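(* Let $\gamma_1,\gamma_2\in\{-1,1\}$ and $\alpha\in\mathbb{R}\setminus\{0\}$ with $\gamma_1\gamma_2-\alpha^2\neq0$, and let $\mathbf{M},\mathbf{F}$ be as in the context. Let $T_0>0$, $\sigma>0$, and let $(r_1^*,v_1^*,r_2^*,v_2^* )\in C\big([0,T_0],G^0_{2\sigma}\big)$ be a solution $\mathbf{u}^*$ of the multiphase Whitham modulation equations $\partial_T\mathbf{u}^*=\mathbf{M}(\mathbf{u}^* )\partial_X\mathbf{u}^*$ with $$\sup_{T\in[0,T_0]}\big\|(r_1^*,v_1^*,r_2^*,v_2^* )(\cdot,T)\big\|_{G^0_{2\sigma}}\le C_{wh}$$ for some positive constant $C_{wh}$. Then there exist positive constants $C_2$, $T_1\le T_0$ and $\varepsilon_0$, and, for every $\varepsilon\in(0,\varepsilon_0)$, a solution $\check{\mathbf{u}}=(\check r_1,\check v_1,\check r_2,\check v_2)(X,T,\varepsilon)$, $T\in[0,T_1]$, of $$\partial_T\check{\mathbf{u}}=\mathbf{M}(\check{\mathbf{u}})\partial_X\check{\mathbf{u}}+\varepsilon^2\mathbf{F}(D_X^3\check{\mathbf{u}}),$$ such that $$\sup_{T\in[0,T_1]}\big\|(\check r_1,\check v_1,\check r_2,\check v_2)(\cdot,T,\varepsilon)-(r_1^*,v_1^*,r_2^*,v_2^* )(\cdot,T)\big\|_{G^0_\sigma}\le C_2\varepsilon^2\qquad\text{for all }\varepsilon\in(0,\varepsilon_0).$$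
   Context: For $s,\sigma\ge 0$ the Gevrey space $G^s_\sigma=G^s_\sigma(\mathbb{R})$ consists of the (scalar- or vector-valued) functions on $\mathbb{R}$ with finite norm $\|\mathbf{u}\|_{G^s_\sigma}:=\big\|e^{\sigma(|\xi|+1)}(1+|\xi|^{2s})^{1/2}\,\widehat{\mathbf{u}}(\xi)\big\|_{L^2}$, where $\widehat{\mathbf{u}}$ is the Fourier transform of $\mathbf{u}$ in $X$. For $\mathbf{u}=(r_1,v_1,r_2,v_2)$, $$\mathbf{M}(\mathbf{u})=\begin{bmatrix}-2v_1&-1&0&0\\ 2\gamma_1e^{2r_1}&-2v_1&2\alpha e^{2r_2}&0\\ 0&0&-2v_2&-1\\ 2\alpha e^{2r_1}&0&2\gamma_2e^{2r_2}&-2v_2\end{bmatrix},\qquad \mathbf{F}(D_X^3\mathbf{u})=\begin{pmatrix}0\\ \partial_X^3r_1+\partial_X(\partial_Xr_1)^2\\0\\ \partial_X^3r_2+\partial_X(\partial_Xr_2)^2\end{pmatrix},$$ where $D_X^3\mathbf{u}=(\mathbf{u},\partial_X\mathbf{u},\partial_X^2\mathbf{u},\partial_X^3\mathbf{u})$. (The $\varepsilon$-equation is the coupled nonlinear Schrödinger system $i\partial_t\Psi_1+\partial_x^2\Psi_1+\gamma_1|\Psi_1|^2\Psi_1+\alpha|\Psi_2|^2\Psi_1=0$, $i\partial_t\Psi_2+\partial_x^2\Psi_2+\alpha|\Psi_1|^2\Psi_2+\gamma_2|\Psi_2|^2\Psi_2=0$ rewritten via $\Psi_j=\exp(r_j+i(\phi_j+(\gamma_j+\alpha)t))$,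 $v_j=\partial_x\phi_j$, $X=\varepsilon x$, $T=\varepsilon t$.) *)

(* Defs.v *)
From HB Require Import structures.
From mathcomp Require Export all_boot all_order all_algebra.
From mathcomp Require Export all_classical all_reals all_analysis.
From mathcomp Require Export complex.

Set Implicit Arguments.
Unset Strict Implicit.
Unset Printing Implicit Defensive.

Export Order.TTheory GRing.Theory Num.Theory.
Export numFieldNormedType.Exports.

Local Open Scope classical_set_scope.
Local Open Scope ring_scope.

Definition component (R : realType) (n : nat) (i : 'I_n) (w : R -> 'cV[R]_n) :
    R -> R := fun X => w X i 0.

Definition cmod (R : realType) (z : R[i]) : R := ComplexField.Normc.normc z.

(** Fourier transform on L^2, in the angular-frequency, unitary convention
    [(2 pi)^(-1/2) * \int u(X) exp(- i xi X) dX]. The normalization constant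
    only rescales the Gevrey norms below. *)

Definition truncated_fourier (R : realType) (n : nat) (u : R -> R) (xi : R) :
    R[i] :=
  Complex
    ((Num.sqrt (pi *+ 2))^-1 *
       \int[lebesgue_measure]_(X in `[- n%:R, n%:R]) (u X * cos (xi * X)))
    (- ((Num.sqrt (pi *+ 2))^-1 *
       \int[lebesgue_measure]_(X in `[- n%:R, n%:R]) (u X * sin (xi * X)))).

(** [g] is a Fourier transform of [u] when both are in L^2 and the transforms
    of the truncations of [u] to [[-n, n]] tend to [g] in L^2. By Plancherel,
    every [u] in L^2 has such a [g], unique up to a null set. *)
Definition is_fourier (R : realType) (u : R -> R) (g : R -> R[i]) : Prop :=
  [/\ u \in Lfun (@lebesgue_measure R) 2%:E,
      (fun xi => complex.Re (g xi)) \in Lfun (@lebesgue_measure R) 2%:E,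
      (fun xi => complex.Im (g xi)) \in Lfun (@lebesgue_measure R) 2%:E &
      Lnorm (@lebesgue_measure R) 2%:E
          (fun xi => (cmod (truncated_fourier n u xi - g xi))%:E)
        @[n --> \oo] --> 0%E].

Definition fourier (R : realType) (u : R -> R) : R -> R[i] :=
  xget (fun=> 0) [set g | is_fourier u g].

Definition gevrey_weight (R : realType) (s sigma xi : R) : R :=
  expR (sigma * (`|xi| + 1)) * Num.sqrt (1 + `|xi| `^ (2 * s)).

(** The norm of [G^s_sigma] on R^n-valued functions, as an extended real: it
    is +oo off the domain of the Fourier transform, so that [G^s_sigma] is
    exactly the set where it is finite. *)
Definition gevrey_norm (R : realType) (n : nat) (s sigma : R)
    (w : R -> 'cV[R]_n) : \bar R :=
  if `[< forall i, exists g, is_fourier (component i w) g >] then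
    Lnorm (@lebesgue_measure R) 2%:E
      (fun xi => (gevrey_weight s sigma xi *
        Num.sqrt (\sum_i cmod (fourier (component i w) xi) ^+ 2))%:E)
  else +oo%E.

Definition in_gevrey (R : realType) (n : nat) (s sigma : R)
    (w : R -> 'cV[R]_n) : Prop :=
  (gevrey_norm s sigma w < +oo)%E.

(** [u] is in C([0, Tm], G^s_sigma); here and below time comes first, and the
    values of [u] at times outside [[0, Tm]] are irrelevant. *)
Definition gevrey_continuous (R : realType) (n : nat) (s sigma Tm : R)
    (u : R -> R -> 'cV[R]_n) : Prop :=
  forall T : R, T \in `[0, Tm] ->
    in_gevrey s sigma (u T) /\
    gevrey_norm s sigma (u S \- u T) @[S --> within `[0, Tm] (nbhs T)]
      --> 0%E.

Definition gevrey_sup_norm (R : realType) (n : nat) (s sigma Tm : R)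
    (u : R -> R -> 'cV[R]_n) : \bar R :=
  ereal_sup [set gevrey_norm s sigma (u T) | T in `[0, Tm]].

(** Time derivative relative to [[0, Tm]]: one-sided at the two endpoints. *)
Definition has_time_derivative (R : realType) (Tm : R) (f : R -> R)
    (T l : R) : Prop :=
  (S - T)^-1 * (f S - f T) @[S --> within `[0, Tm] T^'] --> l.

Definition partialX (R : realType) (n : nat) (w : R -> 'cV[R]_n) (X : R) :
    'cV[R]_n := \col_i derive1 (component i w) X.

(** The unknown is [u = (r1, v1, r2, v2)]. *)
Definition ir1 : 'I_4 := @Ordinal 4 0 isT.
Definition iv1 : 'I_4 := @Ordinal 4 1 isT.
Definition ir2 : 'I_4 := @Ordinal 4 2 isT.
Definition iv2 : 'I_4 := @Ordinal 4 3 isT.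

Definition whitham_mx (R : realType) (gamma1 gamma2 alpha : R)
    (u : 'cV[R]_4) : 'M[R]_4 :=
  let r1 := u ir1 0 in let v1 := u iv1 0 in
  let r2 := u ir2 0 in let v2 := u iv2 0 in
  \matrix_(i, j) nth 0 (nth [::]
   [:: [:: - (2 * v1);                 -1;         0;                          0];
       [:: 2 * gamma1 * expR (2 * r1); - (2 * v1); 2 * alpha * expR (2 * r2);  0];
       [:: 0;                          0;          - (2 * v2);                -1];
       [:: 2 * alpha * expR (2 * r1);  0;          2 * gamma2 * expR (2 * r2);
           - (2 * v2)]] i) j.

Definition dispersive_scalar (R : realType) (r : R -> R) (X : R) : R :=
  derive1n 3 r X + derive1 (fun Y => derive1 r Y ^+ 2) X.

Definition dispersive_term (R : realType) (w : R -> 'cV[R]_4) (X : R) :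
    'cV[R]_4 :=
  \col_i nth 0 [:: 0; dispersive_scalar (component ir1 w) X;
                   0; dispersive_scalar (component ir2 w) X] i.

(** Classical solutions on [[0, Tm]]: the X-derivatives occurring in the
    equation exist, and the equation holds at every point. *)
Definition whitham_solution (R : realType) (gamma1 gamma2 alpha Tm : R)
    (u : R -> R -> 'cV[R]_4) : Prop :=
  forall T X : R, T \in `[0, Tm] -> forall i,
    derivable (component i (u T)) X 1 /\
    has_time_derivative Tm (fun S => u S X i 0) T
      ((whitham_mx gamma1 gamma2 alpha (u T X) *m partialX (u T) X) i 0).

Definition dispersive_whitham_solution (R : realType)
    (gamma1 gamma2 alpha eps Tm : R) (u : R -> R -> 'cV[R]_4) : Prop :=
  forall T X : R, T \in `[0, Tm] -> forall i,
    (forall k, (k < 3)%N -> derivable (derive1n k (component i (u T))) X 1) /\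
    has_time_derivative Tm (fun S => u S X i 0) T
      ((whitham_mx gamma1 gamma2 alpha (u T X) *m partialX (u T) X
         + eps ^+ 2 *: dispersive_term (u T) X) i 0).

(* Main.v *)
From HB Require Import structures.
Require Import Defs.
From mathcomp Require Import measurable_realfun.
From mathcomp Require Import ring lra zify.

(** The whole system is written for Hartley profiles [f], [u = V f] with
    [V f X = \int f(xi) (cos (xi X) + sin (xi X)) dxi], on which products act as
    a symmetrized convolution [star] and d/dX as [D].

    By Plancherel, duality and the equation, the profiles of [ustar T] are
    Lipschitz in time in a weighted L^2 space. A Kolmogorov-type chaining argument
    upgrades this to profiles that are continuous in time at each frequency and
    are dominated, uniformly in time, by [m xi * exp (- rho <xi>)] with a
    majorant [m] satisfying [m * m <= A m] (convolution), where [<xi> = 1 + |xi|]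
    and [rho > sigma].

    Take [q_j = eps dX r_j] as additional unknowns. The terms [eps^2 dX^3 r_j]
    and [eps^2 dX ((dX r_j)^2)] become [eps dX^2 q_j] and [dX (q_j^2)], and
    [q_j] satisfies [dT q_j = - eps dX^2 v_j - 2 dX (v_j q_j)]. The [eps] terms
    act on [(q_j, v_j)], at each frequency, as the rotation of speed
    [eps xi^2], which is solved exactly and preserves pointwise bounds; all of
    the remaining terms lose one derivative only. They are handled by a
    Cauchy-Kovalevskaya iteration in the shrinking strip [rho - kappa T], where
    time integration gains [1 / (kappa <xi>)]. The perturbation [u - ustar]
    starts from zero and its only source, the residual of [ustar], is
    [O(eps^2)]. *)

Set Implicit Arguments.
Unset Strict Implicit.
Unset Printing Implicit Defensive.

Local Open Scope classical_set_scope.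
Local Open Scope ring_scope.

(** * Integration on the real line *)

(** The Whitham equation is given pointwise in physical space, whereas the profiles of [ustar T]
    come from L^2 data and are defined up to null sets that may depend on [T]. The iteration,
    however, solves a separate ordinary differential equation at each frequency, with coefficients
    that must be continuous in time there. This is the gap that the chaining argument closes.
    Pointwise bounds in frequency replace norms, so that only real-valued time integrals occur and
    the rotation costs a constant independent of [eps] and of the frequency. The profiles of [ustar]
    are not shown to solve an equation in frequency: only the perturbation does, and its time
    derivative is added in physical space to the one given by the Whitham equation.

    The widths decrease from [2 sigma] as follows: [15 sigma / 8] and [7 sigma / 4] for the
    right-hand side of the Whitham system, [3 sigma / 2] for the dominated profiles and three of
    their derivatives, at least [5 sigma / 4] throughout the shrinking strip, and [sigma] in the
    conclusion. *)

HB.lock Definition itg {R : realType} (f : R -> R) : R :=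
  \int[@lebesgue_measure R]_x f x.

Section Integrals.
Context {R : realType}.
Notation mu := (@lebesgue_measure R).
Implicit Types f g h : R -> R.

Definition intg f := mu.-integrable [set: R] (EFin \o f).

Lemma eq_itg f g : f =1 g -> itg f = itg g.
Proof. by move=> fg; congr itg; apply/funext. Qed.

Lemma intg_meas f : intg f -> measurable_fun [set: R] f.
Proof. by move=> /integrableP[/measurable_EFinP]. Qed.

Lemma intgD f g : intg f -> intg g -> intg (fun x => f x + g x).
Proof. by move=> ? ?; rewrite /intg /comp; under eq_fun do rewrite EFinD; exact: integrableD. Qed.

Lemma intgB f g : intg f -> intg g -> intg (fun x => f x - g x).
Proof. by move=> ? ?; rewrite /intg /comp; under eq_fun do rewrite EFinB; exact: integrableB. Qed.

Lemma intgZ c f : intg f -> intg (fun x => c * f x).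
Proof. by move=> ?; rewrite /intg /comp; under eq_fun do rewrite EFinM; exact: integrableZl. Qed.

Lemma intg_le f g : measurable_fun [set: R] f -> (forall x, `|f x| <= g x) ->
  intg g -> intg f.
Proof.
move=> mf fg ig; apply: (le_integrable measurableT _ _ ig).
- exact/measurable_EFinP.
- by move=> x _ /=; rewrite lee_fin (le_trans (fg x))// ler_norm.
Qed.

Lemma intg_abs f : intg f -> intg (fun x => `|f x|).
Proof.
move=> fi; rewrite /intg (_ : _ \o _ = abse \o (EFin \o f)) //.
exact: integrable_abse.
Qed.

Lemma intg_sum n (F : 'I_n -> R -> R) : (forall i, intg (F i)) ->
  intg (fun x => \sum_(i < n) F i x).
Proof.
elim: n F => [|n IH] F Fi.
  rewrite /intg; under eq_fun do rewrite /= big_ord0; exact: integrable0.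
under eq_fun do rewrite big_ord_recl.
by apply: intgD => //; apply: IH.
Qed.

Lemma itgD f g : intg f -> intg g -> itg (fun x => f x + g x) = itg f + itg g.
Proof. by move=> ? ?; rewrite !itg.unlock RintegralD. Qed.

Lemma itgB f g : intg f -> intg g -> itg (fun x => f x - g x) = itg f - itg g.
Proof. by move=> ? ?; rewrite !itg.unlock RintegralB. Qed.

Lemma itgZ c f : intg f -> itg (fun x => c * f x) = c * itg f.
Proof. by move=> ?; rewrite !itg.unlock RintegralZl. Qed.

Lemma itg_sum n (F : 'I_n -> R -> R) : (forall i, intg (F i)) ->
  itg (fun x => \sum_(i < n) F i x) = \sum_(i < n) itg (F i).
Proof.
elim: n F => [|n IH] F Fi.
  rewrite big_ord0 itg.unlock /Rintegral; under eq_integral do rewrite big_ord0.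
  by rewrite integral0.
rewrite big_ord_recl -IH// -itgD//; last exact: intg_sum.
by apply: eq_itg => x; rewrite big_ord_recl.
Qed.

Lemma itg_le f g : intg f -> intg g -> (forall x, f x <= g x) -> itg f <= itg g.
Proof. by move=> fi gi fg; rewrite itg.unlock; apply: le_Rintegral. Qed.

Lemma itg_ge0 f : (forall x, 0 <= f x) -> 0 <= itg f.
Proof. by move=> f0; rewrite itg.unlock; apply: Rintegral_ge0. Qed.

Lemma itg_abs f : intg f -> `|itg f| <= itg (fun x => `|f x|).
Proof. by move=> fi; rewrite itg.unlock; apply: le_normr_Rintegral. Qed.

Lemma itg_abs_le f g : measurable_fun [set: R] f -> intg g ->
  (forall x, `|f x| <= g x) -> `|itg f| <= itg g.
Proof.
move=> mf gi fg; have fi := intg_le mf fg gi.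
by rewrite (le_trans (itg_abs fi))// itg_le//; exact: intg_abs.
Qed.

Lemma EFin_itg f : intg f -> (itg f)%:E = (\int[mu]_x (f x)%:E)%E.
Proof. by move=> fi; rewrite !itg.unlock /Rintegral fineK// integrable_fin_num. Qed.

Lemma intg_lty f : measurable_fun [set: R] f -> (forall x, 0 <= f x) ->
  (\int[mu]_x (f x)%:E < +oo)%E -> intg f.
Proof.
move=> mf f0 fy; apply/integrableP; split; first exact/measurable_EFinP.
by under eq_integral do rewrite /= ger0_norm//.
Qed.

Lemma itg_ae_eq (f g : R -> R) : measurable_fun [set: R] g -> intg f ->
  {ae mu, forall x : measurableTypeR R, f x = g x} -> intg g /\ itg g = itg f.
Proof.
move=> mg fi fg.
have ae : ae_eq mu setT (EFin \o f) (EFin \o g) by move: fg; apply: filterS => x /= ->.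
have mf := intg_meas fi.
have gi : intg g.
  apply/integrableP; split; first exact/measurable_EFinP.
  move: fi => /integrableP[_]; congr (_ < _)%E.
  apply: ae_eq_integral => //.
  - by apply/measurable_EFinP; exact: measurableT_comp.
  - by apply/measurable_EFinP; exact: measurableT_comp.
  - by move: ae; apply: filterS => x h /h /= [->].
split => //; rewrite !itg.unlock /Rintegral; congr fine; apply/esym/ae_eq_integral => //.
- exact/measurable_EFinP.
- exact/measurable_EFinP.
Qed.

(** Convergence is asked at every point: profiles are handled as genuine functions, and exceptional
    points are removed beforehand. *)
Lemma itg_dct (F : nat -> R -> R) f g : (forall n, measurable_fun [set: R] (F n)) ->
  (forall n x, `|F n x| <= g x) -> intg g ->
  (forall x, F n x @[n --> \oo] --> f x) ->
  intg f /\ itg (F n) @[n --> \oo] --> itg f.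
Proof.
move=> mF Fg gi Ff.
have mf : measurable_fun [set: R] f.
  by apply: (@measurable_fun_cvg _ _ _ _ F) => // x _; exact: Ff.
have Ff' x : [set: R] x -> (fun n => (F n x)%:E) @ \oo --> (EFin \o f) x.
  by move=> _; apply: cvg_EFin; [exact: nearW|exact: Ff].
have [|||||fi _ Fi] := @dominated_convergence _ _ _ mu _ measurableT
  (fun n x => (F n x)%:E) (EFin \o f) (EFin \o g).
- by move=> n; apply/measurable_EFinP; exact: mF.
- exact/measurable_EFinP.
- exact: aeW.
- exact: gi.
- by apply: aeW => x n _; exact: Fg.
have Fin n : intg (F n) by exact: intg_le (mF n) (Fg n) gi.
split => //; apply: (@fine_cvg _ _ _ _ (fun n => (itg (F n))%:E)); rewrite EFin_itg//.
rewrite (_ : (fun n => _) = (fun n => (\int[mu]_x (F n x)%:E)%E)); first exact: Fi.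
by apply/funext => n; rewrite EFin_itg.
Qed.

(** Tonelli turns [G] into integrability on the product, since the iterated integral of the absolute
    value is at most [itg G]. Sections are integrable at every point, so that the inner [itg] is a
    true integral everywhere and no null set of sections has to be discarded. *)
Lemma itg_fubini (F : R * R -> R) (G : R -> R) : measurable_fun [set: R * R] F ->
  (forall x, intg (fun y => F (x, y))) -> (forall y, intg (fun x => F (x, y))) ->
  intg G -> (forall y, itg (fun x => `|F (x, y)|) <= G y) ->
  [/\ intg (fun x => itg (fun y => F (x, y))), intg (fun y => itg (fun x => F (x, y))) &
  itg (fun x => itg (fun y => F (x, y))) = itg (fun y => itg (fun x => F (x, y)))].
Proof.
move=> mF F1 F2 Gi FG.
have mF' : measurable_fun [set: R * R] (EFin \o F) by exact/measurable_EFinP.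
have iF : (mu \x mu)%E.-integrable [set: R * R] (EFin \o F).
  apply: (iffRL (@integrable21ltyP _ _ _ _ _ mu mu (EFin \o F) mF')).
  rewrite (_ : (fun y => _) = (fun y => (itg (fun x => `|F (x, y)|))%:E)).
    apply: (@le_lt_trans _ _ (\int[mu]_y (G y)%:E)%E); last first.
      by rewrite -EFin_itg// ltry.
    apply: ge0_le_integral => //.
    - by move=> y _; rewrite lee_fin itg_ge0.
    - have := @measurable_fun_fubini_tonelli_G _ _ _ _ _ mu (abse \o (EFin \o F))
        (measurableT_comp (@abse_measurable R _) mF') (fun z => abse_ge0 (EFin (F z))).
      apply: eq_measurable_fun => y _; rewrite /fubini_G EFin_itg//.
      exact: intg_abs.
    - by apply/measurable_EFinP; exact: intg_meas.
    - by move=> y _; rewrite lee_fin.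
  by apply/funext => y; rewrite EFin_itg//; exact: intg_abs.
have E1 : fubini_F mu (EFin \o F) = (fun x => (itg (fun y => F (x, y)))%:E).
  by apply/funext => x; rewrite /fubini_F EFin_itg.
have E2 : fubini_G mu (EFin \o F) = (fun y => (itg (fun x => F (x, y)))%:E).
  by apply/funext => x; rewrite /fubini_G EFin_itg.
have i1 : intg (fun x => itg (fun y => F (x, y))).
  apply: (eq_integrable measurableT) (integrable_fubini_F iF) => x _.
by rewrite /= EFin_itg.
have i2 : intg (fun y => itg (fun x => F (x, y))).
  apply: (intg_le _ _ Gi) => [|y]; last exact: (le_trans (itg_abs (F2 y)) (FG y)).
  apply/measurable_EFinP; apply: eq_measurable_fun (measurable_fubini_G iF) => y _.
  by rewrite /= EFin_itg.
split => //; apply: EFin_inj; rewrite !EFin_itg//.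
under eq_integral do rewrite EFin_itg//.
under [in RHS]eq_integral do rewrite EFin_itg//.
exact: Fubini iF.
Qed.

Lemma itg_fubini_prod (F : R * R -> R) (a b : R -> R) : measurable_fun [set: R * R] F ->
  intg a -> intg b -> (forall x y, `|F (x, y)| <= a x * b y) ->
  [/\ intg (fun x => itg (fun y => F (x, y))), intg (fun y => itg (fun x => F (x, y))) &
  itg (fun x => itg (fun y => F (x, y))) = itg (fun y => itg (fun x => F (x, y)))].
Proof.
move=> mF ia ib Fab.
have mF1 x : measurable_fun [set: R] (fun y => F (x, y)).
  exact: (measurableT_comp mF).
have mF2 y : measurable_fun [set: R] (fun x => F (x, y)).
  exact: (measurableT_comp mF).
have F2 y : intg (fun x => F (x, y)).
  by apply: (intg_le (g := fun x => b y * a x)) => // [x|]; [rewrite mulrC Fab|exact: intgZ].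
apply: (itg_fubini (G := fun y => itg a * b y)) => //.
- by move=> x; apply: (intg_le (g := fun y => a x * b y)) => //; exact: intgZ.
- exact: intgZ.
- move=> y; rewrite mulrC -itgZ//; apply: itg_le; first exact: intg_abs.
  + exact: intgZ.
  + by move=> x; rewrite mulrC Fab.
Qed.

(** Packages the image measure as a bundled measure, the form in which uniqueness of the Lebesgue
    measure and integration against an image measure apply. *)
Lemma pushforward_measure (phi : measurableTypeR R -> measurableTypeR R) :
  measurable_fun [set: measurableTypeR R] phi ->
  exists m : {measure set (measurableTypeR R) -> \bar R}, (m : set R -> \bar R) = pushforward mu phi.
Proof. by move=> mphi; unshelve eexists (pushforward mu phi : {measure set (measurableTypeR R) -> \bar R}). Qed.

Section ChangeOfVariables.
Variables (phi : measurableTypeR R -> measurableTypeR R) (c : R).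
Hypotheses (mphi : measurable_fun [set: measurableTypeR R] phi) (c0 : 0 < c).
Hypothesis muphi : forall A, measurable A -> mu A = (c%:E * mu (phi @^-1` A))%E.

(** By [muphi], Lebesgue measure is [c] times its own image under [phi]; integrating a nonnegative
    function against both gives the formula. *)
Let cv_ge0 f : measurable_fun [set: R] f -> (forall x, 0 <= f x) ->
  (\int[mu]_x (f x)%:E = c%:E * \int[mu]_x (f (phi x))%:E)%E.
Proof.
move=> mf f0.
have [m mE] := pushforward_measure mphi.
transitivity (\int[mscale (NngNum (ltW c0)) m]_x (f x)%:E)%E.
  apply: eq_measure_integral => A mA _.
  transitivity (c%:E * mu (phi @^-1` A))%E; first exact: muphi.
  change (c%:E * mu (phi @^-1` A) = c%:E * m A)%E.
  by rewrite mE.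
have mf' : measurable_fun [set: measurableTypeR R] (EFin \o f) by exact/measurable_EFinP.
rewrite (ge0_integral_mscale m measurableT _ (f := EFin \o f))//; last by move=> x _; rewrite lee_fin.
transitivity (c%:E * \int[mu]_(x in phi @^-1` setT) ((EFin \o f) \o phi) x)%E => //.
congr *%E; apply: (etrans _ (ge0_integral_pushforward mphi _ measurableT mf' _)).
  apply: eq_measure_integral => A mA _.
  exact: (congr1 (fun k => k A) mE).
by move=> x _; rewrite lee_fin.
Qed.

Lemma intg_cv f : intg f -> intg (fun x => f (phi x)).
Proof.
move=> fi; have mf := intg_meas fi.
have mfp : measurable_fun [set: R] (fun x => f (phi x)) by exact: (measurableT_comp mf).
apply/integrableP; split; first exact/measurable_EFinP.
have : (\int[mu]_x (`|f x|)%:E < +oo)%E by move: fi => /integrableP[].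
rewrite cv_ge0//; last exact: measurableT_comp.
rewrite !ltey; apply: contra => /eqP; rewrite /= => ->.
by rewrite mulry gtr0_sg// mul1e.
Qed.

Lemma itg_cv f : intg f -> itg f = c * itg (fun x => f (phi x)).
Proof.
move=> fi; have mf := intg_meas fi.
have ge0 g : intg g -> (forall x, 0 <= g x) -> itg g = c * itg (fun x => g (phi x)).
  move=> gi g0; apply: EFin_inj; rewrite EFinM !EFin_itg//; last exact: intg_cv.
  by rewrite cv_ge0//; exact: intg_meas.
(* A general [f] is the difference of the nonnegative functions [|f|] and [|f| - f]. *)
have h x : 0 <= `|f x| - f x by rewrite subr_ge0 ler_norm.
have := ge0 _ (intgB (intg_abs fi) fi) h.
have := ge0 _ (intg_abs fi) (fun x => normr_ge0 _).
have ai := intg_abs fi.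
rewrite !itgB//; [|exact: (intg_cv ai)|exact: intg_cv].
by move=> ->; rewrite mulrBr => /addrI /oppr_inj.
Qed.

End ChangeOfVariables.

(** The scaled image measure agrees with length on half-open intervals; uniqueness of the Lebesgue
    measure does the rest. *)
Lemma mu_scale (c d : R) : 0 < c -> forall A, measurable A ->
  mu A = (c%:E * mu ((fun x : R => c * x + d)%R @^-1` A))%E.
Proof.
move=> c0 A mA.
pose phi : measurableTypeR R -> measurableTypeR R := fun x : R => c * x + d.
have ms : measurable_fun [set: R] phi.
  by apply: measurable_funD => //; exact: mulrl_measurable.
have [m mE] := pushforward_measure ms.
transitivity (mscale (NngNum (ltW c0)) m A); last by rewrite /mscale/= mE.
apply: lebesgue_measure_unique => //= _ [[a b]] _ <-.
rewrite /mscale /= mE /pushforward.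
rewrite (_ : _ @^-1` _ = `](a - d) / c, (b - d) / c]%classic); last first.
  by apply/seteqP; split=> x /=; rewrite !in_itv/= ltr_pdivrMr// ler_pdivlMr// ltrBlDr lerBrDr (mulrC x).
rewrite !lebesgue_measure_itv/= !lte_fin ltr_pM2r ?invr_gt0// ltrD2r.
case: ifPn => _; last by rewrite mule0.
by rewrite -EFinM -mulrBl mulrC divfK ?gt_eqF// opprD opprK; congr EFin; ring.
Qed.

Lemma mu_opp A : measurable A -> mu A = (1%:E * mu ((fun x : R => - x)%R @^-1` A))%E.
Proof. by move=> mA; rewrite mul1e -[LHS]lebesgue_measureN. Qed.

Let maff (c d : R) : measurable_fun [set: R] (fun x : R => c * x + d).
Proof. by apply: measurable_funD => //; exact: mulrl_measurable. Qed.

Lemma intg_aff c d f : 0 < c -> intg f -> intg (fun x => f (c * x + d)).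
Proof. by move=> c0 fi; apply: (intg_cv (maff c d) c0 (mu_scale d c0)). Qed.

Lemma itg_aff c d f : 0 < c -> intg f -> itg f = c * itg (fun x => f (c * x + d)).
Proof. by move=> c0 fi; apply: (itg_cv (maff c d) c0 (mu_scale d c0)). Qed.

Lemma intg_opp f : intg f -> intg (fun x => f (- x)).
Proof. by move=> fi; apply: (intg_cv (@oppr_measurable R _) ltr01 mu_opp). Qed.

Lemma itg_opp f : intg f -> itg (fun x => f (- x)) = itg f.
Proof. by move=> fi; rewrite (itg_cv (@oppr_measurable R _) ltr01 mu_opp fi) mul1r. Qed.

Lemma intg_sub d f : intg f -> intg (fun x => f (x - d)).
Proof.
by move=> fi; have := intg_aff (- d) ltr01 fi; under eq_fun do rewrite mul1r.
Qed.

Lemma itg_sub d f : intg f -> itg (fun x => f (x - d)) = itg f.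
Proof.
move=> fi; have := itg_aff (- d) ltr01 fi; rewrite mul1r.
by under eq_fun do rewrite mul1r.
Qed.

Lemma intg_rsub d f : intg f -> intg (fun x => f (d - x)).
Proof. by move=> fi; have := intg_sub d (intg_opp fi); under eq_fun do rewrite opprB. Qed.

Lemma itg_rsub d f : intg f -> itg (fun x => f (d - x)) = itg f.
Proof.
move=> fi; rewrite -[RHS](itg_opp fi) -[RHS](itg_sub d (intg_opp fi)).
by apply: eq_itg => x; rewrite opprB.
Qed.

End Integrals.

Section Fatou.
Context {R : realType}.
Notation mu := (@lebesgue_measure R).

Lemma cvg_ge_cst (u : nat -> R) l c : (forall n, c <= u n) -> u @ \oo --> l -> c <= l.
Proof.
move=> h ul; rewrite -(cvg_lim _ ul)//; apply: limr_ge; first exact: cvgP ul.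
exact: nearW.
Qed.

Lemma cvg_le_cst (u : nat -> R) l c : (forall n, u n <= c) -> u @ \oo --> l -> l <= c.
Proof.
move=> h ul; rewrite -(cvg_lim _ ul)//; apply: limr_le; first exact: cvgP ul.
exact: nearW.
Qed.

Lemma cvg_squeeze0 {T : Type} {F : set_system T} {FF : Filter F} (f g : T -> R) :
  (forall x, `|f x| <= g x) -> g @ F --> 0 -> f @ F --> 0.
Proof.
move=> fg g0; apply/cvgrPdist_le => e e0.
move/cvgrPdist_le : g0 => /(_ e e0); apply: filterS => x.
by rewrite !sub0r !normrN => h; apply: le_trans (fg x) (le_trans (ler_norm _) h).
Qed.

(** Converts uniform bounds on approximations into integrability of the limit, where no dominating
    function is at hand. It puts [V f] in L^2 and removes the truncation in [profile_lipschitz]. *)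
Lemma itg_fatou (F : nat -> R -> R) f C : (forall n x, 0 <= F n x) ->
  (forall n, intg (F n)) -> (forall x, F n x @[n --> \oo] --> f x) ->
  (forall n, itg (F n) <= C) -> intg f /\ itg f <= C.
Proof.
move=> F0 Fi Ff FC.
have f0 x : 0 <= f x by apply: (@cvg_ge_cst (F ^~ x)).
have mf : measurable_fun [set: R] f.
  by apply: (@measurable_fun_cvg _ _ _ _ F) => [n|x _]; [exact: intg_meas|exact: Ff].
have key : (\int[mu]_x (f x)%:E <= C%:E)%E.
  have E : (\int[mu]_x (f x)%:E = \int[mu]_x limn_einf (fun n => (F n x)%:E))%E.
    apply: eq_integral => x _; apply/esym.
    have h : (F n x)%:E @[n --> \oo] --> (f x)%:E by apply: cvg_EFin; [exact: nearW|exact: Ff].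
    exact: (cvg_limn_einf_sup h).1.
  rewrite E; apply: (le_trans (fatou mu measurableT _ _)).
  - by move=> n; apply/measurable_EFinP; exact: (intg_meas (Fi n)).
  - by move=> n x _; rewrite lee_fin.
  - rewrite limn_einf_lim; apply: lime_le; first exact: is_cvg_einfs.
    apply: nearW => n; apply: (@le_trans _ _ (itg (F n))%:E); last by rewrite lee_fin.
    by rewrite EFin_itg//; apply: ereal_inf_lbound; exists n => /=.
have fi : intg f by apply: intg_lty => //; apply: le_lt_trans key _; rewrite ltry.
by split=> //; rewrite -lee_fin EFin_itg.
Qed.

(** Two exceptional points suffice because the test functions are continuous functions cut to an
    interval, which can only jump at its endpoints. *)
Lemma itg_eq_off2 (p q : R) (f g : R -> R) : intg f -> measurable_fun [set: R] g ->
  (forall x, x != p -> x != q -> f x = g x) -> intg g /\ itg g = itg f.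
Proof.
move=> fi mg fg; apply: itg_ae_eq => //.
apply: (@negligibleS _ _ _ mu ([set p] `|` [set q])); last first.
  apply: negligibleU.
  - by exists [set p]; split => //; exact: lebesgue_measure_set1.
  - by exists [set q]; split => //; exact: lebesgue_measure_set1.
move=> x /= h; have [->|xp] := eqVneq x p; first by left.
have [->|xq] := eqVneq x q; first by right.
by exfalso; apply: h; exact: fg.
Qed.
End Fatou.

(** * Square-integrable functions and the Cauchy-Schwarz inequality *)

Section SquareIntegrable.
Context {R : realType}.
Implicit Types f g h : R -> R.

Definition sqi f := measurable_fun [set: R] f /\ intg (fun x => f x ^+ 2).

Lemma sqiM f g : sqi f -> sqi g -> intg (fun x => f x * g x).
Proof.
move=> [mf f2] [mg g2]; apply: (intg_le _ _ (intgD f2 g2)).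
  exact: measurable_funM.
move=> x; rewrite ler_norml; apply/andP; split; nra.
Qed.

Lemma sqi_le f g : measurable_fun [set: R] f -> (forall x, `|f x| <= `|g x|) -> sqi g -> sqi f.
Proof.
move=> mf fg [mg g2]; split=> //; apply: (intg_le _ _ g2).
  exact: measurable_funX.
by move=> x; rewrite ger0_norm ?sqr_ge0// -[leLHS]real_normK ?num_real// -[leRHS]real_normK ?num_real// lerXn2r// nnegrE.
Qed.

Lemma sqiZ c f : sqi f -> sqi (fun x => c * f x).
Proof.
move=> [mf f2]; split; first exact: measurable_funM.
by under eq_fun do rewrite exprMn; exact: intgZ.
Qed.

Lemma sqiD f g : sqi f -> sqi g -> sqi (fun x => f x + g x).
Proof.
move=> fs gs; case: (fs) => mf f2; case: (gs) => mg g2.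
split; first exact: measurable_funD.
under eq_fun do rewrite sqrrD; apply: intgD => //; apply: intgD => //.
by under eq_fun do rewrite -mulr_natl; apply: intgZ; exact: sqiM.
Qed.

Lemma sqiB f g : sqi f -> sqi g -> sqi (fun x => f x - g x).
Proof.
by move=> fs gs; under eq_fun do rewrite -mulN1r; apply: sqiD => //; exact: sqiZ.
Qed.

Lemma itg_sqD f g c : sqi f -> sqi g ->
  itg (fun x => (f x + c * g x) ^+ 2) =
  itg (fun x => f x ^+ 2) + 2 * c * itg (fun x => f x * g x) + c ^+ 2 * itg (fun x => g x ^+ 2).
Proof.
move=> fs gs; have fg := sqiM fs gs; case: (fs) => mf f2; case: (gs) => mg g2.
rewrite -itgZ// -(itgZ (c ^+ 2))// -itgD//; last exact: intgZ.
rewrite -itgD//; [|by apply: intgD => //; exact: intgZ|exact: intgZ].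
by apply: eq_itg => x; ring.
Qed.

(** The quadratic [t -> itg ((f + t g)^2)] is nonnegative; its value at the minimum is the
    inequality. *)
Lemma itg_CS f g : sqi f -> sqi g ->
  itg (fun x => f x * g x) ^+ 2 <= itg (fun x => f x ^+ 2) * itg (fun x => g x ^+ 2).
Proof.
move=> fs gs.
have h t : 0 <= itg (fun x => f x ^+ 2) + 2 * t * itg (fun x => f x * g x) + t ^+ 2 * itg (fun x => g x ^+ 2).
  by rewrite -itg_sqD//; apply: itg_ge0 => x; exact: sqr_ge0.
have a0 : 0 <= itg (fun x => g x ^+ 2) by apply: itg_ge0 => x; exact: sqr_ge0.
move: (itg _) (itg _) (itg _) h a0 => c b a h c0.
have [c1|] := eqVneq c 0.
  have [->|b0] := eqVneq b 0; first by rewrite expr0n c1 mulr0.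
  (* For [c = 0] the quadratic is affine in [t]; this [t] gives it the value -1, a contradiction. *)
  have := h (- (a + 1) / (2 * b)); rewrite c1.
  suff -> : 2 * (- (a + 1) / (2 * b)) * b = - (a + 1) by lra.
  by field.
move=> cn; have {}c0 : 0 < c by rewrite lt_neqAle eq_sym cn.
have := h (- b / c).
have -> : a + 2 * (- b / c) * b + (- b / c) ^+ 2 * c = a - b ^+ 2 / c by field.
by rewrite subr_ge0 ler_pdivrMr.
Qed.

Lemma itg_CS_sqrt f g : sqi f -> sqi g ->
  `|itg (fun x => f x * g x)| <= Num.sqrt (itg (fun x => f x ^+ 2)) * Num.sqrt (itg (fun x => g x ^+ 2)).
Proof.
move=> fs gs; rewrite -sqrtrM; last by apply: itg_ge0 => x; exact: sqr_ge0.
by rewrite -sqrtr_sqr ler_sqrt ?itg_CS// mulr_ge0 ?itg_ge0// => x; exact: sqr_ge0.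
Qed.

Lemma itgM_cvg (F : nat -> R -> R) f g : (forall n, sqi (F n)) -> sqi f -> sqi g ->
  itg (fun x => (F n x - f x) ^+ 2) @[n --> \oo] --> 0 ->
  itg (fun x => F n x * g x) @[n --> \oo] --> itg (fun x => f x * g x).
Proof.
move=> Fs fs gs Ff; apply/cvgrPdist_le => e e0.
have B0 : 0 <= itg (fun x => g x ^+ 2) by apply: itg_ge0 => x; exact: sqr_ge0.
move: (itg (fun x => g x ^+ 2)) (@itg_CS) B0 => _ _ _.
(* The extra 1 keeps the denominator positive when [g] vanishes. *)
pose B := itg (fun x => g x ^+ 2) + 1.
have B0 : 0 < B by rewrite ltr_wpDl// itg_ge0// => x; exact: sqr_ge0.
have d0 : 0 < e ^+ 2 / B by rewrite divr_gt0// exprn_gt0.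
move/cvgrPdist_le: Ff => /(_ _ d0); apply: filterS => n.
rewrite sub0r normrN ger0_norm => [le1|]; last by apply: itg_ge0 => x; exact: sqr_ge0.
rewrite distrC -itgB; [|exact: sqiM|exact: sqiM].
rewrite (_ : (fun x => _) = (fun x => (F n x - f x) * g x)); last by apply/funext => x; ring.
rewrite -ler_sqr ?nnegrE//; last exact: ltW.
rewrite real_normK ?num_real//.
apply: le_trans (itg_CS (sqiB (Fs n) fs) gs) _.
rewrite -[leRHS](divfK (lt0r_neq0 B0)); apply: ler_pM => //.
- by apply: itg_ge0 => x; exact: sqr_ge0.
- by apply: itg_ge0 => x; exact: sqr_ge0.
- by rewrite /B lerDl.
Qed.

End SquareIntegrable.

(** * Hartley transform and Plancherel identity *)

Section Hartley.
Context {R : realType}.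
Notation mu := (@lebesgue_measure R).
Implicit Types f g h : R -> R.

Definition cas (x : R) := cos x + sin x.

Lemma cas_le2 x : `|cas x| <= 2.
Proof.
rewrite (le_trans (ler_normD _ _))// (_ : 2 = 1 + 1)//.
by rewrite lerD ?cos_le1' ?sin_le1'// ler_norml ?cos_le1 ?cos_geN1 ?sin_le1 ?sin_geN1.
Qed.

Lemma continuous_cas : continuous cas.
Proof. by move=> x; apply: cvgD; [exact: continuous_cos|exact: continuous_sin]. Qed.

Lemma measurable_cas : measurable_fun [set: R] cas.
Proof. exact: continuous_measurable_fun continuous_cas. Qed.

Lemma measurable_casM (c : R) : measurable_fun [set: R] (fun x => cas (x * c)).
Proof.
apply: continuous_measurable_fun => x; apply: (@continuous_comp _ _ _ (fun x : R => x * c) cas).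
  exact: mulrr_continuous.
exact: continuous_cas.
Qed.

(** The Hartley substitute for multiplicativity of the exponential. The cosine sees the difference
    of the frequencies and the sine their sum, whence the two convolutions in [star]. *)
Lemma cas_mul a b : cas a * cas b = cos (a - b) + sin (a + b).
Proof. by rewrite /cas cosB sinD; ring. Qed.

(* Hartley transform; [f] is the profile of [V f]. Real-valued functions have
   real profiles, so that all of the nonlinear analysis below is real. *)
Definition V f (X : R) := itg (fun xi => f xi * cas (xi * X)).

Lemma intg_cas f X : intg f -> intg (fun xi => f xi * cas (xi * X)).
Proof.
move=> fi; apply: (intg_le _ _ (intgZ 2 (intg_abs fi))).
  by apply: measurable_funM; [exact: intg_meas|exact: measurable_casM].
by move=> x; rewrite normrM mulrC ler_wpM2r// cas_le2.
Qed.

Lemma VD f g : intg f -> intg g -> V (fun x => f x + g x) = (fun X => V f X + V g X).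
Proof.
move=> fi gi; apply/funext => X; rewrite /V -itgD; [|exact: intg_cas..].
by apply: eq_itg => x; rewrite mulrDl.
Qed.

Lemma VB f g : intg f -> intg g -> V (fun x => f x - g x) = (fun X => V f X - V g X).
Proof.
move=> fi gi; apply/funext => X; rewrite /V -itgB; [|exact: intg_cas..].
by apply: eq_itg => x; rewrite mulrBl.
Qed.

Lemma VZ c f : intg f -> V (fun x => c * f x) = (fun X => c * V f X).
Proof.
move=> fi; apply/funext => X; rewrite /V -itgZ; [|exact: intg_cas..].
by apply: eq_itg => x; rewrite mulrA.
Qed.

Lemma V_le f X : intg f -> `|V f X| <= 2 * itg (fun x => `|f x|).
Proof.
move=> fi; rewrite -itgZ; last exact: intg_abs.
apply: itg_abs_le; last by move=> x; rewrite normrM mulrC ler_wpM2r// cas_le2.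
  exact: intg_meas (intg_cas _ fi).
exact/intgZ/intg_abs.
Qed.

Lemma continuous_V f : intg f -> continuous (V f).
Proof.
move=> fi X.
have -> : V f = fun l => \int[mu]_(x in setT) (f x * cas (x * l)).
  by apply/funext => l; rewrite /V itg.unlock.
have := @continuity_under_integral R _ _ mu (fun X xi => f xi * cas (xi * X)) setT measurableT
  (X - 1) (X + 1) (fun x _ => intg_cas x fi) _ (fun x => 2 * `|f x|) (intgZ 2 (intg_abs fi)).
apply.
- apply: aeW => y _ x _; apply: cvgM; first exact: cvg_cst.
  apply: (continuous_comp (f := fun x => y * x)); first exact: mulrl_continuous.
  exact: continuous_cas.
- by move=> x _; apply: aeW => y _; rewrite normrM mulrC ler_wpM2r// cas_le2.
- by rewrite inE/= in_itv/=; apply/andP; split; lra.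
Qed.

Lemma measurable_V f : intg f -> measurable_fun [set: R] (V f).
Proof. by move=> fi; exact: continuous_measurable_fun (continuous_V fi). Qed.

Lemma intg_mulb f g c : intg f -> measurable_fun [set: R] g -> (forall x, `|g x| <= c) ->
  intg (fun x => f x * g x).
Proof.
move=> fi mg gc; apply: (intg_le _ _ (intgZ c (intg_abs fi))).
  by apply: measurable_funM => //; exact: intg_meas.
by move=> x; rewrite normrM mulrC ler_wpM2r.
Qed.

Lemma intg_VM f k : intg f -> intg k -> intg (fun X => V f X * k X).
Proof.
move=> fi ki; under eq_fun do rewrite mulrC.
by apply: (intg_mulb ki (measurable_V fi)) => x; exact: V_le.
Qed.

(** The kernel [cas (xi * X)] is symmetric in frequency and position, so [V] is its own
    transpose. *)
Lemma V_adjoint f k : intg f -> intg k ->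
  itg (fun X => V f X * k X) = itg (fun xi => f xi * V k xi).
Proof.
move=> fi ki.
have mf := intg_meas fi; have mk := intg_meas ki.
pose F (z : R * R) := f z.2 * cas (z.2 * z.1) * k z.1.
have [||_ _] := @itg_fubini_prod R F (fun X => 2 * `|k X|) (fun x => `|f x|) _ (intgZ 2 (intg_abs ki)) (intg_abs fi) _.
- apply: measurable_funM; last exact: (measurableT_comp mk).
  apply: measurable_funM; first exact: (measurableT_comp mf).
  apply: (measurableT_comp measurable_cas).
  by apply: measurable_funM.
- move=> x y; rewrite /F /= !normrM mulrAC mulrC (mulrC `|f y|).
  by rewrite -[leRHS]mulrA ler_wpM2r ?mulr_ge0// cas_le2.
rewrite /F /= => E.
transitivity (itg (fun X => itg (fun y => f y * cas (y * X) * k X))).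
  apply: eq_itg => X; rewrite /V mulrC -itgZ; last exact: intg_cas.
  by apply: eq_itg => y; rewrite mulrC.
rewrite E; apply: eq_itg => y; rewrite /V -itgZ; last exact: intg_cas.
by apply: eq_itg => x; rewrite (mulrC y); ring.
Qed.

End Hartley.

(** * The Abel-Poisson regularization of the Hartley kernel *)

Section Poisson.
Context {R : realType}.
Notation mu := (@lebesgue_measure R).
Implicit Types f g h : R -> R.
Variable d : R.
Hypothesis d0 : 0 < d.

Let dy0 y : d ^+ 2 + y ^+ 2 != 0.
Proof. by rewrite gt_eqF// ltr_wpDr ?sqr_ge0// exprn_gt0. Qed.

Let E (x : R) : R := expR (- (d * `|x|)).

Let cE : continuous E.
Proof.
move=> x; apply: (@continuous_comp _ _ _ (fun x => - (d * `|x|)) expR); last exact: continuous_expR.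
by apply: cvgN; apply: cvgM; [exact: cvg_cst|exact: norm_continuous].
Qed.

(** Antiderivative of [exp (- d x) (1 + cos (y x))], used on the half-line. The added 1 makes the
    integrand nonnegative, as the improper fundamental theorem requires; it is subtracted again in
    [itg_expabs_cos]. *)
Let F (y x : R) : R := - expR (- (d * x)) / d + expR (- (d * x)) * ((y * sin (y * x) - d * cos (y * x)) / (d ^+
  2 + y ^+ 2)).

Let dF (y x : R) : is_derive x (1 : R) (F y : R -> R) (expR (- (d * x)) * (1 + cos (y * x))).
Proof.
rewrite /F; apply: is_derive_eq; rewrite /GRing.scale/=.
by field; rewrite dy0 lt0r_neq0.
Qed.

Let F_cvg y : F y x @[x --> +oo] --> 0.
Proof.
have e0 : expR (- (d * x)) @[x --> +oo] --> (0 : R).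
  rewrite (_ : (fun x => _) = (fun x => expR (- (x * d)))); last by apply/funext => x; rewrite mulrC.
  apply: (@cvg_comp _ _ _ (fun x => x * d) (fun x => expR (- x)) +oo +oo); last exact: cvgr_expR.
  by apply: gt0_cvgMly => //; exact: cvg_id.
pose B := d^-1 + (`|y| + d) / (d ^+ 2 + y ^+ 2).
apply: (cvg_squeeze0 (g := fun x => expR (- (d * x)) * B)); last first.
  by rewrite -(mul0r B); apply: cvgM => //; exact: cvg_cst.
move=> x; rewrite /F.
  rewrite (le_trans (ler_normD _ _))// /B mulrDr; apply: lerD.
    by rewrite normrM normrN (ger0_norm (expR_ge0 _)) ger0_norm// invr_ge0 ltW.
  rewrite !normrM (ger0_norm (expR_ge0 _)) ler_wpM2l ?expR_ge0//.
  rewrite normfV (@ger0_norm _ (d ^+ 2 + y ^+ 2)) ?addr_ge0 ?sqr_ge0//.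
  rewrite ler_wpM2r// ?invr_ge0 ?addr_ge0 ?sqr_ge0//.
  rewrite (le_trans (ler_normB _ _))// !normrM lerD//.
    by rewrite ler_piMr// ler_norml sin_le1 sin_geN1.
  rewrite (ger0_norm (ltW d0)) ler_piMr ?(ltW d0)// ler_norml cos_le1 cos_geN1//.
Qed.

Let cG y : continuous (fun x : R => E x * (1 + cos (y * x))).
Proof.
move=> x; apply: cvgM; first exact: cE.
apply: cvgD; first exact: cvg_cst.
apply: (@continuous_comp _ _ _ (fun x : R => y * x) cos); first exact: mulrl_continuous.
exact: continuous_cos.
Qed.

Let G0 y x : 0 <= E x * (1 + cos (y * x)).
Proof. by rewrite mulr_ge0 ?expR_ge0//; have := cos_geN1 (y * x); lra. Qed.

Let intG y : (\int[mu]_x (E x * (1 + cos (y * x)))%:E = (2 * (d^-1 + d / (d ^+ 2 + y ^+ 2)))%:E)%E.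
Proof.
rewrite ge0_symfun_integralT//; last first.
  by move=> x /=; rewrite /E normrN mulrN cosN.
rewrite -set_itvcy.
rewrite [X in (_ * X)%E](_ : _ = \int[mu]_(x in `[0%R, +oo[) (expR (- (d * x)) * (1 + cos (y * x)))%:E)%E; last first.
  apply: eq_integral => x; rewrite inE/= in_itv/= andbT => x0; rewrite /E ger0_norm//.
rewrite (@ge0_continuous_FTC2y _ _ (F y) 0 0).
- rewrite -EFinB -EFinM; congr EFin; rewrite /F !mulr0 oppr0 expR0 sin0 cos0.
  by field; rewrite dy0 lt0r_neq0.
- by move=> x x0; have := G0 y x; rewrite /E ger0_norm.
- apply: continuous_subspaceT => x.
  apply: cvgM.
    apply: (@continuous_comp _ _ _ (fun x : R => - (d * x)) expR); last exact: continuous_expR.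
    by apply: cvgN; exact: mulrl_continuous.
  apply: cvgD; first exact: cvg_cst.
  apply: (@continuous_comp _ _ _ (fun x : R => y * x) cos); first exact: mulrl_continuous.
  exact: continuous_cos.
- exact: F_cvg.
- by move=> x _; have /@ex_derive := dF y x.
- apply: cvg_at_right_filter; apply: differentiable_continuous.
  by apply/derivable1_diffP; have /@ex_derive := dF y 0.
- by move=> x _; rewrite derive1E; have /@derive_val := dF y x.
Qed.

Let iG y : intg (fun x => E x * (1 + cos (y * x))).
Proof.
apply: intg_lty; [exact: continuous_measurable_fun|exact: G0|].
by rewrite intG ltry.
Qed.

Let itgG y : itg (fun x => E x * (1 + cos (y * x))) = 2 * (d^-1 + d / (d ^+ 2 + y ^+ 2)).
Proof. by apply: EFin_inj; rewrite EFin_itg// intG. Qed.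

Lemma intg_expabs : intg (fun x => expR (- (d * `|x|))).
Proof.
have := intgZ (2^-1) (iG 0); congr intg; apply/funext => x.
by rewrite mul0r cos0 /E; lra.
Qed.

Lemma itg_expabs : itg (fun x => expR (- (d * `|x|))) = 2 / d.
Proof.
transitivity (itg (fun x => 2^-1 * (E x * (1 + cos (0 * x))))).
  by apply: eq_itg => x; rewrite mul0r cos0 /E; lra.
rewrite itgZ; last exact: iG.
by rewrite itgG; field; rewrite lt0r_neq0.
Qed.

Lemma intg_expabs_mul g c : measurable_fun [set: R] g -> (forall x, `|g x| <= c) ->
  intg (fun x => expR (- (d * `|x|)) * g x).
Proof. by move=> mg gc; apply: intg_mulb gc => //; exact: intg_expabs. Qed.

Lemma itg_expabs_cos y : itg (fun x => expR (- (d * `|x|)) * cos (y * x)) = 2 * d / (d ^+ 2 + y ^+ 2).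
Proof.
transitivity (itg (fun x => E x * (1 + cos (y * x)) - E x)).
  by apply: eq_itg => x; rewrite /E; ring.
rewrite itgB; [|exact: iG|exact: intg_expabs].
by rewrite itgG itg_expabs; field; rewrite dy0 lt0r_neq0.
Qed.

Lemma itg_expabs_sin y : itg (fun x => expR (- (d * `|x|)) * sin (y * x)) = 0.
Proof.
have i : intg (fun x => expR (- (d * `|x|)) * sin (y * x)).
  apply: (intg_expabs_mul (c := 1)); last by move=> x; rewrite ler_norml sin_le1 sin_geN1.
  apply: continuous_measurable_fun => x.
  apply: (@continuous_comp _ _ _ (fun x : R => y * x) sin); first exact: mulrl_continuous.
  exact: continuous_sin.
have := itg_opp i.
rewrite (_ : (fun x => _) = (fun x => -1 * (expR (- (d * `|x|)) * sin (y * x)))); last first.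
  by apply/funext => x; rewrite normrN mulrN sinN; ring.
by rewrite itgZ//; lra.
Qed.

(** In [cas_mul] the sine of the sum integrates to zero by oddness; the cosine of the difference
    leaves the Poisson kernel. *)
Lemma itg_expabs_cas a b : itg (fun x => cas (a * x) * (expR (- (d * `|x|)) * cas (x * b))) =
  2 * d / (d ^+ 2 + (a - b) ^+ 2).
Proof.
rewrite -itg_expabs_cos -[RHS]addr0 -(itg_expabs_sin (a + b)) -itgD.
- apply: eq_itg => x; rewrite mulrCA cas_mul (mulrC x) -mulrBl -mulrDl.
  by rewrite mulrDr.
- apply: (intg_expabs_mul (c := 1)); last by move=> x; rewrite ler_norml cos_le1 cos_geN1.
  apply: continuous_measurable_fun => x.
  apply: (@continuous_comp _ _ _ (fun x : R => _ * x) cos); first exact: mulrl_continuous.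
  exact: continuous_cos.
- apply: (intg_expabs_mul (c := 1)); last by move=> x; rewrite ler_norml sin_le1 sin_geN1.
  apply: continuous_measurable_fun => x.
  apply: (@continuous_comp _ _ _ (fun x : R => _ * x) sin); first exact: mulrl_continuous.
  exact: continuous_sin.
Qed.

End Poisson.

(** * Boundedness of the Hartley transform on L^2 *)

Section Plancherel.
Context {R : realType}.
Notation mu := (@lebesgue_measure R).
Implicit Types f g h : R -> R.

Lemma intg_oneDsqr : intg (fun x : R => (1 + x ^+ 2)^-1) /\ itg (fun x : R => (1 + x ^+ 2)^-1) = pi.
Proof.
have E : (\int[mu]_x ((1 + x ^+ 2)^-1)%:E = pi%:E)%E.
  rewrite (@ge0_symfun_integralT R (fun x => (1 + x ^+ 2)^-1)).
  - by rewrite -set_itvcy [X in (_ * X)%E]integral0y_oneDsqr -EFinM; congr EFin; field.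
  - by move=> x; rewrite invr_ge0 addr_ge0// sqr_ge0.
  - by move=> x; exact: continuous_oneDsqrV.
  - by move=> x /=; rewrite sqrrN.
have i : intg (fun x : R => (1 + x ^+ 2)^-1).
  apply: intg_lty; first exact: continuous_measurable_fun (@continuous_oneDsqrV R).
    by move=> x; rewrite invr_ge0 addr_ge0// sqr_ge0.
  by rewrite E ltry.
by split => //; apply: EFin_inj; rewrite EFin_itg.
Qed.

(** Unnormalized Poisson kernel: its mass is [2 pi] for every [d], the constant of the Plancherel
    identity. *)
Definition poisson (d y : R) := 2 * d / (d ^+ 2 + y ^+ 2).

Lemma poissonM d z : 0 < d -> poisson d (d * z) = d^-1 * (2 * (1 + z ^+ 2)^-1).
Proof.
move=> d0; rewrite /poisson; have z0 : 1 + z ^+ 2 != 0 by rewrite gt_eqF// ltr_wpDr ?sqr_ge0.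
have d1 : d != 0 by rewrite gt_eqF.
have d2 : d ^+ 2 + (d * z) ^+ 2 != 0 by rewrite exprMn -{1}[d ^+ 2]mulr1 -mulrDr mulf_neq0// expf_neq0.
by field; rewrite d1 z0 d2.
Qed.

Lemma poisson_ge0 d y : 0 < d -> 0 <= poisson d y.
Proof. by move=> d0; rewrite /poisson divr_ge0 ?addr_ge0 ?sqr_ge0// mulr_ge0// ltW. Qed.

Lemma poisson_le d y : 0 < d -> `|poisson d y| <= 2 / d.
Proof.
move=> d0; rewrite ger0_norm ?poisson_ge0// /poisson.
have h : 0 < d ^+ 2 + y ^+ 2 by rewrite ltr_wpDr ?sqr_ge0// exprn_gt0.
rewrite ler_pdivrMr// mulrAC ler_pdivlMr//.
by have := sqr_ge0 y; nra.
Qed.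

Lemma poissonE d y : 0 < d -> poisson d y = d^-1 * (2 * (1 + (d^-1 * y) ^+ 2)^-1).
Proof. by move=> d0; rewrite -poissonM// mulrA divff ?gt_eqF// mul1r. Qed.

Lemma measurable_poisson d : 0 < d -> measurable_fun [set: R] (poisson d).
Proof.
move=> d0; have -> : poisson d = (fun y => d^-1 * (2 * (1 + (d^-1 * y) ^+ 2)^-1)).
  by apply/funext => y; exact: poissonE.
apply: measurable_funM => //; apply: measurable_funM => //.
apply: (measurableT_comp (f := fun y : R => (1 + y ^+ 2)^-1)).
  exact: continuous_measurable_fun (@continuous_oneDsqrV R).
exact: mulrl_measurable.
Qed.

Lemma intg_poisson d : 0 < d -> intg (poisson d) /\ itg (poisson d) = 2 * pi.
Proof.
move=> d0; have [i E] := intg_oneDsqr.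
have -> : poisson d = (fun y => d^-1 * (2 * (1 + (d^-1 * y + 0) ^+ 2)^-1)).
  by apply/funext => y; rewrite addr0 poissonE.
have d'0 : 0 < d^-1 by rewrite invr_gt0.
have i2 := intg_aff 0 d'0 (intgZ 2 i).
split; first exact: intgZ.
by rewrite itgZ// -(itg_aff 0 d'0 (intgZ 2 i)) itgZ// E.
Qed.

(** Damping by [exp (- d |X|)] makes the integrals in [X] converge absolutely before anything is
    known about [V f] in L^2. Moving both transforms onto the damped kernel leaves a Poisson
    convolution in frequency. *)
Lemma V_poisson (d : R) f g : 0 < d -> intg f -> intg g ->
  itg (fun X => V f X * (expR (- (d * `|X|)) * V g X)) =
  itg (fun a => f a * itg (fun b => g b * poisson d (a - b))).
Proof.
move=> d0 fi gi.
have ki : intg (fun X => expR (- (d * `|X|)) * V g X).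
  by apply: (intg_expabs_mul d0 (c := 2 * itg (fun x => `|g x|))); [exact: measurable_V|move=> x; exact: V_le].
rewrite V_adjoint//; apply: eq_itg => a; congr (_ * _).
have ki2 : intg (fun x => expR (- (d * `|x|)) * cas (x * a)).
  by apply: (intg_expabs_mul d0 (c := 2)); [exact: measurable_casM|move=> x; exact: cas_le2].
transitivity (itg (fun X => V g X * (expR (- (d * `|X|)) * cas (X * a)))).
  by apply: eq_itg => X; rewrite -mulrA mulrCA.
rewrite V_adjoint//; apply: eq_itg => b; congr (_ * _).
rewrite /V /poisson -itg_expabs_cas//; apply: eq_itg => x.
by rewrite -mulrA mulrCA (mulrC x a).
Qed.

Lemma intg_mul_poisson (d a : R) h : 0 < d -> intg h -> intg (fun b => h b * poisson d (a - b)).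
Proof.
move=> d0 hi; apply: (intg_mulb (c := 2 / d) hi) => [|x]; last exact: poisson_le.
exact: intg_meas (intg_rsub a (intg_poisson d0).1).
Qed.

Lemma itg_poisson_conv (d : R) h : 0 < d -> intg h ->
  intg (fun a => itg (fun b => h b * poisson d (a - b))) /\
  itg (fun a => itg (fun b => h b * poisson d (a - b))) = 2 * pi * itg h.
Proof.
move=> d0 hi; have [Pi PE] := intg_poisson d0.
have mP2 : measurable_fun [set: R * R] (fun z : R * R => poisson d (z.1 - z.2)).
  by apply: (measurableT_comp (measurable_poisson d0)); apply: measurable_funB.
have [|||||H1 H2 H3] := @itg_fubini R (fun z : R * R => h z.2 * poisson d (z.1 - z.2)) (fun b => 2 * pi * `|h b|).
- by apply: measurable_funM => //; exact: (measurableT_comp (intg_meas hi)).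
- by move=> a; exact: intg_mul_poisson.
- by move=> b /=; apply: intgZ; exact: intg_sub.
- by apply: intgZ; exact: intg_abs.
- move=> y /=; rewrite mulrC -PE -(itg_sub y Pi) -itgZ ?itg_le//; last exact: intg_sub.
  + by apply: intg_abs; apply: intgZ; exact: intg_sub.
  + by apply: intgZ; exact: intg_sub.
  + by move=> x; rewrite normrM (ger0_norm (poisson_ge0 _ _)).
split => //; rewrite H3 -itgZ//; apply: eq_itg => b /=.
by rewrite itgZ ?itg_sub// ?PE 1?mulrC//; exact: intg_sub.
Qed.

(** Schur test: [2 f(a) f(b) <= f(a)^2 + f(b)^2] against the positive symmetric kernel
    [poisson d (a - b)], whose mass in each variable is [2 pi]. The bound does not depend on [d]. *)
Lemma V_poisson_le (d : R) f : 0 < d -> intg f -> sqi f ->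
  itg (fun X => V f X * (expR (- (d * `|X|)) * V f X)) <= 2 * pi * itg (fun x => f x ^+ 2).
Proof.
move=> d0 fi fs; rewrite V_poisson//; case: (fs) => mf f2.
have [Pi PE] := intg_poisson d0.
pose A := fun a => itg (fun b => f a ^+ 2 * poisson d (a - b)).
pose B := fun a => itg (fun b => f b ^+ 2 * poisson d (a - b)).
have [Bi BE] := itg_poisson_conv d0 f2; rewrite -/B in Bi BE.
have AE a : A a = 2 * pi * f a ^+ 2.
  by rewrite /A itgZ ?itg_rsub// ?PE 1?mulrC//; exact: intg_rsub.
have Ai : intg A by rewrite (_ : A = fun a => 2 * pi * f a ^+ 2); [exact: intgZ|apply/funext].
rewrite -(@ler_pM2l _ 2)//.
have -> : 2 * (2 * pi * itg (fun x => f x ^+ 2)) = itg (fun a => A a + B a).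
  rewrite itgD// BE; suff -> : itg A = 2 * pi * itg (fun x => f x ^+ 2) by ring.
  by rewrite -itgZ//; exact: eq_itg.
have ABi a : intg (fun b => f a ^+ 2 * poisson d (a - b) + f b ^+ 2 * poisson d (a - b)).
  by apply: intgD; [exact/intgZ/intg_rsub|exact: intg_mul_poisson].
have ABE a : A a + B a = itg (fun b => f a ^+ 2 * poisson d (a - b) + f b ^+ 2 * poisson d (a - b)).
  by rewrite itgD//; [exact/intgZ/intg_rsub|exact: intg_mul_poisson].
have le2 (x y p : R) : 0 <= p -> `|2 * (x * (y * p))| <= x ^+ 2 * p + y ^+ 2 * p.
  move=> p0; rewrite -mulrDl !mulrA normrM (ger0_norm p0) ler_wpM2r//.
  have := sqr_ge0 (x - y); have := sqr_ge0 (x + y).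
  by rewrite ler_norml => h1 h2; apply/andP; split; lra.
have Ci : intg (fun a => 2 * (f a * itg (fun b => f b * poisson d (a - b)))).
  apply: (intg_le _ _ (intgD Ai Bi)) => [|a].
    apply: measurable_funM => //; apply: measurable_funM => //.
    exact: intg_meas (itg_poisson_conv d0 fi).1.
  rewrite ABE -itgZ; last exact: intg_mul_poisson.
  rewrite -itgZ; last by apply: intgZ; exact: intg_mul_poisson.
  apply: itg_abs_le => [||b]; [|exact: ABi|by apply: le2; exact: poisson_ge0].
  by apply: intg_meas; do 2 apply: intgZ; exact: intg_mul_poisson.
rewrite -itgZ; last first.
  by have := intgZ (2^-1) Ci; congr intg; apply/funext => a; rewrite mulrA mulVf// mul1r.
apply: itg_le => //; first exact: intgD.
move=> a; rewrite ABE -itgZ; last exact: intg_mul_poisson.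
rewrite -itgZ; last by apply: intgZ; exact: intg_mul_poisson.
apply: itg_le => [||b]; [by do 2 apply: intgZ; exact: intg_mul_poisson|exact: ABi|].
by apply: le_trans (ler_norm _) _; apply: le2; exact: poisson_ge0.
Qed.

Lemma cvg_expabs_mul (a b x : R) : a * (expR (- (n.+1%:R^-1 * `|x|)) * b) @[n --> \oo] --> a * b.
Proof.
apply: cvgM; first exact: cvg_cst.
rewrite -[X in _ --> X]mul1r.
apply: cvgM; last exact: cvg_cst.
have h : - (n.+1%:R^-1 * `|x|) @[n --> \oo] --> (0 : R).
  rewrite -[X in _ --> X]oppr0 -(mul0r `|x|).
  by apply: cvgN; apply: cvgM; [exact: cvg_harmonic|exact: cvg_cst].
have := @cvg_comp _ _ _ _ expR _ _ _ h (@continuous_expR R 0).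
by rewrite expR0.
Qed.

(** The damping [d = 1 / (n + 1)] tends to 0. Fatou's lemma yields an inequality only, but it
    legitimates the later exchanges of limits. *)
Lemma sqi_V f : intg f -> sqi f -> sqi (V f) /\ itg (fun X => V f X ^+ 2) <= 2 * pi * itg (fun x => f x ^+ 2).
Proof.
move=> fi fs.
pose F n X := V f X * (expR (- (n.+1%:R^-1 * `|X|)) * V f X).
have n0 n : 0 < n.+1%:R^-1 :> R by rewrite invr_gt0.
have [] := @itg_fatou R F (fun X => V f X ^+ 2) (2 * pi * itg (fun x => f x ^+ 2)).
- by move=> n x; rewrite /F mulrCA mulr_ge0 ?expR_ge0// -expr2 sqr_ge0.
- move=> n; apply: intg_VM => //.
  by apply: (intg_expabs_mul (n0 n) (c := 2 * itg (fun x => `|f x|))); [exact: measurable_V|move=> x; exact: V_le].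
- by move=> x; exact: cvg_expabs_mul.
- by move=> n; exact: V_poisson_le.
by move=> i le; split => //; split => //; exact: measurable_V.
Qed.

End Plancherel.

Lemma cvg_to_eq {R : realType} {T : Type} {F : set_system T} (f : T -> R) (a b : R) :
  f @ F --> a -> a = b -> f @ F --> b.
Proof. by move=> ? <-. Qed.

Lemma sqrB_le {R : realType} (a b c : R) : (a - c) ^+ 2 <= 2 * (a - b) ^+ 2 + 2 * (b - c) ^+ 2.
Proof.
rewrite -subr_ge0 (_ : _ - _ = ((a - b) - (b - c)) ^+ 2) ?sqr_ge0//; ring.
Qed.

(** * The Plancherel identity and inversion in the mean *)

Section PlancherelIdentity.
Context {R : realType}.
Notation mu := (@lebesgue_measure R).
Implicit Types (f g h k : R -> R) (p q a B : R).

Definition cut (p q : R) k (x : R) : R := if p <= x <= q then k x else 0.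

Lemma cutE p q k : cut p q k = k \_ `[p, q].
Proof. by apply/funext => x; rewrite /cut patchE mem_setE in_itv. Qed.

Lemma measurable_cut p q k : measurable_fun [set: R] k -> measurable_fun [set: R] (cut p q k).
Proof.
move=> mk; rewrite cutE; apply/(measurable_restrictT _ _).1 => //.
exact: measurable_funTS.
Qed.

Lemma continuous_measurable_cut p q k : continuous k -> measurable_fun [set: R] (cut p q k).
Proof. by move=> ck; apply: measurable_cut; exact: continuous_measurable_fun. Qed.

Lemma cut_bounded p q k : continuous k -> exists2 B : R, 0 <= B & forall x, `|cut p q k x| <= B.
Proof.
move=> ck.
have h : {within `[p, q], continuous k} by exact: continuous_subspaceT.
have /compact_bounded[M [_ Mk]] := continuous_compact h (@segment_compact R p q).
exists (`|M| + 1) => [|x]; first by rewrite addr_ge0.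
rewrite /cut; case: ifPn => [xpq|_]; last by rewrite normr0 addr_ge0.
apply: (Mk (`|M| + 1)); first by rewrite (le_lt_trans (ler_norm M))// ltrDl.
by exists x => //=; rewrite in_itv.
Qed.

Lemma intg_cut1 (p q B : R) : intg (cut p q (fun=> B)).
Proof.
rewrite cutE /intg -restrict_EFin; apply/(integrable_mkcond _ _).1 => //.
apply: measurable_bounded_integrable => //.
  by rewrite [X in (X < _)%E]lebesgue_measure_itv/=; case: ifPn => // _; rewrite -EFinB ltry.
by exists `|B|; split; [exact: num_real|move=> c /ltW h y _ /=].
Qed.

Lemma intg_cut p q k : continuous k -> intg (cut p q k).
Proof.
move=> ck; have [B B0 Bk] := cut_bounded p q ck.
apply: (intg_le (g := cut p q (fun=> B))); [| |exact: intg_cut1].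
  exact: continuous_measurable_cut.
by move=> x; move: (Bk x); rewrite /cut; case: ifPn => // _; rewrite normr0.
Qed.

Lemma cut_sqr p q k : (fun x => cut p q k x ^+ 2) = cut p q (fun x => k x ^+ 2).
Proof. by apply/funext => x; rewrite /cut; case: ifPn => //; rewrite expr0n. Qed.

Lemma sqi_cut p q k : continuous k -> sqi (cut p q k).
Proof.
move=> ck; split; first exact: continuous_measurable_cut.
by rewrite cut_sqr; apply: intg_cut => x; apply: (cvgM (ck x) (ck x)).
Qed.

Lemma cut_continuous p q k a : continuous k -> a != p -> a != q -> {for a, continuous (cut p q k)}.
Proof.
move=> ck ap aq; rewrite /prop_for /continuous_at.
have [pa|ap'|ea] := ltgtP p a; last by rewrite ea eqxx in ap.
  have [aq'|qa|ea] := ltgtP a q; last by rewrite ea eqxx in aq.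
    have -> : cut p q k a = k a by rewrite /cut !ltW.
    apply: cvg_trans (ck a); apply: near_eq_cvg; near=> x.
    have px : p < x by near: x; exact: lt_nbhsr.
    have xq : x < q by near: x; exact: lt_nbhsl.
    by rewrite /cut !ltW.
  have -> : cut p q k a = 0 by rewrite /cut (leNgt a q) qa andbF.
  apply: cvg_near_cst; near=> x.
  have qx : q < x by near: x; exact: lt_nbhsr.
  by rewrite /cut (leNgt x q) qx andbF.
have -> : cut p q k a = 0 by rewrite /cut (leNgt p a) ap'.
apply: cvg_near_cst; near=> x.
have qx : x < p by near: x; exact: lt_nbhsl.
by rewrite /cut (leNgt p x) qx.
Unshelve. all: by end_near. Qed.

(** Rescaling moves the width [d] into the argument of [g], where dominated convergence with the
    fixed kernel [1 / (1 + z^2)] applies. *)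
Lemma itg_poisson_scale (d a : R) g : 0 < d -> intg g ->
  itg (fun b => g b * poisson d (a - b)) = itg (fun z => 2 * (g (a - d * z) * (1 + z ^+ 2)^-1)).
Proof.
move=> d0 gi; have i1 := intg_mul_poisson a d0 gi; have i2 := intg_rsub a i1.
rewrite -[LHS](itg_rsub a i1) [LHS](itg_aff 0 d0 i2) -[LHS](itgZ _ (intg_aff 0 d0 i2)).
by apply: eq_itg => z; rewrite addr0 subKr poissonM// mulrCA mulVKf ?gt_eqF// mulrCA.
Qed.

(** The damping is removed on both sides: on the left [|V f V g|] is an integrable dominating
    function, on the right the Poisson averages of the bounded function [g] converge to [2 pi g] at
    its continuity points. *)
Lemma V_pairing f g p q B : intg f -> sqi f -> intg g -> sqi g -> (forall x, `|g x| <= B) ->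
  (forall a, a != p -> a != q -> {for a, continuous g}) ->
  itg (fun X => V f X * V g X) = 2 * pi * itg (fun x => f x * g x).
Proof.
move=> fi fs gi gs gB cg.
have n0 n : 0 < n.+1%:R^-1 :> R by rewrite invr_gt0.
have [Vf _] := sqi_V fi fs; have [Vg _] := sqi_V gi gs.
have VV := sqiM Vf Vg.
have eE n X : expR (- (n.+1%:R^-1 * `|X|)) <= 1 :> R.
  by rewrite -expR0 ler_expR oppr_le0 mulr_ge0// ltW.
have [||_ L] := @itg_dct R (fun n X => V f X * (expR (- (n.+1%:R^-1 * `|X|)) * V g X)) (fun X =>
  V f X * V g X) (fun X => `|V f X * V g X|)
  _ _ (intg_abs VV) (fun x => @cvg_expabs_mul R _ _ x).
- move=> n; apply: measurable_funM; first exact: measurable_V.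
  apply: intg_meas; apply: (intg_expabs_mul (n0 n) (c := 2 * itg (fun x => `|g x|))).
    exact: measurable_V.
  by move=> x; exact: V_le.
- move=> n x; rewrite !normrM ler_wpM2l// (ger0_norm (expR_ge0 _)) ler_piMl//.
pose h n a := itg (fun b => g b * poisson n.+1%:R^-1 (a - b)).
have [i1 E1] := @intg_oneDsqr R.
have hE n a : h n a = itg (fun z => 2 * (g (a - n.+1%:R^-1 * z) * (1 + z ^+ 2)^-1)).
  by rewrite /h itg_poisson_scale.
have mgz (c a : R) : measurable_fun [set: R] (fun z => g (a - c * z)).
  apply: (measurableT_comp (intg_meas gi)).
  by apply: measurable_funB => //; exact: mulrl_measurable.
have m1 := intg_meas i1.
have gle c a z : `|2 * (g (a - c * z) * (1 + z ^+ 2)^-1)| <= 2 * B * (1 + z ^+ 2)^-1.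
  rewrite normrM ger0_norm// -mulrA ler_pM2l// normrM.
  have h1 : 0 <= (1 + z ^+ 2)^-1 by rewrite invr_ge0 addr_ge0// sqr_ge0.
  by rewrite (ger0_norm h1) ler_wpM2r.
have iB : intg (fun z => 2 * B * (1 + z ^+ 2)^-1) by exact: intgZ.
have hle n a : `|h n a| <= 2 * B * pi.
  rewrite hE -E1 -itgZ//; apply: itg_abs_le => //.
  by apply: measurable_funM => //; apply: measurable_funM.
have hcvg a : a != p -> a != q -> h n a @[n --> \oo] --> 2 * pi * g a.
  move=> ap aq.
  have [|_] := @itg_dct R (fun n z => 2 * (g (a - n.+1%:R^-1 * z) * (1 + z ^+ 2)^-1))
    (fun z => 2 * (g a * (1 + z ^+ 2)^-1)) (fun z => 2 * B * (1 + z ^+ 2)^-1)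
    (fun n => measurable_funM (measurable_cst _) (measurable_funM (mgz _ _) m1)) (fun n z => gle _ _ z) iB
    _.
    move=> z; apply: cvgM; first exact: cvg_cst.
    apply: cvgM; last exact: cvg_cst.
    have hc : a - n.+1%:R^-1 * z @[n --> \oo] --> a.
      rewrite -[X in _ --> X]subr0 -(mul0r z).
      by apply: cvgB; [exact: cvg_cst|apply: cvgM; [exact: cvg_harmonic|exact: cvg_cst]].
    exact: (@cvg_comp _ _ _ _ g _ _ _ hc (cg a ap aq)).
  rewrite itgZ; last exact: intgZ.
  rewrite itgZ// E1 (mulrC (g a)) mulrA.
  by under eq_fun do rewrite -hE.
(* [f] is set to zero at the two possible jumps of [g], so that the products with the Poisson
   averages converge at every point. *)
pose I2 : set R := ~` [set p; q].
have mI2 : measurable_fun [set: R] (\1_I2 : R -> R).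
  by apply: measurable_indic; apply: measurableC; apply: measurableU.
pose f' a := f a * \1_I2 a.
have f'E a : a != p -> a != q -> f' a = f a.
  move=> ap aq; rewrite /f' indicE mem_set ?mulr1// /I2/= => -[/eqP|/eqP].
    by rewrite (negbTE ap).
  by rewrite (negbTE aq).
have f'p a : (a == p) || (a == q) -> f' a = 0.
  by move=> /orP[] /eqP ->; rewrite /f' indicE memNset ?mulr0// /I2/=; apply; [left|right].
have mf := intg_meas fi.
have mf' : measurable_fun [set: R] f' by exact: measurable_funM.
have mh n : measurable_fun [set: R] (h n) by exact: intg_meas (itg_poisson_conv (n0 n) gi).1.
have f'le a : `|f' a| <= `|f a|.
  have [/f'p ->|] := boolP ((a == p) || (a == q)); first by rewrite normr0.
  by rewrite negb_or => /andP[? ?]; rewrite f'E.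
have [|||_ L2] := @itg_dct R (fun n a => f' a * h n a) (fun a => f' a * (2 * pi * g a)) (fun a => `|f a| * (2 * B * pi))
  (fun n => measurable_funM mf' (mh n)) _ _ _.
- by move=> n x; rewrite normrM ler_pM.
- by under eq_fun do rewrite mulrC; apply: intgZ; exact: intg_abs.
- move=> a; have [ha|] := boolP ((a == p) || (a == q)).
    by rewrite (f'p _ ha); apply: cvg_near_cst; apply: nearW => n; rewrite !mul0r.
  by rewrite negb_or => /andP[? ?]; apply: cvgM; [exact: cvg_cst|exact: hcvg].
have fg : intg (fun x => f x * g x) by exact: sqiM.
have E2 : itg (fun a => f' a * (2 * pi * g a)) = 2 * pi * itg (fun x => f x * g x).
  rewrite -itgZ//; apply: (@itg_eq_off2 R p q _ _ _ _ _).2; first exact: intgZ.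
    by apply: measurable_funM => //; apply: measurable_funM => //; exact: intg_meas.
  by move=> x xp xq; rewrite f'E//; ring.
rewrite -E2.
apply: (@cvg_unique _ _ (itg (fun X => V f X * (expR (- (n.+1%:R^-1 * `|X|)) * V g X)) @[n --> \oo])) => //.
apply: cvg_trans L2; apply: near_eq_cvg; apply: nearW => n.
rewrite V_poisson//; apply: (@itg_eq_off2 R p q _ _ _ _ _).2.
- exact: (intg_mulb (c := 2 * B * pi) fi (mh n) (hle n)).
- exact: measurable_funM.
- by move=> x xp xq; rewrite f'E.
Qed.

(** L^2 density of cut continuous functions, from L^1 density: [f] is truncated in range and height,
    and between functions bounded by [n] the squared L^2 distance is at most [2 n] times the L^1
    distance. *)
Lemma V_approx f (e : R) : intg f -> sqi f -> 0 < e ->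
  exists k p q, continuous k /\ itg (fun x => (f x - cut p q k x) ^+ 2) < e.
Proof.
move=> fi fs e0; case: (fs) => mf f2.
pose D (n : nat) : set R := `[- n%:R, n%:R] `&` [set x | `|f x| <= n%:R].
have mD n : measurable (D n).
  apply: measurableI => //; rewrite -[X in measurable X]setTI.
  have := measurable_fun_ler (measurableT_comp (@normr_measurable R setT) mf) (@measurable_cst _ _ _ _ setT (n%:R : R)).
  by move=> /(_ measurableT [set true]); rewrite preimage_true; exact.
pose F (n : nat) x := f x * \1_(D n) x.
have mF n : measurable_fun [set: R] (F n).
  by apply: measurable_funM => //; exact: measurable_indic.
have F01 n x : F n x = f x \/ F n x = 0.
  rewrite /F indicE; case: (x \in D n); [left|right]; rewrite ?mulr1 ?mulr0//.
have Fcvg x : F n x @[n --> \oo] --> f x.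
  apply: cvg_near_cst.
  have [N _ Nh] : \forall n \near \oo, `|x| + `|f x| <= (n%:R : R) by exact: nbhs_infty_ger.
  exists N => // n /Nh h; rewrite /F indicE mem_set ?mulr1// /D; split.
    by rewrite /= in_itv/= -ler_norml (le_trans _ h)// lerDl.
  by rewrite /= (le_trans _ h)// lerDr.
have [|||_ L] := @itg_dct R (fun n x => (f x - F n x) ^+ 2) (fun=> 0) (fun x => f x ^+ 2) _ _ f2 _.
- by move=> n; apply: measurable_funX; exact: measurable_funB.
- move=> n x; rewrite ger0_norm ?sqr_ge0//.
  by case: (F01 n x) => ->; rewrite ?subrr ?subr0// expr0n sqr_ge0.
- move=> x; have h : f x - F n x @[n --> \oo] --> 0.
    by rewrite -[X in _ --> X](subrr (f x)); apply: cvgB; [exact: cvg_cst|exact: Fcvg].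
  by rewrite -[X in _ --> X](mulr0 (0 : R)); exact: (cvgM h h).
have itg0 : itg (fun=> 0 : R) = 0.
  by rewrite itg.unlock /Rintegral integral0.
rewrite itg0 in L.
have e4 : 0 < e / 4 by rewrite divr_gt0.
move/cvgrPdist_lt : L => /(_ _ e4) [N _ /(_ N (leqnn N))] /=.
rewrite sub0r normrN ger0_norm; last by apply: itg_ge0 => x; exact: sqr_ge0.
move=> LN.
pose n : R := N.+1%:R.
have n0 : 0 < n by rewrite /n.
have FN x : `|F N x| <= n.
  rewrite /F indicE; have [/set_mem [_ /= h]|_] := boolP (x \in D N).
    by rewrite mulr1 (le_trans h)// ler_nat.
  by rewrite mulr0 normr0 ltW.
have FNi : intg (F N).
  apply: (intg_le (mF N) _ (intg_abs fi)) => x.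
  by case: (F01 N x) => ->//; rewrite normr0.
have Etop : (mu `[(- n)%R, n] < +oo)%E.
  by rewrite [X in (X < _)%E]lebesgue_measure_itv/=; case: ifPn => // _; rewrite -EFinB ltry.
have FNe : mu.-integrable `[- n, n] (EFin \o F N) by exact: integrableS FNi.
have [G [cG iG LG]] := approximation_continuous_integrable (measurable_itv _) Etop FNe.
(* Budget of the L^1 error: it enters multiplied by [4 * n] and must stay below [e / 2]. *)
have n8 : 0 < e / (8 * n) by rewrite divr_gt0// mulr_gt0.
move/fine_cvgP : LG => [_] /cvgrPdist_lt /(_ _ n8) [M _ /(_ M (leqnn M))] /=.
set J := fine _; rewrite sub0r normrN => JM.
(* The continuous approximation [G M] clipped to [[-n, n]], which does not increase its distance to
   [F N]. *)
pose k x : R := 2^-1 * (`|G M x + n| - `|G M x - n|).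
have ck : continuous k.
  move=> x; apply: cvgM; first exact: cvg_cst.
  by apply: cvgB; apply: cvg_norm; [apply: cvgD|apply: cvgB]; [exact: cG|exact: cvg_cst|exact: cG|exact: cvg_cst].
exists k, (- n), n; split => //.
have kn x : `|k x| <= n.
  rewrite ler_norml /k; case: (ger0P (G M x + n)) => ?; case: (ger0P (G M x - n)) => ?; lra.
have Fk x : `|F N x - k x| <= `|F N x - G M x|.
  have := FN x; rewrite ler_norml /k => /andP[h1 h2].
  case: (ger0P (G M x + n)) => ?; case: (ger0P (G M x - n)) => ?;
    case: (ger0P (F N x - G M x)) => ?; rewrite ler_norml; lra.
have FN0 x : ~~ (- n <= x <= n) -> F N x = 0.
  move=> xn; rewrite /F indicE memNset ?mulr0// => -[/=]; rewrite in_itv/= => h _.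
  by move: xn; rewrite -!ler_norml in h *; rewrite (le_trans h)// ler_nat.
have ci : intg (cut (- n) n (fun x => `|F N x - G M x|)).
  rewrite cutE /intg -restrict_EFin; apply/(integrable_mkcond _ _).1 => //.
  apply: integrable_abse (_ : mu.-integrable _ (EFin \o (fun x => F N x - G M x))) => //.
  rewrite (_ : EFin \o _ = (EFin \o F N) \- (EFin \o G M))%E; first by apply: integrableB => //; exact: iG.
  by apply/funext => x; rewrite /= EFinB.
have cJ : itg (cut (- n) n (fun x => `|F N x - G M x|)) = J.
  by rewrite itg.unlock cutE -Rintegral_mkcond.
have key x : (f x - cut (- n) n k x) ^+ 2 <=
    2 * (f x - F N x) ^+ 2 + 4 * n * cut (- n) n (fun x => `|F N x - G M x|) x.
  have h1 : (F N x - cut (- n) n k x) ^+ 2 <= 2 * n * cut (- n) n (fun x => `|F N x - G M x|) x.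
    rewrite /cut; case: ifPn => [_|/FN0 ->]; last by rewrite subrr expr0n mulr0.
    rewrite -real_normK ?num_real// expr2; apply: ler_pM => //.
    by rewrite (le_trans (ler_normB _ _))// mulr_natl lerD.
  apply: le_trans (sqrB_le (f x) (F N x) _) _.
  have -> : 4 * n = 2 * (2 * n) by ring.
  by rewrite lerD2l -[X in _ <= X]mulrA ler_pM2l.
have i1 : intg (fun x => (f x - F N x) ^+ 2).
  apply: (intg_le _ _ f2) => [|x]; first by apply: measurable_funX; exact: measurable_funB.
  by rewrite ger0_norm ?sqr_ge0//; case: (F01 N x) => ->; rewrite ?subrr ?subr0// expr0n sqr_ge0.
apply: (@le_lt_trans _ _ (2 * itg (fun x => (f x - F N x) ^+ 2) + 4 * n * J)).
  rewrite -cJ -!itgZ// -itgD; [|exact: intgZ..].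
  apply: itg_le => //; last by apply: intgD; exact: intgZ.
  apply: (intg_le _ _ (intgD (intgZ 2 i1) (intgZ (4 * n) ci))) => [|x].
    apply: measurable_funX; apply: measurable_funB => //; exact: continuous_measurable_cut.
  by rewrite ger0_norm ?sqr_ge0.
have J4 : 4 * n * J < e / 2.
  have : J < e / (8 * n) by exact: le_lt_trans (ler_norm _) JM.
  rewrite ltr_pdivlMr; last by rewrite mulr_gt0.
  by move=> ?; nra.
by lra.
Qed.

(** Only the lower bound is missing. For [g] a cut continuous function close to [f], expanding
    [0 <= ||V (f - g)||^2] with the exact pairings of [V_pairing] gives [||V f||^2 >= 2 pi (||f||^2
    - ||f - g||^2)]. *)
Lemma plancherel f : intg f -> sqi f -> itg (fun X => V f X ^+ 2) = 2 * pi * itg (fun x => f x ^+ 2).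
Proof.
move=> fi fs; apply/eqP; rewrite eq_le (sqi_V fi fs).2/=.
apply/ler_addgt0Pr => e e0.
have d0 : 0 < e / (2 * pi) by rewrite divr_gt0// mulr_gt0// pi_gt0.
have [k [p [q [ck ke]]]] := V_approx fi fs d0.
set g := cut p q k in ke.
have gi : intg g by exact: intg_cut.
have gs : sqi g by exact: sqi_cut.
have [B _ gB] := cut_bounded p q ck.
have cg a : a != p -> a != q -> {for a, continuous g} by exact: cut_continuous.
have P1 := V_pairing fi fs gi gs gB cg.
have P2 := V_pairing gi gs gi gs gB cg.
have [Vfs _] := sqi_V fi fs; have [Vgs _] := sqi_V gi gs.
have [Vd le] := sqi_V (intgB fi gi) (sqiB fs gs).
have E1 : itg (fun X => V (fun x => f x - g x) X ^+ 2) =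
   itg (fun X => V f X ^+ 2) - 2 * (2 * pi * itg (fun x => f x * g x)) + 2 * pi * itg (fun x => g x ^+ 2).
  transitivity (itg (fun X => (V f X + (-1) * V g X) ^+ 2)).
    by apply: eq_itg => X; rewrite VB// mulN1r.
  rewrite itg_sqD// P1; have -> : itg (fun x => V g x ^+ 2) = 2 * pi * itg (fun x => g x ^+ 2).
    by under eq_itg do rewrite expr2; rewrite P2; congr (_ * _); apply: eq_itg => x; rewrite expr2.
  by ring.
have E2 : itg (fun x => (f x - g x) ^+ 2) = itg (fun x => f x ^+ 2) - 2 * itg (fun x =>
  f x * g x) + itg (fun x => g x ^+ 2).
  transitivity (itg (fun X => (f X + (-1) * g X) ^+ 2)); first by apply: eq_itg => X; rewrite mulN1r.
  by rewrite itg_sqD//; ring.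
have : 0 <= itg (fun X => V (fun x => f x - g x) X ^+ 2) by apply: itg_ge0 => X; exact: sqr_ge0.
rewrite E1.
have : 2 * pi * itg (fun x => (f x - g x) ^+ 2) < e.
  by rewrite mulrC -ltr_pdivlMr// mulr_gt0// pi_gt0.
rewrite E2 !mulrDr.
move: (itg _) (itg _) (itg _) (itg _) => A1 A2 A3 A4 h1 h2.
lra.
Qed.

Lemma plancherelM f g : intg f -> sqi f -> intg g -> sqi g ->
  itg (fun X => V f X * V g X) = 2 * pi * itg (fun x => f x * g x).
Proof.
move=> fi fs gi gs.
have [Vfs _] := sqi_V fi fs; have [Vgs _] := sqi_V gi gs.
have := plancherel (intgD fi gi) (sqiD fs gs).
have -> : itg (fun X => V (fun x => f x + g x) X ^+ 2) = itg (fun X => (V f X + 1 * V g X) ^+ 2).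
  by apply: eq_itg => X; rewrite VD// mul1r.
have -> : itg (fun X => (f X + g X) ^+ 2) = itg (fun X => (f X + 1 * g X) ^+ 2).
  by apply: eq_itg => X; rewrite mul1r.
rewrite !itg_sqD// !plancherel//; lra.
Qed.

(** Inversion in the mean-square form used by [is_fourier]. After expanding the square, [V_adjoint]
    turns the cross term into the squared norm of the cut function, and the error becomes [2 pi]
    times the tail of the integral of [(V f)^2]. *)
Lemma V_cut_cvg f : intg f -> sqi f ->
  itg (fun x => (V (cut (- n%:R) n%:R (V f)) x - 2 * pi * f x) ^+ 2) @[n --> \oo] --> 0.
Proof.
move=> fi fs; set u := V f; have cu : continuous u by exact: continuous_V.
have [us uE] := sqi_V fi fs; case: (us) => mu' u2.
pose g (n : nat) := cut (- n%:R) n%:R u.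
have gi n : intg (g n) by exact: intg_cut.
have gs n : sqi (g n) by exact: sqi_cut.
have gu n x : g n x * u x = g n x ^+ 2 by rewrite /g /cut; case: ifPn => //; rewrite mul0r expr0n.
have E n : itg (fun x => (V (g n) x - 2 * pi * f x) ^+ 2) =
    2 * pi * (itg (fun x => u x ^+ 2) - itg (fun x => g n x ^+ 2)).
  transitivity (itg (fun x => (V (g n) x + (- (2 * pi)) * f x) ^+ 2)).
    by apply: eq_itg => x; rewrite mulNr.
  rewrite itg_sqD//; last exact: (sqi_V _ _).1.
  rewrite V_adjoint// (eq_itg (gu n)) !plancherel//; ring.
have L : itg (fun x => g n x ^+ 2) @[n --> \oo] --> itg (fun x => u x ^+ 2).
  have [//| ||_] := @itg_dct R (fun n x => g n x ^+ 2) (fun x => u x ^+ 2) (fun x => u x ^+ 2) _ _ u2 _.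
  - by move=> n; apply: measurable_funX; exact: intg_meas.
  - move=> n x; rewrite ger0_norm ?sqr_ge0// /g /cut; case: ifPn => // _.
    by rewrite expr0n sqr_ge0.
  - move=> x; apply: cvg_near_cst.
    have [N _ Nh] : \forall n \near \oo, `|x| <= (n%:R : R) by exact: nbhs_infty_ger.
    by exists N => // n /Nh h; rewrite /g /cut -ler_norml h.
  by [].
rewrite (eq_cvg _ _ E); apply: cvg_to_eq.
  by apply: cvgM; [exact: cvg_cst|apply: cvgB; [exact: cvg_cst|exact: L]].
by rewrite subrr mulr0.
Qed.

End PlancherelIdentity.

(** * Fourier transforms and Gevrey norms of Hartley transforms *)

Section FourierHartley.
Context {R : realType}.
Notation mu := (@lebesgue_measure R).
Implicit Types (f h k u : R -> R) (g : R -> R[i]) (a b : R).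

Lemma Lnorm2E f : sqi f -> Lnorm mu 2%:E (EFin \o f) = (Num.sqrt (itg (fun x => f x ^+ 2)))%:E.
Proof.
move=> [mf f2]; rewrite unlock /=.
have -> : (\int[mu]_x `|(f x)%:E| `^ 2 = (itg (fun x => f x ^+ 2))%:E)%E.
  rewrite EFin_itg//; apply: eq_integral => x _.
  transitivity ((`|f x| `^ 2)%R%:E) => //.
  by rewrite powR_mulrn// real_normK// num_real.
by rewrite poweR_EFin powR12_sqrt// itg_ge0// => x; exact: sqr_ge0.
Qed.

Lemma sqi_Lfun f : sqi f -> f \in Lfun mu 2%:E.
Proof.
move=> fs; rewrite inE; apply/andP; split; rewrite inE/=; first by case: fs.
by rewrite /finite_norm Lnorm2E// ltry.
Qed.

Lemma Lfun_sqi f : f \in Lfun mu 2%:E -> sqi f.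
Proof.
move=> fL; split; last exact: Lfun2_integrable_sqr.
by move: fL; rewrite inE => /andP[]; rewrite !inE.
Qed.

(** Even part minus [i] times odd part: the complex Fourier transform read off from the real Hartley
    transform. *)
Definition hartley_fourier (G : R -> R) (xi : R) : R[i] :=
  Complex ((G xi + G (- xi)) / 2) (- ((G xi - G (- xi)) / 2)).

Lemma cmod_sqr (z : R[i]) : cmod z ^+ 2 = complex.Re z ^+ 2 + complex.Im z ^+ 2.
Proof. by case: z => a b; rewrite /cmod /= sqr_sqrtr// addr_ge0 ?sqr_ge0. Qed.

Lemma cmod_ge0 (z : R[i]) : 0 <= cmod z.
Proof. by case: z => a b; rewrite /cmod /= sqrtr_ge0. Qed.

Lemma cmod_hartley_fourier G xi : cmod (hartley_fourier G xi) ^+ 2 = 2^-1 * (G xi ^+ 2 + G (- xi) ^+ 2).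
Proof. by rewrite cmod_sqr /=; field. Qed.

Lemma hartley_fourierB G1 G2 xi : hartley_fourier G1 xi - hartley_fourier G2 xi = hartley_fourier (fun x =>
  G1 x - G2 x) xi.
Proof. by rewrite /hartley_fourier; apply/eqP; rewrite eq_complex /=; apply/andP; split; apply/eqP; field. Qed.

Definition sqrt2pi : R := Num.sqrt (pi *+ 2).

Lemma sqrt2pi_gt0 : 0 < sqrt2pi.
Proof. by rewrite /sqrt2pi sqrtr_gt0 mulrn_wgt0// pi_gt0. Qed.

Lemma sqrt2pi_sqr : sqrt2pi ^+ 2 = 2 * pi.
Proof. by rewrite /sqrt2pi sqr_sqrtr ?mulr_natl// mulrn_wge0// pi_ge0. Qed.

Lemma itg_setE a b (f : R -> R) : \int[mu]_(X in `[a, b]) f X = itg (cut a b f).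
Proof. by rewrite itg.unlock cutE -Rintegral_mkcond. Qed.

Lemma truncated_fourierE n u xi : continuous u ->
  truncated_fourier n u xi = hartley_fourier (fun x => sqrt2pi^-1 * V (cut (- n%:R) n%:R u) x) xi.
Proof.
move=> cu; rewrite /truncated_fourier -/sqrt2pi !itg_setE.
set C := cut _ _ _; set S := cut _ _ _.
have cc : continuous (fun X => u X * cos (xi * X)).
  move=> x; apply: cvgM; first exact: cu.
  apply: (@continuous_comp _ _ _ (fun x : R => xi * x) cos); first exact: mulrl_continuous.
  exact: continuous_cos.
have cs : continuous (fun X => u X * sin (xi * X)).
  move=> x; apply: cvgM; first exact: cu.
  apply: (@continuous_comp _ _ _ (fun x : R => xi * x) sin); first exact: mulrl_continuous.
  exact: continuous_sin.
have Ci : intg C by exact: intg_cut.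
have Si : intg S by exact: intg_cut.
have E1 : V (cut (- n%:R) n%:R u) xi = itg C + itg S.
  rewrite -itgD//; apply: eq_itg => x; rewrite /C /S /cut; case: ifPn => _.
    by rewrite /cas mulrDr (mulrC x).
  by rewrite mul0r addr0.
have E2 : V (cut (- n%:R) n%:R u) (- xi) = itg C - itg S.
  rewrite -itgB//; apply: eq_itg => x; rewrite /C /S /cut; case: ifPn => _.
    by rewrite /cas mulrDr mulrN cosN sinN (mulrC x) mulrN.
  by rewrite mul0r subr0.
rewrite /hartley_fourier E1 E2; apply/eqP; rewrite eq_complex /=; apply/andP; split; apply/eqP.
  by field; rewrite gt_eqF// sqrt2pi_gt0.
by field; rewrite gt_eqF// sqrt2pi_gt0.
Qed.

Lemma sqi_opp f : sqi f -> sqi (fun x => f (- x)).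
Proof. by move=> [mf f2]; split; [exact: measurableT_comp mf (@oppr_measurable R setT)|exact: (intg_opp f2)]. Qed.

Lemma sqi_cmod (g : R -> R[i]) : sqi (fun x => complex.Re (g x)) -> sqi (fun x => complex.Im (g x)) ->
  sqi (fun x => cmod (g x)).
Proof.
move=> rs is_; case: (rs) => mr r2; case: (is_) => mi i2.
have -> : (fun x => cmod (g x)) = (fun x => Num.sqrt (complex.Re (g x) ^+ 2 + complex.Im (g x) ^+ 2)).
  by apply/funext => x; rewrite -cmod_sqr sqrtr_sqr ger0_norm// cmod_ge0.
split.
  apply: (measurableT_comp (continuous_measurable_fun (@sqrt_continuous R))).
  by apply: measurable_funD; apply: measurable_funX.
have := intgD r2 i2; congr intg; apply/funext => x.
by rewrite sqr_sqrtr// addr_ge0 ?sqr_ge0.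
Qed.

Lemma sqi_hartley_fourier G : sqi G -> sqi (fun x => complex.Re (hartley_fourier G x)) /\ sqi (fun x =>
  complex.Im (hartley_fourier G x)).
Proof.
move=> Gs; have Go := sqi_opp Gs; split.
  by have := sqiZ 2^-1 (sqiD Gs Go); congr sqi; apply/funext => x; rewrite mulrC.
by have := sqiZ (- 2^-1) (sqiB Gs Go); congr sqi; apply/funext => x; rewrite mulNr mulrC.
Qed.

(** The factor [sqrt2pi] reconciles the unitary normalization of [is_fourier] with the unnormalized
    [V], which applied to the truncations of [V f] tends to [2 pi f]. *)
Lemma is_fourier_V f : intg f -> sqi f -> is_fourier (V f) (hartley_fourier (fun x => sqrt2pi * f x)).
Proof.
move=> fi fs; have [us _] := sqi_V fi fs.
have [h1 h2] := sqi_hartley_fourier (sqiZ sqrt2pi fs).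
split; [exact: sqi_Lfun|exact: sqi_Lfun|exact: sqi_Lfun|].
have cu := continuous_V fi.
pose G n x := sqrt2pi^-1 * (V (cut (- n%:R) n%:R (V f)) x - 2 * pi * f x).
have Gs n : sqi (G n).
  apply: sqiZ; apply: sqiB; last exact: sqiZ.
  by apply: (sqi_V _ _).1; [exact: intg_cut|exact: sqi_cut].
have E n xi : truncated_fourier n (V f) xi - hartley_fourier (fun x => sqrt2pi * f x) xi = hartley_fourier (G n) xi.
  rewrite truncated_fourierE// hartley_fourierB; congr hartley_fourier; apply/funext => x; rewrite /G -sqrt2pi_sqr.
  by field; rewrite gt_eqF// sqrt2pi_gt0.
have E2 n : Lnorm mu 2%:E (fun xi => (cmod (truncated_fourier n (V f) xi - hartley_fourier (fun x =>
  sqrt2pi * f x) xi))%:E) =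
    (Num.sqrt (itg (fun x => G n x ^+ 2)))%:E.
  under [X in Lnorm _ _ X]eq_fun do rewrite E.
  have [s1 s2] := sqi_hartley_fourier (Gs n).
  rewrite (Lnorm2E (sqi_cmod s1 s2)); congr (Num.sqrt _)%:E.
  rewrite (eq_itg (cmod_hartley_fourier (G n))) itgZ; last by apply: intgD; [exact: (Gs n).2|exact: (intg_opp (Gs n).2)].
  rewrite itgD; [|exact: (Gs n).2|exact: (intg_opp (Gs n).2)].
  by rewrite (itg_opp (Gs n).2); field.
rewrite (eq_cvg _ _ E2).
apply: cvg_EFin; first exact: nearW.
have L : itg (fun x => G n x ^+ 2) @[n --> \oo] --> 0.
  have E3 n : itg (fun x => G n x ^+ 2) = sqrt2pi^-1 ^+ 2 * itg (fun x =>
    (V (cut (- n%:R) n%:R (V f)) x - 2 * pi * f x) ^+ 2).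
    rewrite -itgZ.
      by apply: eq_itg => x; rewrite /G exprMn.
    apply: (sqiB _ (sqiZ _ fs)).2.
    by apply: (sqi_V _ _).1; [exact: intg_cut|exact: sqi_cut].
  rewrite (eq_cvg _ _ E3); apply: cvg_to_eq.
    by apply: cvgM; [exact: cvg_cst|exact: V_cut_cvg].
  by rewrite mulr0.
apply: (cvg_to_eq (a := Num.sqrt 0)); last by rewrite sqrtr0.
exact: (@cvg_comp _ _ _ _ Num.sqrt _ _ _ L (@sqrt_continuous R 0)).
Qed.

Lemma is_fourier_L2 u g : continuous u -> is_fourier u g ->
  (forall n, sqi (fun xi => cmod (truncated_fourier n u xi - g xi))) /\
  itg (fun xi => cmod (truncated_fourier n u xi - g xi) ^+ 2) @[n --> \oo] --> 0.
Proof.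
move=> cu [_ /Lfun_sqi gr /Lfun_sqi gi L].
have s n : sqi (fun xi => cmod (truncated_fourier n u xi - g xi)).
  have us : sqi (fun x => sqrt2pi^-1 * V (cut (- n%:R) n%:R u) x).
    by apply: sqiZ; apply: (sqi_V _ _).1; [exact: intg_cut|exact: sqi_cut].
  have [h1 h2] := sqi_hartley_fourier us.
  apply: sqi_cmod.
    have := sqiB h1 gr; congr sqi; apply/funext => x; rewrite truncated_fourierE//.
    by case: (g x).
  have := sqiB h2 gi; congr sqi; apply/funext => x; rewrite truncated_fourierE//.
  by case: (g x).
split => //.
have E n : Lnorm mu 2%:E (fun xi => (cmod (truncated_fourier n u xi - g xi))%:E) = (Num.sqrt (itg (fun xi =>
  cmod (truncated_fourier n u xi - g xi) ^+ 2)))%:E.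
  exact: (Lnorm2E (s n)).
move: L; rewrite (eq_cvg _ _ E) => /fine_cvgP [_ L].
have L2 := cvgM L L; rewrite mulr0 in L2.
suff E3 n : itg (fun xi => cmod (truncated_fourier n u xi - g xi) ^+ 2) =
    Num.sqrt (itg (fun xi => cmod (truncated_fourier n u xi - g xi) ^+ 2)) *
    Num.sqrt (itg (fun xi => cmod (truncated_fourier n u xi - g xi) ^+ 2)).
  by rewrite (eq_cvg _ _ E3); exact: L2.
by rewrite -expr2 sqr_sqrtr// itg_ge0// => x; exact: sqr_ge0.
Qed.

(** The primitive of [h] vanishes identically, and its derivative is [h]. *)
Lemma cut_integral_eq0 h : continuous h -> (forall a b, itg (cut a b h) = 0) -> h = (fun=> 0).
Proof.
move=> ch h0; apply/funext => x.
have xu : x < x + 1 by rewrite ltrDl.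
have ax : x - 1 < x by rewrite ltrBlDr ltrDl.
have i : mu.-integrable `[x - 1, x + 1] (EFin \o h).
  apply: continuous_compact_integrable; first exact: segment_compact.
  exact: continuous_subspaceT.
have [_] := continuous_FTC1_closed xu i ax (ch x).
rewrite (_ : (fun y => _) = cst 0); last by apply/funext => y; rewrite itg_setE h0.
by rewrite derive1_cst.
Qed.

(** [Re - Im] recovers the Hartley transform from the Fourier transform. The identity is proved for
    integrals over arbitrary intervals, by pairing with their indicator functions; continuity of
    both sides makes it hold at every point. *)
Lemma fourier_inversion u g : continuous u -> is_fourier u g ->
  intg (fun xi => sqrt2pi^-1 * (complex.Re (g xi) - complex.Im (g xi))) ->
  u = V (fun xi => sqrt2pi^-1 * (complex.Re (g xi) - complex.Im (g xi))).
Proof.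
move=> cu ug; set f := (fun xi => _) => fi.
have [s L] := is_fourier_L2 cu ug.
have [/Lfun_sqi us /Lfun_sqi gr /Lfun_sqi gi _] := ug.
have fs : sqi f by apply: sqiZ; exact: sqiB.
have gni n : intg (cut (- n%:R) n%:R u) by exact: intg_cut.
have gns n : sqi (cut (- n%:R) n%:R u) by exact: sqi_cut.
have cp0 : sqrt2pi != 0 by rewrite gt_eqF// sqrt2pi_gt0.
have Hs n : sqi (V (cut (- n%:R) n%:R u)) by exact: (sqi_V _ _).1.
have L2 : itg (fun x => (V (cut (- n%:R) n%:R u) x - 2 * pi * f x) ^+ 2) @[n --> \oo] --> 0.
  apply: (cvg_squeeze0 (g := fun n => 2 * sqrt2pi ^+ 2 * itg (fun xi =>
    cmod (truncated_fourier n u xi - g xi) ^+ 2))); last first.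
    by apply: cvg_to_eq; [apply: cvgM; [exact: cvg_cst|exact: L]|rewrite mulr0].
  move=> n; rewrite ger0_norm; last by apply: itg_ge0 => x; exact: sqr_ge0.
  rewrite -itgZ; last exact: (s n).2.
  apply: itg_le; [exact: (sqiB (Hs n) (sqiZ _ fs)).2|exact: (intgZ _ (s n).2)|].
  move=> x; rewrite truncated_fourierE// cmod_sqr /f -sqrt2pi_sqr.
  case: (g x) => p q /=; set A := V _ x; set B := V _ (- x).
  have -> : A - sqrt2pi ^+ 2 * (sqrt2pi^-1 * (p - q)) = sqrt2pi * (((sqrt2pi^-1 * A + sqrt2pi^-1 * B) / 2 - p)
    - (- ((sqrt2pi^-1 * A - sqrt2pi^-1 * B) / 2) - q)).
    by field.
  rewrite exprMn [2 * _]mulrC -[X in _ <= X]mulrA ler_wpM2l ?sqr_ge0//.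
  move: (_ / 2 - p) (- (_ / 2) - q) => z w.
  by have := sqr_ge0 (z + w); rewrite sqrrD sqrrB; lra.
have key a b : itg (cut a b u) = itg (cut a b (V f)).
  pose psi := cut a b (fun=> 1 : R).
  have cps : continuous (fun _ : R => 1 : R) by exact: cst_continuous.
  have pi1 : intg psi by exact: intg_cut.
  have ps : sqi psi by exact: sqi_cut.
  have [Vps _] := sqi_V pi1 ps.
  have LL := itgM_cvg Hs (sqiZ (2 * pi) fs) Vps L2.
  have E1 : itg (fun x => 2 * pi * f x * V psi x) = 2 * pi * itg (cut a b (V f)).
    rewrite -(eq_itg (f := fun x => 2 * pi * (f x * V psi x))); last by move=> x; rewrite mulrA.
    rewrite itgZ; last exact: sqiM.
    rewrite -V_adjoint//; congr (_ * _); apply: eq_itg => x.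
    by rewrite /psi /cut; case: ifPn => _; rewrite ?mulr1 ?mulr0.
  have L3 : itg (fun x => V (cut (- n%:R) n%:R u) x * V psi x) @[n --> \oo] --> 2 * pi * itg (cut a b u).
    (* Once [[-n, n]] contains [[a, b]] the sequence is constant. *)
    apply: cvg_near_cst.
    have [N _ Nh] : \forall n \near \oo, `|a| + `|b| <= (n%:R : R) by exact: nbhs_infty_ger.
    exists N => // n /Nh h; rewrite plancherelM//; congr (_ * _); apply: eq_itg => x.
    rewrite /psi /cut; case: ifPn => [/andP[h1 h2]|]; case: ifPn => // [/andP[h3 h4]|]; rewrite ?mulr1 ?mulr0 ?mul0r//.
    have := ler_norm b; have := ler_norm (- a); rewrite normrN => h5 h6.
    have := normr_ge0 a; have := normr_ge0 b => h7 h8.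
    by rewrite negb_and -!ltNge => /orP[] h9; exfalso; lra.
  have E : 2 * pi * itg (cut a b u) = 2 * pi * itg (cut a b (V f)).
    by rewrite -E1; apply: cvg_unique L3 LL.
  by apply: mulfI E; rewrite mulf_neq0// gt_eqF// pi_gt0.
have cV : continuous (V f) by exact: continuous_V.
have ch : continuous (fun x => u x - V f x) by move=> x; apply: cvgB; [exact: cu|exact: cV].
have := @cut_integral_eq0 (fun x => u x - V f x) ch.
move=> h; apply/funext => x; apply/eqP; rewrite -subr_eq0; apply/eqP.
apply: (congr1 (@^~ x) (h _)) => a b.
transitivity (itg (fun x => cut a b u x - cut a b (V f) x)).
  by apply: eq_itg => y; rewrite /cut; case: ifPn => // _; rewrite subrr.
by rewrite itgB ?key ?subrr//; exact: intg_cut.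
Qed.

(** [fourier] selects an arbitrary transform; norms computed from an explicit one rely on this
    independence of the choice. *)
Lemma is_fourier_unique u (g1 g2 : R -> R[i]) : continuous u -> is_fourier u g1 -> is_fourier u g2 ->
  {ae mu, forall x : measurableTypeR R, cmod (g1 x) = cmod (g2 x)}.
Proof.
move=> cu u1 u2; have [s1 L1] := is_fourier_L2 cu u1; have [s2 L2] := is_fourier_L2 cu u2.
have [_ /Lfun_sqi gr1 /Lfun_sqi gi1 _] := u1.
have [_ /Lfun_sqi gr2 /Lfun_sqi gi2 _] := u2.
have s : sqi (fun x => cmod (g1 x - g2 x)).
  apply: sqi_cmod.
    by have := sqiB gr1 gr2; congr sqi; apply/funext => x; case: (g1 x) => ? ?; case: (g2 x).
  by have := sqiB gi1 gi2; congr sqi; apply/funext => x; case: (g1 x) => ? ?; case: (g2 x).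
have z : itg (fun x => cmod (g1 x - g2 x) ^+ 2) = 0.
  apply/eqP; rewrite eq_le itg_ge0 ?andbT; last by move=> x; exact: sqr_ge0.
  apply: (@cvg_ge_cst R (fun n => 2 * itg (fun xi => cmod (truncated_fourier n u xi - g1 xi) ^+ 2) + 2 * itg
    (fun xi => cmod (truncated_fourier n u xi - g2 xi) ^+ 2))).
    move=> n; rewrite -!itgZ; [|exact: (s2 n).2|exact: (s1 n).2].
    rewrite -itgD; [|exact: (intgZ _ (s1 n).2)|exact: (intgZ _ (s2 n).2)].
    apply: itg_le; [exact: s.2|by apply: intgD; [exact: (intgZ _ (s1 n).2)|exact: (intgZ _ (s2 n).2)]|].
    move=> x; rewrite !cmod_sqr.
    case: (g1 x) => a b; case: (g2 x) => c d; case: (truncated_fourier n u x) => t v /=.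
    have := sqrB_le a t c; have := sqrB_le b v d.
    by rewrite -(sqrrN (a - t)) -(sqrrN (b - v)) !opprB; lra.
  by apply: cvg_to_eq; [apply: cvgD; (apply: cvgM; first exact: cvg_cst); [exact: L1|exact: L2]|rewrite mulr0 addr0].
have ae0 : {ae mu, forall x : measurableTypeR R, cmod (g1 x - g2 x) ^+ 2 = 0}.
  have : (\int[mu]_x `|(cmod (g1 x - g2 x) ^+ 2)%:E| = 0)%E.
    under eq_integral do rewrite gee0_abs ?lee_fin ?sqr_ge0//.
    by rewrite -EFin_itg ?z//; exact: s.2.
  move/(ae_eq_integral_abs mu measurableT ((measurable_EFinP _ _).2 (intg_meas s.2))).
  by apply: filterS => x /= /(_ I) [].
move: ae0; apply: filterS => x; rewrite cmod_sqr.
case: (g1 x) => a b; case: (g2 x) => c d /= h.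
have h1 : a - c = 0 by apply/eqP; rewrite -sqrf_eq0; have := sqr_ge0 (a - c); have := sqr_ge0 (b - d); rewrite eq_le; lra.
have h2 : b - d = 0 by apply/eqP; rewrite -sqrf_eq0; have := sqr_ge0 (a - c); have := sqr_ge0 (b - d); rewrite eq_le; lra.
by rewrite (subr0_eq h1) (subr0_eq h2).
Qed.

Lemma is_fourier_fourier u g : is_fourier u g -> is_fourier u (fourier u).
Proof. by move=> ug; have := xgetPex (fun=> 0) (ex_intro _ g ug). Qed.

End FourierHartley.

(** * Gevrey norms of Hartley transforms *)

Section Gevrey.
Context {R : realType}.
Notation mu := (@lebesgue_measure R).

Definition wt (sigma xi : R) : R := expR (sigma * (`|xi| + 1)).

Lemma wt_gt0 sigma xi : 0 < wt sigma xi.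
Proof. exact: expR_gt0. Qed.

Lemma wt_ge1 sigma xi : 0 <= sigma -> 1 <= wt sigma xi.
Proof. by move=> s0; rewrite /wt -expR0 ler_expR mulr_ge0// addr_ge0. Qed.

Lemma wtN sigma xi : wt sigma (- xi) = wt sigma xi.
Proof. by rewrite /wt normrN. Qed.

Lemma continuous_wt sigma : continuous (wt sigma).
Proof.
move=> x; apply: (@continuous_comp _ _ _ (fun x : R => sigma * (`|x| + 1)) expR); last exact: continuous_expR.
by apply: cvgM; [exact: cvg_cst|apply: cvgD; [exact: norm_continuous|exact: cvg_cst]].
Qed.

Lemma measurable_wt sigma : measurable_fun [set: R] (wt sigma).
Proof. by apply: continuous_measurable_fun; exact: continuous_wt. Qed.

(** At [s = 0] the polynomial factor is the constant [sqrt 2], since the zeroth power is 1 also at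
    [xi = 0]. *)
Lemma gevrey_weight0 sigma xi : gevrey_weight 0 sigma xi = wt sigma xi * Num.sqrt 2.
Proof. by rewrite /gevrey_weight mulr0 powRr0. Qed.

Lemma measurable_cmod (g : R -> R[i]) : measurable_fun [set: R] (fun x => complex.Re (g x)) ->
  measurable_fun [set: R] (fun x => complex.Im (g x)) -> measurable_fun [set: R] (fun x => cmod (g x)).
Proof.
move=> mr mi.
have -> : (fun x => cmod (g x)) = (fun x => Num.sqrt (complex.Re (g x) ^+ 2 + complex.Im (g x) ^+ 2)).
  by apply/funext => x; rewrite -cmod_sqr sqrtr_sqr ger0_norm// cmod_ge0.
apply: (measurableT_comp (continuous_measurable_fun (@sqrt_continuous R))).
by apply: measurable_funD; apply: measurable_funX.
Qed.

Lemma measurable_pow2 (f : R -> R) : measurable_fun [set: R] f ->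
  measurable_fun [set: measurableTypeR R] (fun x => (`|(EFin \o f) x| `^ 2)%E).
Proof.
move=> mf; rewrite (_ : (fun x => _) = EFin \o (fun x => f x ^+ 2)).
  by apply/measurable_EFinP; exact: measurable_funX.
apply/funext => x; transitivity ((`|f x| `^ 2)%R%:E) => //.
by rewrite powR_mulrn// real_normK// num_real.
Qed.

Lemma Lnorm2_ae (f k : R -> R) : measurable_fun [set: R] f -> measurable_fun [set: R] k ->
  {ae mu, forall x : measurableTypeR R, f x = k x} ->
  Lnorm mu 2%:E (EFin \o f) = Lnorm mu 2%:E (EFin \o k).
Proof.
move=> mf mk fk; rewrite unlock.
have E : (\int[mu]_x `|(EFin \o f) x| `^ 2 = \int[mu]_x `|(EFin \o k) x| `^ 2)%E.
  apply: ae_eq_integral => //; [exact: measurable_pow2|exact: measurable_pow2|].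
  by move: fk; apply: filterS => x /= ->.
by rewrite /Lnorm.body /= E.
Qed.

Lemma measurable_sum_fun n (F : 'I_n -> R -> R) : (forall i, measurable_fun [set: R] (F i)) ->
  measurable_fun [set: R] (fun x => \sum_(i < n) F i x).
Proof. by move=> mF; apply: measurable_sum. Qed.

Lemma ae_all_ord n (P : 'I_n -> measurableTypeR R -> Prop) :
  (forall i, {ae mu, forall x, P i x}) -> {ae mu, forall x, forall i, P i x}.
Proof. by move=> h; apply: filter_forall. Qed.

Variable n : nat.
Implicit Types (w : R -> 'cV[R]_n) (G : 'I_n -> R -> R[i]).

Definition gsum (sigma : R) G (xi : R) : R :=
  gevrey_weight 0 sigma xi * Num.sqrt (\sum_i cmod (G i xi) ^+ 2).

Lemma gsum_sqr sigma G xi : gsum sigma G xi ^+ 2 = \sum_i 2 * (wt sigma xi * cmod (G i xi)) ^+ 2.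
Proof.
rewrite /gsum gevrey_weight0 exprMn sqr_sqrtr; last by apply: sumr_ge0 => i _; exact: sqr_ge0.
rewrite exprMn sqr_sqrtr// mulr_sumr; apply: eq_bigr => i _.
by rewrite exprMn; ring.
Qed.

Lemma measurable_gsum sigma G : (forall i, measurable_fun [set: R] (fun x => cmod (G i x))) ->
  measurable_fun [set: R] (gsum sigma G).
Proof.
move=> mG; apply: measurable_funM.
  rewrite (_ : gevrey_weight _ _ = (fun x => wt sigma x * Num.sqrt 2)); last first.
    by apply/funext => x; rewrite gevrey_weight0.
  by apply: measurable_funM => //; exact: measurable_wt.
apply: (measurableT_comp (continuous_measurable_fun (@sqrt_continuous R))).
by apply: measurable_sum_fun => i; apply: measurable_funX.
Qed.

Lemma sqi_gsum sigma G : (forall i, sqi (fun x => wt sigma x * cmod (G i x))) ->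
  (forall i, measurable_fun [set: R] (fun x => cmod (G i x))) -> sqi (gsum sigma G) /\
  itg (fun x => gsum sigma G x ^+ 2) = \sum_i 2 * itg (fun x => (wt sigma x * cmod (G i x)) ^+ 2).
Proof.
move=> sG mG.
have E : (fun x => gsum sigma G x ^+ 2) = (fun x => \sum_i 2 * (wt sigma x * cmod (G i x)) ^+ 2).
  by apply/funext => x; exact: gsum_sqr.
have i2 i : intg (fun x => 2 * (wt sigma x * cmod (G i x)) ^+ 2) by exact: (intgZ _ (sG i).2).
split; first by split; [exact: measurable_gsum|rewrite E; exact: intg_sum].
by rewrite E itg_sum//; apply: eq_bigr => i _; rewrite itgZ//; exact: (sG i).2.
Qed.

(** The constant [4 pi] per component is 2 from the squared weight at [s = 0] times [2 pi] from the
    normalization of the Fourier transform. *)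
Lemma gevrey_norm_le (sigma : R) w (h : 'I_n -> R -> R) (c : R) : 0 <= sigma ->
  (forall i, component i w = V (h i)) -> (forall i, intg (h i)) ->
  (forall i, sqi (fun x => h i x * wt sigma x)) ->
  (forall i, itg (fun x => (h i x * wt sigma x) ^+ 2) <= c ^+ 2) -> 0 <= c ->
  (gevrey_norm 0 sigma w <= (Num.sqrt (4 * pi * n%:R) * c)%:E)%E.
Proof.
move=> s0 wE hi hs hcc c0.
have mh i : measurable_fun [set: R] (h i) by exact: intg_meas.
have hsq i : sqi (h i).
  apply: sqi_le (hs i) => // x; rewrite normrM ler_peMr//.
  by rewrite ger0_norm ?(ltW (wt_gt0 _ _))// wt_ge1.
pose G i := hartley_fourier (fun x => sqrt2pi * h i x).
have Gf i : is_fourier (component i w) (G i) by rewrite wE; exact: is_fourier_V.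
have cw i : continuous (component i w) by rewrite wE; exact: continuous_V.
have Ff i : is_fourier (component i w) (fourier (component i w)) by exact: is_fourier_fourier (Gf i).
have mf i (g : R -> R[i]) : is_fourier (component i w) g -> measurable_fun [set: R] (fun x => cmod (g x)).
  by move=> [_ /Lfun_sqi[mr _] /Lfun_sqi[mi _] _]; exact: measurable_cmod.
rewrite /gevrey_norm; case: asboolP => [_|]; last by case=> i; exists (G i).
have Lae : Lnorm mu 2%:E (EFin \o gsum sigma (fun i => fourier (component i w))) = Lnorm mu 2%:E (EFin \o gsum sigma G).
  apply: Lnorm2_ae.
  - exact: (measurable_gsum _ (fun i => mf i _ (Ff i))).
  - exact: (measurable_gsum _ (fun i => mf i _ (Gf i))).
  have := ae_all_ord (fun i => is_fourier_unique (cw i) (Ff i) (Gf i)).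
  apply: filterS => x hx; rewrite /gsum; congr (_ * Num.sqrt _).
  by apply: eq_bigr => i _; rewrite hx.
have GE i x : (wt sigma x * cmod (G i x)) ^+ 2 = pi * ((h i x * wt sigma x) ^+ 2 + (h i (- x) * wt sigma (- x)) ^+ 2).
  by rewrite exprMn cmod_hartley_fourier wtN !exprMn sqrt2pi_sqr; field.
have Gs i : sqi (fun x => wt sigma x * cmod (G i x)).
  split; first by apply: measurable_funM; [exact: measurable_wt|exact: mf (Gf i)].
  rewrite (_ : (fun x => _) = (fun x => pi * ((h i x * wt sigma x) ^+ 2 + (h i (- x) * wt sigma (- x)) ^+ 2)));
    last by apply/funext.
  by apply: intgZ; apply: intgD; [exact: (hs i).2|exact: (intg_opp (hs i).2)].
have [Gs2 GsE] := sqi_gsum Gs (fun i => mf i _ (Gf i)).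
rewrite -/(gsum _ _) [leLHS]Lae Lnorm2E// lee_fin.
rewrite -[X in _ <= _ * X](ger0_norm c0) -sqrtr_sqr -sqrtrM ?mulr_ge0 ?pi_ge0//.
rewrite ler_sqrt; last by rewrite !mulr_ge0 ?pi_ge0 ?sqr_ge0.
rewrite GsE; apply: (@le_trans _ _ (\sum_(i < n) 4 * pi * c ^+ 2)); last first.
  by rewrite sumr_const card_ord -[leLHS]mulr_natr [leLHS]mulrAC.
apply: ler_sum => i _; rewrite (eq_itg (GE i)) itgZ; last first.
  by apply: intgD; [exact: (hs i).2|exact: (intg_opp (hs i).2)].
rewrite itgD; [|exact: (hs i).2|exact: (intg_opp (hs i).2)].
rewrite (itg_opp (hs i).2) -mulr2n -mulr_natl.
have := hcc i; have := @pi_ge0 R; nra.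
Qed.

Lemma gevrey_norm_fin (sigma : R) w (c : R) : 0 <= c -> (gevrey_norm 0 sigma w <= c%:E)%E ->
  forall i, exists g, [/\ is_fourier (component i w) g, sqi (fun x => wt sigma x * cmod (g x)) &
  itg (fun x => (wt sigma x * cmod (g x)) ^+ 2) <= c ^+ 2].
Proof.
move=> c0; rewrite /gevrey_norm; case: asboolP => [wf|]; last by rewrite leye_eq.
move=> N i.
have Ff j : is_fourier (component j w) (fourier (component j w)).
  by case: (wf j) => g /is_fourier_fourier.
have mf j : measurable_fun [set: R] (fun x => cmod (fourier (component j w) x)).
  by have [_ /Lfun_sqi[mr _] /Lfun_sqi[mi _] _] := Ff j; exact: measurable_cmod.
pose S := gsum sigma (fun j => fourier (component j w)).
have mS : measurable_fun [set: R] S by exact: measurable_gsum.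
have NS : (Lnorm mu 2%:E (EFin \o S) <= c%:E)%E by exact: N.
have SL : S \in Lfun mu 2%:E.
  rewrite inE; apply/andP; split; rewrite inE/=//.
  by rewrite /finite_norm (le_lt_trans NS)// ltry.
have Ss := Lfun_sqi SL.
have S2 : itg (fun x => S x ^+ 2) <= c ^+ 2.
  move: NS; rewrite Lnorm2E// lee_fin => h.
  rewrite -[leLHS]sqr_sqrtr; last by apply: itg_ge0 => x; exact: sqr_ge0.
  by rewrite lerXn2r// nnegrE ?sqrtr_ge0.
have le x : (wt sigma x * cmod (fourier (component i w) x)) ^+ 2 <= S x ^+ 2.
  rewrite gsum_sqr (bigD1 i)//=.
  apply: (@le_trans _ _ (2 * (wt sigma x * cmod (fourier (component i w) x)) ^+ 2)).
    by rewrite ler_peMl ?sqr_ge0// ler1n.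
  by rewrite lerDl sumr_ge0// => j _; rewrite mulr_ge0// sqr_ge0.
have s : sqi (fun x => wt sigma x * cmod (fourier (component i w) x)).
  split; first by apply: measurable_funM => //; exact: measurable_wt.
  apply: (intg_le _ _ Ss.2); first by apply: measurable_funX; apply: measurable_funM => //; exact: measurable_wt.
  by move=> x; rewrite ger0_norm ?sqr_ge0.
exists (fourier (component i w)); split => //.
by apply: le_trans S2; apply: itg_le => //; [exact: s.2|exact: Ss.2].
Qed.

(** The positive width makes the profile integrable, by Cauchy-Schwarz against [exp (- sigma |x|)];
    this is what gives [fourier_inversion] at every point. *)
Lemma gevrey_norm_hartley (sigma : R) w (c : R) : 0 < sigma -> 0 <= c -> (forall i, continuous (component i w)) ->
  (gevrey_norm 0 sigma w <= c%:E)%E ->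
  exists h : 'I_n -> R -> R, forall i, [/\ component i w = V (h i), intg (h i),
    sqi (fun x => h i x * wt sigma x) & itg (fun x => (h i x * wt sigma x) ^+ 2) <= c ^+ 2].
Proof.
move=> s0 c0 cw N.
suff : forall i, exists hi : R -> R, [/\ component i w = V hi, intg hi,
    sqi (fun x => hi x * wt sigma x) & itg (fun x => (hi x * wt sigma x) ^+ 2) <= c ^+ 2].
  by move=> /choice[h hh]; exists h.
move=> i; have [g [gf gs gc]] := gevrey_norm_fin c0 N i.
pose f xi := sqrt2pi^-1 * (complex.Re (g xi) - complex.Im (g xi)).
have [_ /Lfun_sqi gr /Lfun_sqi gi _] := gf.
have fs : sqi f by apply: sqiZ; exact: sqiB.
(* The loss in [(p - q)^2 <= 2 (p^2 + q^2)] is absorbed by the normalization, as [2 <= 2 pi]. *)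
have cpi1 : sqrt2pi^-1 ^+ 2 * 2 <= (1 : R).
  rewrite exprVn sqrt2pi_sqr invfM mulrAC mulVf// mul1r invf_le1 ?pi_gt0//.
  by have := @pi_ge2 R; lra.
have le x : (f x * wt sigma x) ^+ 2 <= (wt sigma x * cmod (g x)) ^+ 2.
  rewrite !exprMn mulrC ler_wpM2l ?sqr_ge0// cmod_sqr.
  move: cpi1; move: (sqrt2pi^-1 ^+ 2) (sqr_ge0 (sqrt2pi^-1 : R)) => k k0 k1.
  move: (complex.Re _) (complex.Im _) => p q.
  have : (p - q) ^+ 2 <= 2 * (p ^+ 2 + q ^+ 2) by have := sqr_ge0 (p + q); rewrite sqrrD sqrrB; lra.
  have : 0 <= p ^+ 2 + q ^+ 2 by rewrite addr_ge0 ?sqr_ge0.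
  move: (p ^+ 2 + q ^+ 2) ((p - q) ^+ 2) => s t s0' st.
  nra.
have mfw : measurable_fun [set: R] (fun x => f x * wt sigma x).
  by apply: measurable_funM; [exact: fs.1|exact: measurable_wt].
have fws : sqi (fun x => f x * wt sigma x).
  split => //; apply: (intg_le _ _ gs.2); first exact: measurable_funX.
  by move=> x; rewrite ger0_norm ?sqr_ge0.
have es : sqi (fun x => expR (- (sigma * `|x|))).
  split; first exact: intg_meas (intg_expabs s0).
  have s2 : 0 < 2 * sigma by rewrite mulr_gt0.
  have := intg_expabs s2; congr intg; apply/funext => x.
  by rewrite -expRM_natl; congr expR; ring.
have fi : intg f.
  apply: (intg_le _ _ (intg_abs (sqiM fws es))); first exact: fs.1.
  move=> x; rewrite -[X in _ <= `|X|]mulrA [X in _ <= X]normrM ler_peMr// ger0_norm ?mulr_ge0 ?expR_ge0//.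
  by rewrite /wt -expRD -[X in X <= _]expR0 ler_expR mulrDr mulr1; lra.
exists f; split => //; first exact: fourier_inversion.
by apply: le_trans gc; apply: itg_le => //; [exact: fws.2|exact: gs.2].
Qed.

End Gevrey.

(** * Majorant algebra of profiles *)

Section Convolution.
Context {R : realType}.
Notation mu := (@lebesgue_measure R).

Definition conv (f g : R -> R) (xi : R) := itg (fun a => f a * g (xi - a)).

Definition flip (f : R -> R) (x : R) := f (- x).

(* Hartley profile of a product: [V (star f g) = V f * V g] *)
Definition star (f g : R -> R) (xi : R) :=
  2^-1 * (conv f (flip g) xi + conv f (flip g) (- xi) + (conv f g xi - conv f g (- xi))).

(* Hartley profile of a derivative *)
Definition D (f : R -> R) (xi : R) := - xi * f (- xi).

Definition convable (f g : R -> R) := forall xi, intg (fun a => f a * g (xi - a)).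

Lemma measurable_conv2 (f g : R -> R) : measurable_fun [set: R] f -> measurable_fun [set: R] g ->
  measurable_fun [set: R * R] (fun z : R * R => f z.2 * g (z.1 - z.2)).
Proof.
move=> mf mg; apply: measurable_funM; first exact: (measurableT_comp mf).
by apply: (measurableT_comp mg); exact: measurable_funB.
Qed.

(** Fubini for a convolution tested against a bounded function: the tests [cos] and [sin] lead to
    [V_star], the constant 1 to integrability. *)
Lemma itg_conv (f g c : R -> R) (B : R) : intg f -> intg g -> convable f g ->
  measurable_fun [set: R] c -> (forall x, `|c x| <= B) ->
  [/\ intg (fun xi => conv f g xi * c xi),
    intg (fun a => f a * itg (fun b => g b * c (a + b))) &
    itg (fun xi => conv f g xi * c xi) = itg (fun a => f a * itg (fun b => g b * c (a + b)))].
Proof.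
move=> fi gi fg mc cB.
have mf := intg_meas fi; have mg := intg_meas gi.
have B0 : 0 <= B by apply: le_trans (cB 0).
have [|||||H1 H2 H3] := @itg_fubini R (fun z : R * R => f z.2 * g (z.1 - z.2) * c z.1) (fun a =>
  `|f a| * (B * itg (fun x => `|g x|))).
- by apply: measurable_funM; [exact: measurable_conv2|exact: (measurableT_comp mc)].
- by move=> x /=; have := intgZ (c x) (fg x); congr intg; apply/funext => a; rewrite mulrC.
- move=> a /=; apply: (intg_mulb (c := B)) => //.
  by apply: intgZ; exact: intg_sub.
- by under eq_fun do rewrite mulrC; apply: intgZ; exact: intg_abs.
- move=> a /=; rewrite -(itg_sub a (intg_abs gi)) -itgZ; last exact: intg_sub (intg_abs gi).
  rewrite -itgZ; last by apply: intgZ; exact: intg_sub (intg_abs gi).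
  apply: itg_le.
  + apply: intg_abs; apply: (intg_mulb (c := B)) => //.
    by apply: intgZ; exact: intg_sub.
  + by do 2 apply: intgZ; exact: intg_sub (intg_abs gi).
  + by move=> x; rewrite !normrM -mulrA ler_wpM2l// mulrC ler_wpM2r.
have E x : itg (fun y => f y * g (x - y) * c x) = conv f g x * c x.
  by rewrite /conv mulrC -itgZ//; apply: eq_itg => a; rewrite mulrC.
have E2 a : itg (fun x => f a * g (x - a) * c x) = f a * itg (fun b => g b * c (a + b)).
  have gc : intg (fun b => g b * c (a + b)).
    apply: (intg_mulb (c := B)) => //.
    by apply: (measurableT_comp mc); exact: measurable_funD.
  rewrite -(itg_sub a gc) -itgZ; last exact: intg_sub gc.
  by apply: eq_itg => x; rewrite addrCA subrr addr0 mulrA.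
split; first by move: H1; congr intg; apply/funext => x /=; rewrite E.
- by move: H2; congr intg; apply/funext => x /=; rewrite E2.
- by rewrite -(eq_itg E) H3; apply: eq_itg => a /=; rewrite E2.
Qed.

Lemma intg_conv f g : intg f -> intg g -> convable f g -> intg (conv f g).
Proof.
move=> fi gi fg.
have [||h _ _] := @itg_conv f g (fun=> 1) 1 fi gi fg; first exact: measurable_cst.
  by move=> x; rewrite normr1.
by move: h; congr intg; apply/funext => x; rewrite mulr1.
Qed.

Lemma intg_flip f : intg f -> intg (flip f). Proof. exact: intg_opp. Qed.

Lemma intg_star f g : intg f -> intg g -> convable f g -> convable f (flip g) -> intg (star f g).
Proof.
move=> fi gi fg fg'; have c1 := intg_conv fi gi fg.
have c2 := intg_conv fi (intg_flip gi) fg'.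
apply: intgZ; apply: intgD.
  by apply: intgD => //; exact: intg_opp.
by apply: intgB => //; exact: intg_opp.
Qed.

(** By [cas_mul] the product is the double integral of [f(a) g(b) (cos ((a - b) X) + sin ((a + b)
    X))]. The cosine sees only the even part of [conv f (flip g)] and the sine the odd part of
    [conv f g], which explains the symmetrization in [star]. *)
Lemma V_star f g : intg f -> intg g -> convable f g -> convable f (flip g) ->
  V (star f g) = (fun X => V f X * V g X).
Proof.
move=> fi gi fg fg'; apply/funext => X.
have c1 := intg_conv fi gi fg.
have c2 := intg_conv fi (intg_flip gi) fg'.
have VN (h : R -> R) : intg h -> itg (fun xi => h (- xi) * cas (xi * X)) = itg (fun xi => h xi * cas (- (xi * X))).
  move=> hi; have i := intg_cas (- X) hi.
  rewrite -[RHS](eq_itg (f := fun xi => h xi * cas (xi * - X))); last by move=> x; rewrite mulrN.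
  by rewrite -(itg_opp i); apply: eq_itg => x; rewrite mulrNN.
have mcos : measurable_fun [set: R] (fun x => cos (x * X)).
  apply: continuous_measurable_fun => x.
  apply: (@continuous_comp _ _ _ (fun x : R => x * X) cos); first exact: mulrr_continuous.
  exact: continuous_cos.
have msin : measurable_fun [set: R] (fun x => sin (x * X)).
  apply: continuous_measurable_fun => x.
  apply: (@continuous_comp _ _ _ (fun x : R => x * X) sin); first exact: mulrr_continuous.
  exact: continuous_sin.
have lc x : `|cos (x * X)| <= 1 by rewrite ler_norml cos_le1 cos_geN1.
have ls x : `|sin (x * X)| <= 1 by rewrite ler_norml sin_le1 sin_geN1.
have [ic jc Ec] := itg_conv fi (intg_flip gi) fg' mcos lc.
have [is_ js Es] := itg_conv fi gi fg msin ls.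
have cc h : intg h -> intg (fun xi => h xi * cas (xi * X)) by exact: intg_cas.
have cn (h : R -> R) : intg h -> intg (fun xi => h (- xi) * cas (xi * X)).
  by move=> hi; apply: intg_cas; exact: intg_opp.
have i0 a : intg (fun b => g b * cos ((a - b) * X)).
  apply: (intg_mulb (c := 1)) => //.
  by apply: (measurableT_comp mcos); exact: measurable_funB.
have i1 a : intg (fun b => g b * sin ((a + b) * X)).
  apply: (intg_mulb (c := 1)) => //.
  by apply: (measurableT_comp msin); exact: measurable_funD.
transitivity (itg (fun xi => conv f (flip g) xi * cos (xi * X)) + itg (fun xi => conv f g xi * sin (xi * X))).
  have -> : V (star f g) X = 2^-1 * ((itg (fun xi => conv f (flip g) xi * cas (xi * X)) + itg (fun xi =>
    conv f (flip g) (- xi) * cas (xi * X)))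
     + (itg (fun xi => conv f g xi * cas (xi * X)) - itg (fun xi => conv f g (- xi) * cas (xi * X)))).
    rewrite -itgD; [|exact: cc|exact: cn]; rewrite -itgB; [|exact: cc|exact: cn].
    rewrite -itgD; [|by apply: intgD; [exact: cc|exact: cn]|by apply: intgB; [exact: cc|exact: cn]].
    rewrite -itgZ; last by apply: intgD; [apply: intgD; [exact: cc|exact: cn]|apply: intgB; [exact: cc|exact: cn]].
    by apply: eq_itg => x; rewrite /star; ring.
  rewrite !VN// -itgD; [|exact: cc|]; last first.
    by have := intg_cas (- X) c2; congr intg; apply/funext => x; rewrite mulrN.
  have h1 : intg (fun xi => conv f g xi * cas (- (xi * X))).
    by have := intg_cas (- X) c1; congr intg; apply/funext => x; rewrite mulrN.
  rewrite -itgB//; last exact: cc.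
  rewrite mulrDr; congr (_ + _); rewrite -itgZ.
  - by apply: eq_itg => x; rewrite /cas cosN sinN; field.
  - have := intgZ 2 ic; congr intg; apply/funext => x; rewrite /cas cosN sinN; ring.
  - by apply: eq_itg => x; rewrite /cas cosN sinN; field.
  - have := intgZ 2 is_; congr intg; apply/funext => x; rewrite /cas cosN sinN; ring.
have E2 a : itg (fun b => flip g b * cos ((a + b) * X)) = itg (fun b => g b * cos ((a - b) * X)).
  by rewrite -[RHS](itg_opp (i0 a)); apply: eq_itg => b; rewrite /flip opprK.
have E3 a : itg (fun b => g b * cos ((a - b) * X)) + itg (fun b => g b * sin ((a + b) * X)) = cas (a * X) * V g X.
  rewrite -itgD// -itgZ; last exact: cc.
  apply: eq_itg => b; rewrite mulrCA cas_mul -mulrBl -mulrDl; ring.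
rewrite Ec Es -itgD// mulrC -itgZ; last exact: cc.
by apply: eq_itg => a; rewrite E2 -mulrDr E3 mulrA mulrC.
Qed.

(** The derivative of [cas] at [t] is [cas (- t)], so differentiation multiplies by [xi] and
    reflects; the reflection is moved onto the profile. *)
Lemma V_derive f : intg f -> intg (fun xi => xi * f xi) -> forall X,
  derivable (V f) X 1 /\ derive1 (V f) X = V (D f) X.
Proof.
move=> fi gi X.
have dc (x y : R) : is_derive x (1 : R) (fun X : R => f y * cas (y * X)) (y * f y * cas (- (y * x))).
  by rewrite /cas; apply: is_derive_eq; rewrite /GRing.scale/= cosN sinN; ring.
have E (x y : R) : partial1of2 (fun X y => f y * cas (y * X)) x y = y * f y * cas (- (y * x)).
  by rewrite partial1of2E; exact: (@derive_val _ _ _ _ _ _ _ (dc x y)).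
have VE : V f = fun l => \int[mu]_(x in setT) (f x * cas (x * l)).
  by apply/funext => l; rewrite /V itg.unlock.
have H1 (x : R) : `]X - 1, X + 1[%classic x -> intg (fun xi => f xi * cas (xi * x)) by move=> _; exact: intg_cas.
have Xi : `]X - 1, X + 1[%classic X by rewrite /= in_itv/=; apply/andP; split; lra.
have G0 (y : R) : 0 <= 2 * `|y * f y| by rewrite mulr_ge0.
have iG : intg (fun y => 2 * `|y * f y|) by apply: intgZ; exact: intg_abs.
have dd (x y : R) : `]X - 1, X + 1[%classic x -> [set: R] y -> derivable (fun X : R => f y * cas (y * X)) x 1.
  by move=> _ _; have /@ex_derive := dc x y.
have Gb (x y : R) : `]X - 1, X + 1[%classic x -> [set: R] y -> `|partial1of2 (fun X y =>
  f y * cas (y * X)) x y| <= 2 * `|y * f y|.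
  by move=> _ _; rewrite E normrM mulrC ler_wpM2r// cas_le2.
split.
  by rewrite VE; exact: (@derivable_under_integral R _ _ mu _ setT measurableT X _ _ Xi H1 dd _ G0 iG Gb).
rewrite VE (@differentiation_under_integral R _ _ mu _ setT measurableT X _ _ Xi H1 dd _ G0 iG Gb).
transitivity (itg (fun y => y * f y * cas (- (y * X)))).
  by rewrite itg.unlock; apply: eq_Rintegral => y _; rewrite E.
have i : intg (fun y => y * f y * cas (- (y * X))).
  by have := intg_cas (- X) gi; congr intg; apply/funext => y; rewrite mulrN.
rewrite -(itg_opp i); apply: eq_itg => y.
by rewrite /D -[- (- y * X)]mulNr opprK.
Qed.

End Convolution.

(** * Exponential weights and profiles dominated by a majorant *)

Section Majorant.
Context {R : realType}.

Definition br (xi : R) : R := `|xi| + 1.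

Lemma br_ge1 (xi : R) : 1 <= br xi. Proof. by rewrite /br lerDr. Qed.
Lemma br_gt0 (xi : R) : 0 < br xi. Proof. by rewrite (lt_le_trans ltr01)// br_ge1. Qed.
Lemma brN (xi : R) : br (- xi) = br xi. Proof. by rewrite /br normrN. Qed.

Lemma brD (a b : R) : br (a + b) <= br a + br b.
Proof. by rewrite /br; have := ler_normD a b; lra. Qed.

Lemma measurable_br : measurable_fun [set: R] br.
Proof.
apply: continuous_measurable_fun => x.
by apply: cvgD; [exact: norm_continuous|exact: cvg_cst].
Qed.

Lemma wtE (s xi : R) : wt s xi = expR (s * br xi). Proof. by []. Qed.

Lemma wt_le1 (s xi : R) : 0 <= s -> wt (- s) xi <= 1.
Proof. by move=> s0; rewrite wtE -[leRHS]expR0 ler_expR mulNr oppr_le0 mulr_ge0// ltW// br_gt0. Qed.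

Lemma wtD (s t xi : R) : wt (s + t) xi = wt s xi * wt t xi.
Proof. by rewrite !wtE mulrDl expRD. Qed.

Lemma wt_mono (s t xi : R) : s <= t -> wt s xi <= wt t xi.
Proof. by move=> st; rewrite !wtE ler_expR ler_pM2r// br_gt0. Qed.

Lemma wt_submul (s a b : R) : 0 <= s -> wt (- s) a * wt (- s) b <= wt (- s) (a + b).
Proof.
move=> s0; rewrite !wtE -expRD ler_expR -mulrDr !mulNr lerN2 ler_wpM2l//; exact: brD.
Qed.

(* one power of [br] is moved from a factor to the product, at a cost [1/s] *)
Lemma br_wt_submul (s a b : R) : 0 < s ->
  br b * (wt (- s) a * wt (- s) b) <= (1 + s^-1) * (br (a + b) * wt (- s) (a + b)).
Proof.
move=> s0; rewrite !wtE -expRD -mulrDr.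
set p := br (a + b); set q := br a + br b.
have pq : p <= q by exact: brD.
have p1 : 1 <= p by exact: br_ge1.
have bq : br b <= p + (q - p) by rewrite /q; have := br_gt0 a; lra.
have h1 : expR (- s * q) = expR (- s * p) * expR (- (s * (q - p))).
  by rewrite -expRD; congr expR; ring.
have h2 : (q - p) * expR (- (s * (q - p))) <= s^-1.
  rewrite expRN ler_pdivrMr ?expR_gt0// mulrC ler_pdivlMr//.
  have := expR_ge1Dx (s * (q - p)); rewrite mulrC; lra.
have h3 : expR (- (s * (q - p))) <= 1.
  by rewrite -expR0 ler_expR oppr_le0 mulr_ge0 ?subr_ge0// ltW.
rewrite h1; set e := expR (- s * p); set t := expR _ in h2 h3 *.
have e0 : 0 < e by exact: expR_gt0.
have t0 : 0 < t by exact: expR_gt0.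
have s1 : 0 < s^-1 by rewrite invr_gt0.
have h4 : br b * t <= (1 + s^-1) * p.
  apply: (@le_trans _ _ ((p + (q - p)) * t)); first by rewrite ler_pM2r.
  have : p * t <= p by rewrite ler_piMr//; lra.
  have : s^-1 <= s^-1 * p by rewrite ler_peMr// ltW.
  by lra.
by rewrite mulrCA [leRHS]mulrA [leRHS]mulrC ler_pM2l.
Qed.

(** [t exp (- s t) <= 1 / s], from [1 + y <= exp y]: one derivative costs the inverse of the width
    given up. *)
Lemma br_wt_le (s xi : R) : 0 < s -> br xi * wt (- s) xi <= s^-1.
Proof.
move=> s0; rewrite wtE mulNr expRN ler_pdivrMr ?expR_gt0// mulrC ler_pdivlMr//.
have := expR_ge1Dx (s * br xi); rewrite mulrC; lra.
Qed.

(* Stability under convolution turns profiles dominated by [m] into a Banach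
   algebra, with pointwise bounds instead of norms. *)
Record majorant (A : R) (m : R -> R) := Majorant {
  maj_intg : intg m;
  maj_ge0 : forall x, 0 <= m x;
  maj_even : forall x, m (- x) = m x;
  maj_sqi : sqi m;
  maj_itg2 : itg (fun x => m x ^+ 2) <= A;
  maj_itg1 : itg m <= A;
  maj_convable : convable m m;
  maj_conv : forall x, conv m m x <= A * m x;
  maj_A : 0 <= A }.

Variables (A : R) (m : R -> R).
Hypothesis M : majorant A m.

Definition bnd (s C : R) (f : R -> R) :=
  measurable_fun [set: R] f /\ forall xi, `|f xi| <= C * (m xi * wt (- s) xi).

(** The factor [br] records the loss of one derivative. Sources satisfy such bounds, and integration
    in time brings them back to [bnd]. *)
Definition bnd1 (s C : R) (f : R -> R) :=
  measurable_fun [set: R] f /\ forall xi, `|f xi| <= C * (br xi * (m xi * wt (- s) xi)).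

Lemma mwt_ge0 (s x : R) : 0 <= m x * wt (- s) x.
Proof. by rewrite mulr_ge0 ?(maj_ge0 M)// ltW// wt_gt0. Qed.

Lemma bmwt_ge0 (s x : R) : 0 <= br x * (m x * wt (- s) x).
Proof. by rewrite mulr_ge0 ?mwt_ge0// ltW// br_gt0. Qed.

Lemma bnd_mono (s C C' : R) (f : R -> R) : C <= C' -> bnd s C f -> bnd s C' f.
Proof. by move=> CC [mf h]; split => // x; rewrite (le_trans (h x))// ler_wpM2r// mwt_ge0. Qed.

Lemma bnd1_mono (s C C' : R) (f : R -> R) : C <= C' -> bnd1 s C f -> bnd1 s C' f.
Proof. by move=> CC [mf h]; split => // x; rewrite (le_trans (h x))// ler_wpM2r// bmwt_ge0. Qed.

Lemma bnd_wmono (s t C : R) (f : R -> R) : s <= t -> 0 <= C -> bnd t C f -> bnd s C f.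
Proof.
move=> st C0 [mf h]; split => // x; rewrite (le_trans (h x))// ler_wpM2l// ler_wpM2l ?(maj_ge0 M)//.
by rewrite wt_mono// lerN2.
Qed.

Lemma bndD (s C C' : R) (f g : R -> R) : bnd s C f -> bnd s C' g -> bnd s (C + C') (fun x => f x + g x).
Proof.
move=> [mf hf] [mg hg]; split; first exact: measurable_funD.
by move=> x; rewrite (le_trans (ler_normD _ _))// mulrDl lerD.
Qed.

Lemma bndB (s C C' : R) (f g : R -> R) : bnd s C f -> bnd s C' g -> bnd s (C + C') (fun x => f x - g x).
Proof.
move=> [mf hf] [mg hg]; split; first exact: measurable_funB.
by move=> x; rewrite (le_trans (ler_normB _ _))// mulrDl lerD.
Qed.

Lemma bndZ (s C c : R) (f : R -> R) : bnd s C f -> bnd s (`|c| * C) (fun x => c * f x).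
Proof.
move=> [mf hf]; split; first exact: measurable_funM.
by move=> x; rewrite normrM -mulrA ler_wpM2l.
Qed.

Lemma bnd1D (s C C' : R) (f g : R -> R) : bnd1 s C f -> bnd1 s C' g -> bnd1 s (C + C') (fun x => f x + g x).
Proof.
move=> [mf hf] [mg hg]; split; first exact: measurable_funD.
by move=> x; rewrite (le_trans (ler_normD _ _))// mulrDl lerD.
Qed.

Lemma bnd1B (s C C' : R) (f g : R -> R) : bnd1 s C f -> bnd1 s C' g -> bnd1 s (C + C') (fun x => f x - g x).
Proof.
move=> [mf hf] [mg hg]; split; first exact: measurable_funB.
by move=> x; rewrite (le_trans (ler_normB _ _))// mulrDl lerD.
Qed.

Lemma bnd1Z (s C c : R) (f : R -> R) : bnd1 s C f -> bnd1 s (`|c| * C) (fun x => c * f x).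
Proof.
move=> [mf hf]; split; first exact: measurable_funM.
by move=> x; rewrite normrM -mulrA ler_wpM2l.
Qed.

Lemma bnd_flip (s C : R) (f : R -> R) : bnd s C f -> bnd s C (flip f).
Proof.
move=> [mf hf]; split; first exact: (measurableT_comp mf (@oppr_measurable R setT)).
by move=> x; have := hf (- x); rewrite (maj_even M) wtN.
Qed.

Lemma bnd1_flip (s C : R) (f : R -> R) : bnd1 s C f -> bnd1 s C (flip f).
Proof.
move=> [mf hf]; split; first exact: (measurableT_comp mf (@oppr_measurable R setT)).
by move=> x; have := hf (- x); rewrite (maj_even M) wtN brN.
Qed.

Lemma bnd_D (s C : R) (f : R -> R) : 0 <= C -> bnd s C f -> bnd1 s C (D f).
Proof.
move=> C0 fb; have [mf hf] := bnd_flip fb; split.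
  by apply: measurable_funM => //; exact: oppr_measurable.
move=> x; rewrite /D normrM normrN mulrCA ler_pM//; last exact: hf.
by rewrite /br lerDl.
Qed.

Lemma bnd_intg (s C : R) (f : R -> R) : 0 <= s -> 0 <= C -> bnd s C f -> intg f.
Proof.
move=> s0 C0 [mf hf]; apply: (intg_le mf _ (intgZ C (maj_intg M))) => x.
by rewrite (le_trans (hf x))// ler_wpM2l// ler_piMr ?(maj_ge0 M)// wt_le1.
Qed.

Lemma bnd1_bnd0 (s C : R) (f : R -> R) : 0 < s -> 0 <= C -> bnd1 s C f -> bnd 0 (C * s^-1) f.
Proof.
move=> s0 C0 [mf hf]; split => // x; rewrite (le_trans (hf x))// -mulrA ler_wpM2l//.
rewrite oppr0 (wtE 0) mul0r expR0 mulr1 mulrCA [leRHS]mulrC ler_wpM2l ?(maj_ge0 M)//.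
exact: br_wt_le.
Qed.

Lemma bnd1_intg (s C : R) (f : R -> R) : 0 < s -> 0 <= C -> bnd1 s C f -> intg f.
Proof.
move=> s0 C0 fb; apply: (bnd_intg (lexx 0) _ (bnd1_bnd0 s0 C0 fb)).
by rewrite mulr_ge0// invr_ge0 ltW.
Qed.

Lemma bnd_sqi (s C : R) (f : R -> R) : 0 <= s -> 0 <= C -> bnd s C f -> sqi f /\ itg (fun x => f x ^+ 2) <= C ^+ 2 * A.
Proof.
move=> s0 C0 [mf hf].
have le x : `|f x| <= `|C * m x|.
  rewrite (le_trans (hf x))// ger0_norm; last by rewrite mulr_ge0// (maj_ge0 M).
  by rewrite ler_wpM2l// ler_piMr ?(maj_ge0 M)// wt_le1.
have ms := sqiZ C (maj_sqi M).
have fs : sqi f by exact: sqi_le le ms.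
split => //; apply: (@le_trans _ _ (itg (fun x => (C * m x) ^+ 2))).
  apply: itg_le; [exact: fs.2|exact: ms.2|move=> x].
  by rewrite -[leLHS]real_normK ?num_real// -[leRHS]real_normK ?num_real// lerXn2r// nnegrE.
rewrite (eq_itg (g := fun x => C ^+ 2 * m x ^+ 2)); last by move=> x; rewrite exprMn.
rewrite itgZ; last exact: (maj_sqi M).2.
by rewrite ler_wpM2l ?sqr_ge0// (maj_itg2 M).
Qed.

(* [w] is the weight carried by the convolution *)
Lemma conv_le (f g c : R -> R) : intg f -> intg g -> (forall x, 0 <= c x) ->
  (forall x a, `|f a * g (x - a)| <= c x * (m a * m (x - a))) ->
  [/\ convable f g, measurable_fun [set: R] (conv f g) & forall x, `|conv f g x| <= A * (c x * m x)].
Proof.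
move=> fi gi c0 fg.
have cv : convable f g.
  move=> x; apply: (intg_le _ (fg x)); last exact: intgZ (maj_convable M x).
  apply: measurable_funM; first exact: intg_meas.
  exact: intg_meas (intg_rsub x gi).
split => //; first exact: intg_meas (intg_conv fi gi cv).
move=> x; apply: (@le_trans _ _ (itg (fun a => c x * (m a * m (x - a))))).
  apply: itg_abs_le => //; [exact: intg_meas (cv x)|exact: intgZ (maj_convable M x)].
rewrite itgZ; last exact: (maj_convable M x).
by rewrite mulrCA ler_wpM2l//; exact: (maj_conv M).
Qed.

(** Four convolutions, each at most [A c m], and the factor 1/2 of [star]. *)
Lemma star_le (f g : R -> R) (c : R -> R) : intg f -> intg g -> (forall x, 0 <= c x) -> (forall x, c (- x) = c x) ->
  (forall x a, `|f a * g (x - a)| <= c x * (m a * m (x - a))) ->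
  (forall x a, `|f a * flip g (x - a)| <= c x * (m a * m (x - a))) ->
  [/\ convable f g, convable f (flip g), measurable_fun [set: R] (star f g) &
    forall x, `|star f g x| <= 2 * A * (c x * m x)].
Proof.
move=> fi gi c0 ce h1 h2.
have [v1 m1 b1] := conv_le fi gi c0 h1.
have [v2 m2 b2] := conv_le fi (intg_flip gi) c0 h2.
split => //; first exact: intg_meas (intg_star fi gi v1 v2).
move=> x; rewrite /star normrM ger0_norm ?invr_ge0// -(@ler_pM2l _ 2)// mulrA mulfV// mul1r.
have := b1 x; have := b1 (- x); have := b2 x; have := b2 (- x).
rewrite ce (maj_even M).
move=> a1 a2 a3 a4; rewrite (le_trans (ler_normD _ _))//.
have := ler_normD (conv f (flip g) x) (conv f (flip g) (- x)).
have := ler_normB (conv f g x) (conv f g (- x)).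
rewrite -!mulrA; lra.
Qed.

Lemma star_bnd (s C C' : R) (f g : R -> R) : 0 <= s -> 0 <= C -> 0 <= C' -> bnd s C f -> bnd s C' g ->
  [/\ convable f g, convable f (flip g) & bnd s (2 * A * (C * C')) (star f g)].
Proof.
move=> s0 C0 C'0 fb gb.
have gen h : bnd s C' h -> forall x a, `|f a * h (x - a)| <= C * C' * wt (- s) x * (m a * m (x - a)).
  move=> [mh hh] x a; rewrite normrM; apply: (le_trans (ler_pM _ _ (fb.2 a) (hh (x - a)))) => //.
  rewrite mulrACA -[leRHS]mulrA ler_wpM2l ?mulr_ge0// mulrACA mulrC.
  rewrite ler_wpM2r ?mulr_ge0 ?(maj_ge0 M)//.
  by apply: le_trans (wt_submul _ _ s0) _; rewrite addrC subrK.
have [||||||v1 v2 m1 b1] := @star_le f g (fun x => C * C' * wt (- s) x).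
- exact: bnd_intg fb.
- exact: bnd_intg gb.
- by move=> x; rewrite !mulr_ge0// ltW// wt_gt0.
- by move=> x; rewrite wtN.
- exact: gen.
- exact: gen (bnd_flip gb).
split => //; split => // x; apply: le_trans (b1 x) _.
by rewrite -!mulrA ler_wpM2l// ler_wpM2l ?(maj_A M)// ler_wpM2l// ler_wpM2l// mulrC.
Qed.

(** The constant depends on the lower bound [s0] of the width rather than on [s], hence is uniform
    over the shrinking strip. *)
Lemma star_bnd1 (s0 s C C' : R) (f g : R -> R) : 0 < s0 -> s0 <= s -> 0 <= C -> 0 <= C' -> bnd s C f -> bnd1 s C' g ->
  [/\ convable f g, convable f (flip g) & bnd1 s (2 * A * ((1 + s0^-1) * (C * C'))) (star f g)].
Proof.
move=> s00 ss C0 C'0 fb gb.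
have sp : 0 < s by exact: lt_le_trans ss.
have gen h : bnd1 s C' h -> forall x a, `|f a * h (x - a)| <= (1 + s0^-1) * (C * C') * (br x * wt (- s) x) * (m
  a * m (x - a)).
  move=> [mh hh] x a; rewrite normrM; apply: (le_trans (ler_pM _ _ (fb.2 a) (hh (x - a)))) => //.
  have -> : C * (m a * wt (- s) a) * (C' * (br (x - a) * (m (x - a) * wt (- s) (x - a)))) =
    (C * C') * (m a * m (x - a)) * (br (x - a) * (wt (- s) a * wt (- s) (x - a))) by ring.
  have -> : (1 + s0^-1) * (C * C') * (br x * wt (- s) x) * (m a * m (x - a)) =
    (C * C') * (m a * m (x - a)) * ((1 + s0^-1) * (br x * wt (- s) x)) by ring.
  rewrite ler_wpM2l ?mulr_ge0 ?(maj_ge0 M)//.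
  apply: le_trans (br_wt_submul _ _ sp) _; rewrite [a + _]addrC subrK.
  rewrite ler_wpM2r ?mulr_ge0 ?(ltW (br_gt0 _)) ?(ltW (wt_gt0 _ _))//.
  by rewrite lerD2l lef_pV2.
have k0 : 0 <= 1 + s0^-1 by rewrite addr_ge0// invr_ge0 ltW.
have [||||||v1 v2 m1 b1] := @star_le f g (fun x => (1 + s0^-1) * (C * C') * (br x * wt (- s) x)).
- by apply: bnd_intg fb => //; exact: ltW.
- exact: bnd1_intg gb.
- by move=> x; rewrite !mulr_ge0// ltW// ?br_gt0 ?wt_gt0.
- by move=> x; rewrite wtN brN.
- exact: gen.
- exact: gen (bnd1_flip gb).
split => //; split => // x; apply: le_trans (b1 x) _.
rewrite -!mulrA !ler_wpM2l ?(maj_A M)//.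
  exact: ltW (br_gt0 x).
by rewrite mulrC.
Qed.

End Majorant.

(** * Exponentials of profiles *)

Section ExpSeries.
Context {R : realType}.

Lemma series_exp_le (y : R) n : 0 <= y -> series (exp_coeff y) n <= expR y.
Proof.
move=> y0; rewrite /expR; apply: nondecreasing_cvgn_le; last exact: is_cvg_series_exp_coeff.
by apply: nondecreasing_series => k _ _; exact: exp_coeff_ge0.
Qed.

Lemma exp_series_bound (a : R^nat) (c y : R) : 0 <= y -> 0 <= c ->
  (forall k, `|a k| <= c * exp_coeff y k) ->
  [/\ cvgn (series a), forall n, `|series a n| <= c * expR y &
      `|limn (series a)| <= c * expR y].
Proof.
move=> y0 c0 h.
have b n : `|series a n| <= c * expR y.
  apply: (@le_trans _ _ (c * series (exp_coeff y) n)); last by rewrite ler_wpM2l// series_exp_le.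
  rewrite /series/= mulr_sumr (le_trans (ler_norm_sum _ _ _))//.
  by apply: ler_sum => k _; exact: h.
have cv : cvgn (series a).
  apply: normed_cvg; apply: (series_le_cvg _ _ h) => //.
    by move=> k; rewrite mulr_ge0// exp_coeff_ge0.
  exact: is_cvg_seriesZ (is_cvg_series_exp_coeff y).
split => //; apply: (@cvg_le_cst _ (fun n => `|series a n|)) => //.
exact: cvg_norm cv.
Qed.

(** Dominated convergence for series: the tails are controlled uniformly in [n] by those of the
    exponential series, and finite sums converge termwise. *)
Lemma exp_series_dct (a : nat -> R^nat) (b : R^nat) (c y : R) : 0 <= y -> 0 <= c ->
  (forall n k, `|a n k| <= c * exp_coeff y k) -> (forall k, a n k @[n --> \oo] --> b k) ->
  limn (series (a n)) @[n --> \oo] --> limn (series b).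
Proof.
move=> y0 c0 h ab.
have hb k : `|b k| <= c * exp_coeff y k.
  by apply: (@cvg_le_cst _ (fun n => `|a n k|)) => //; exact: cvg_norm.
have [cb _ _] := exp_series_bound y0 c0 hb.
pose S N := series (exp_coeff y) N.
have tail (d : R^nat) N : (forall k, `|d k| <= c * exp_coeff y k) ->
    `|limn (series d) - series d N| <= c * (expR y - S N).
  move=> hd; have [cd _ _] := exp_series_bound y0 c0 hd.
  have h1 : `|series d n - series d N| @[n --> \oo] --> `|limn (series d) - series d N|.
    by apply: cvg_norm; apply: cvgB => //; exact: cvg_cst.
  have h2 : c * (S n - S N) @[n --> \oo] --> c * (expR y - S N).
    by apply: cvgMl_tmp; apply: cvgB; [exact: is_cvg_series_exp_coeff|exact: cvg_cst].
  apply: (ler_cvg_to h1 h2); near=> n.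
  have Nn : (N <= n)%N by near: n; exists N.
  rewrite /S !sub_series Nn mulr_sumr (le_trans (ler_norm_sum _ _ _))//.
  by apply: ler_sum => k _; exact: hd.
apply/cvgrPdist_le => e e0.
have : c * (expR y - S N) @[N --> \oo] --> 0.
  rewrite -(mulr0 c) -(subrr (expR y)).
  by apply: cvgMl_tmp; apply: cvgB; [exact: cvg_cst|exact: is_cvg_series_exp_coeff].
have e3 : 0 < e / 3 by rewrite divr_gt0.
move/cvgrPdist_le => /(_ _ e3)[N _ /(_ N (leqnn N))/=].
rewrite sub0r normrN => hN.
have hN' := le_trans (ler_norm _) hN.
have : series (a n) N @[n --> \oo] --> series b N.
  rewrite /series/=; elim: N {hN hN'} => [|N IH].
    by rewrite big_geq//; apply: cvg_near_cst; apply: nearW => n; rewrite big_geq.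
  rewrite big_nat_recr//=; under eq_cvg do rewrite big_nat_recr//=.
  exact: cvgD.
move/cvgrPdist_le => /(_ _ e3); apply: filterS => n hn.
have t1 := tail b N hb; have t2 := tail (a n) N (h n).
rewrite (_ : _ - _ = (limn (series b) - series b N) + (series b N - series (a n) N) - (limn (series (a n)) -
  series (a n) N)); last by ring.
rewrite (le_trans (ler_normB _ _))// (le_trans (lerD (ler_normD _ _) (lexx _)))//; lra.
Unshelve. all: by end_near. Qed.

End ExpSeries.

Section StarLinear.
Context {R : realType}.

Lemma conv_subl (f f' g : R -> R) : convable f g -> convable f' g ->
  forall x, conv (fun a => f a - f' a) g x = conv f g x - conv f' g x.
Proof.
by move=> h h' x; rewrite /conv -itgB//; apply: eq_itg => a; rewrite mulrBl.
Qed.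

Lemma conv_subr (f g g' : R -> R) : convable f g -> convable f g' ->
  forall x, conv f (fun a => g a - g' a) x = conv f g x - conv f g' x.
Proof.
by move=> h h' x; rewrite /conv -itgB//; apply: eq_itg => a; rewrite mulrBr.
Qed.

Lemma star_subl (f f' g : R -> R) : convable f g -> convable f' g ->
  convable f (flip g) -> convable f' (flip g) ->
  forall x, star (fun a => f a - f' a) g x = star f g x - star f' g x.
Proof. by move=> h1 h2 h3 h4 x; rewrite /star !conv_subl//; ring. Qed.

Lemma star_subr (f g g' : R -> R) : convable f g -> convable f g' ->
  convable f (flip g) -> convable f (flip g') ->
  forall x, star f (fun a => g a - g' a) x = star f g x - star f g' x.
Proof.
move=> h1 h2 h3 h4 x; rewrite /star.
have -> : flip (fun a => g a - g' a) = (fun a => flip g a - flip g' a) by [].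
by rewrite !conv_subr//; ring.
Qed.

Lemma conv_cvg (f g : nat -> R -> R) (f' g' m : R -> R) (B : R) : convable m m ->
  (forall n, measurable_fun [set: R] (f n)) -> (forall n, measurable_fun [set: R] (g n)) ->
  (forall n a b, `|f n a * g n b| <= B * (m a * m b)) ->
  (forall x, f n x @[n --> \oo] --> f' x) -> (forall x, g n x @[n --> \oo] --> g' x) ->
  forall x, conv (f n) (g n) x @[n --> \oo] --> conv f' g' x.
Proof.
move=> mm mf mg fg ff gg x; rewrite /conv.
have [||||_ //] := @itg_dct R (fun n a => f n a * g n (x - a)) (fun a => f' a * g' (x - a)) (fun a =>
  B * (m a * m (x - a))).
- move=> n; apply: measurable_funM => //; apply: (measurableT_comp (mg n)).
  by apply: measurable_funB.
- by move=> n a.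
- exact: intgZ.
- by move=> a; exact: cvgM.
Qed.

Lemma star_cvg (f g : nat -> R -> R) (f' g' m : R -> R) (B : R) : convable m m ->
  (forall x, m (- x) = m x) ->
  (forall n, measurable_fun [set: R] (f n)) -> (forall n, measurable_fun [set: R] (g n)) ->
  (forall n a b, `|f n a * g n b| <= B * (m a * m b)) ->
  (forall x, f n x @[n --> \oo] --> f' x) -> (forall x, g n x @[n --> \oo] --> g' x) ->
  forall x, star (f n) (g n) x @[n --> \oo] --> star f' g' x.
Proof.
move=> mm me mf mg fg ff gg x; rewrite /star.
have c1 := conv_cvg mm mf mg fg ff gg.
have c2 : forall x, conv (f n) (flip (g n)) x @[n --> \oo] --> conv f' (flip g') x.
  apply: (conv_cvg mm mf _ _ ff (B := B)).
  - by move=> n; apply: (measurableT_comp (mg n)); exact: oppr_measurable.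
  - by move=> n a b; rewrite /flip -(me b).
  - by move=> y; exact: gg.
by apply: cvgMl_tmp; apply: cvgD; [apply: cvgD|apply: cvgB].
Qed.

End StarLinear.

Section Exponential.
Context {R : realType}.

(** Profile of the power [k.+1], not [k]: a unit for [star] would be a Dirac mass, which is no
    function. This is also why 1 is subtracted in [exp_profile]. *)
Fixpoint star_pow (f : R -> R) (k : nat) : R -> R :=
  if k is k'.+1 then star f (star_pow f k') else f.

Definition exp_cf (k : nat) : R := 2 ^+ k.+1 / k.+1`!%:R.

(* Hartley profile of [exp (2 u) - 1] *)
Definition exp_profile (f : R -> R) (xi : R) : R := limn (series (fun k => exp_cf k * star_pow f k xi)).

Lemma exp_cf_ge0 k : 0 <= exp_cf k.
Proof. by rewrite divr_ge0// exprn_ge0. Qed.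

(** The factor [k.+1] produced by differences of powers cancels against the factorial, leaving terms
    of an exponential series. *)
Lemma exp_cf_le k : k.+1%:R * exp_cf k = 2 * (2 ^+ k / k`!%:R).
Proof.
rewrite /exp_cf exprS factS natrM; field.
by rewrite !pnatr_eq0/= -lt0n fact_gt0 addrC natr1 pnatr_eq0.
Qed.

Variables (A : R) (m : R -> R).
Hypothesis M : majorant A m.
Notation bnd := (bnd m).

Lemma star_pow_bnd (s C : R) f k : 0 <= s -> 0 <= C -> bnd s C f -> bnd s (C * (2 * A * C) ^+ k) (star_pow f k).
Proof.
move=> s0 C0 fb; elim: k => [|k IH]; first by rewrite expr0 mulr1.
have A0 := maj_A M.
have [|_ _] := star_bnd M s0 C0 _ fb IH; first by rewrite mulr_ge0// exprn_ge0// !mulr_ge0.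
by rewrite (_ : 2 * A * _ = C * (2 * A * C) ^+ k.+1)//; rewrite exprS; ring.
Qed.

(** Induction on [f f^k - g g^k = (f - g) f^k + g (f^k - g^k)]. *)
Lemma star_pow_lip (s C d : R) f g k : 0 <= s -> 0 <= C -> 0 <= d -> bnd s C f -> bnd s C g ->
  bnd s d (fun x => f x - g x) ->
  bnd s (d * k.+1%:R * (2 * A * C) ^+ k) (fun x => star_pow f k x - star_pow g k x).
Proof.
move=> s0 C0 d0 fb gb fgb; elim: k => [|k IH]; first by rewrite expr0 !mulr1.
have A0 := maj_A M.
have AC0 : 0 <= (2 * A * C) ^+ k by rewrite exprn_ge0// !mulr_ge0.
have pf := star_pow_bnd k s0 C0 fb; have pg := star_pow_bnd k s0 C0 gb.
have CC0 : 0 <= C * (2 * A * C) ^+ k by rewrite mulr_ge0.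
have [v1 v2 b1] := star_bnd M s0 d0 CC0 fgb pf.
have dk : 0 <= d * k.+1%:R * (2 * A * C) ^+ k by rewrite !mulr_ge0.
have [v3 v4 b2] := star_bnd M s0 C0 dk gb IH.
have [w1 w2 _] := star_bnd M s0 C0 CC0 fb pf.
have [w3 w4 _] := star_bnd M s0 C0 CC0 gb pf.
have [w5 w6 _] := star_bnd M s0 C0 CC0 gb pg.
have -> : d * k.+2%:R * (2 * A * C) ^+ k.+1 =
  2 * A * (d * (C * (2 * A * C) ^+ k)) + 2 * A * (C * (d * k.+1%:R * (2 * A * C) ^+ k)).
  by rewrite exprS -(natr1 k.+1); ring.
have := bndD b1 b2.
congr (bnd _ _ _); apply/funext => x.
by rewrite star_subl// star_subr//=; ring.
Qed.

Lemma exp_coeff_scaled (B : R) k : 2 * (2 ^+ k / k`!%:R) * B ^+ k = 2 * exp_coeff (2 * B) k.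
Proof. by rewrite /exp_coeff/= exprMn; ring. Qed.

Lemma exp_cf_star_pow_le (s C : R) f k x : 0 <= s -> 0 <= C -> bnd s C f ->
  `|exp_cf k * star_pow f k x| <= 2 * C * (m x * wt (- s) x) * exp_coeff (2 * (2 * A * C)) k.
Proof.
move=> s0 C0 fb; have A0 := maj_A M.
rewrite normrM ger0_norm ?exp_cf_ge0//.
have hb := (star_pow_bnd k s0 C0 fb).2 x.
have AC0 : 0 <= (2 * A * C) ^+ k by rewrite exprn_ge0// !mulr_ge0.
(* The bound is enlarged by [k.+1] so as to reach the form of [exp_cf_le], shared with the Lipschitz
   estimate. *)
apply: (@le_trans _ _ (k.+1%:R * exp_cf k * (C * (2 * A * C) ^+ k * (m x * wt (- s) x)))).
  apply: ler_pM => //; first exact: exp_cf_ge0.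
  by rewrite ler_peMl ?exp_cf_ge0// ler1n.
have E := exp_coeff_scaled (2 * A * C) k.
rewrite exp_cf_le (_ : 2 * C * _ * _ = C * (m x * wt (- s) x) * (2 * exp_coeff (2 * (2 * A * C)) k)); last by ring.
by rewrite -E le_eqVlt; apply/orP; left; apply/eqP; ring.
Qed.

Lemma exp_cf_star_pow_lip_le (s C d : R) f g k x : 0 <= s -> 0 <= C -> 0 <= d -> bnd s C f -> bnd s C g ->
  bnd s d (fun x => f x - g x) ->
  `|exp_cf k * star_pow f k x - exp_cf k * star_pow g k x| <= 2 * d * (m x * wt (- s) x) * exp_coeff (2 * (2 * A * C)) k.
Proof.
move=> s0 C0 d0 fb gb fgb; have A0 := maj_A M.
rewrite -mulrBr normrM ger0_norm ?exp_cf_ge0//.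
have hb := (star_pow_lip k s0 C0 d0 fb gb fgb).2 x.
apply: (le_trans (ler_wpM2l (exp_cf_ge0 k) hb)).
have E := exp_coeff_scaled (2 * A * C) k.
rewrite (_ : 2 * d * _ * _ = d * (m x * wt (- s) x) * (2 * exp_coeff (2 * (2 * A * C)) k)); last by ring.
by rewrite -E -exp_cf_le le_eqVlt; apply/orP; left; apply/eqP; ring.
Qed.

Let y0 (C : R) : 0 <= C -> 0 <= 2 * (2 * A * C).
Proof. by move=> C0; rewrite !mulr_ge0// (maj_A M). Qed.

Let w0 (s C x : R) : 0 <= C -> 0 <= 2 * C * (m x * wt (- s) x).
Proof. by move=> C0; rewrite !mulr_ge0// ?(maj_ge0 M)// ltW// wt_gt0. Qed.

Lemma exp_profile_cvg (s C : R) f x : 0 <= s -> 0 <= C -> bnd s C f ->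
  series (fun k => exp_cf k * star_pow f k x) n @[n --> \oo] --> exp_profile f x.
Proof.
move=> s0 C0 fb.
by have [] := exp_series_bound (y0 C0) (w0 s x C0) (fun k => exp_cf_star_pow_le k x s0 C0 fb).
Qed.

Lemma measurable_exp_profile_series (s C : R) f n : 0 <= s -> 0 <= C -> bnd s C f ->
  measurable_fun [set: R] (fun x => series (fun k => exp_cf k * star_pow f k x) n).
Proof.
move=> s0 C0 fb; rewrite /series/=; apply: measurable_sum => k.
by apply: measurable_funM => //; exact: (star_pow_bnd k s0 C0 fb).1.
Qed.

Lemma exp_profile_bnd (s C : R) f : 0 <= s -> 0 <= C -> bnd s C f ->
  bnd s (2 * expR (2 * (2 * A * C)) * C) (exp_profile f).
Proof.
move=> s0 C0 fb; split.
  apply: (@measurable_fun_cvg _ _ _ _ (fun n x => series (fun k => exp_cf k * star_pow f k x) n)).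
    by move=> n; exact: measurable_exp_profile_series fb.
  by move=> x _; exact: exp_profile_cvg fb.
move=> x; have [_ _] := exp_series_bound (y0 C0) (w0 s x C0) (fun k => exp_cf_star_pow_le k x s0 C0 fb).
by rewrite (_ : 2 * C * _ * _ = 2 * expR (2 * (2 * A * C)) * C * (m x * wt (- s) x))//; ring.
Qed.

Lemma exp_profile_lip (s C d : R) f g : 0 <= s -> 0 <= C -> 0 <= d -> bnd s C f -> bnd s C g ->
  bnd s d (fun x => f x - g x) ->
  bnd s (2 * expR (2 * (2 * A * C)) * d) (fun x => exp_profile f x - exp_profile g x).
Proof.
move=> s0 C0 d0 fb gb fgb; split.
  by apply: measurable_funB; [exact: (exp_profile_bnd s0 C0 fb).1|exact: (exp_profile_bnd s0 C0 gb).1].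
move=> x; have [cv _] := exp_series_bound (y0 C0) (w0 s x d0) (fun k => exp_cf_star_pow_lip_le k x s0 C0 d0 fb gb fgb).
rewrite -(@lim_seriesB _ (fun k => exp_cf k * star_pow f k x : R^o) (fun k => exp_cf k * star_pow g k x : R^o)).
- by rewrite (_ : 2 * d * _ * _ = 2 * expR (2 * (2 * A * C)) * d * (m x * wt (- s) x))//; ring.
- by have /cvgP := exp_profile_cvg (x := x) s0 C0 fb.
- by have /cvgP := exp_profile_cvg (x := x) s0 C0 gb.
Qed.

Lemma exp_profile_seq_cvg (s C : R) (f : nat -> R -> R) f' : 0 <= s -> 0 <= C -> (forall n, bnd s C (f n)) ->
  (forall x, f n x @[n --> \oo] --> f' x) -> forall x, exp_profile (f n) x @[n --> \oo] --> exp_profile f' x.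
Proof.
move=> s0 C0 fb ff x.
apply: (exp_series_dct (y0 C0) (w0 s x C0)).
  by move=> n k; exact: exp_cf_star_pow_le (fb n).
move=> k; apply: cvgMl_tmp; elim: k x => [|k IH] x //=.
apply: (star_cvg (maj_convable M) (maj_even M) _ _ _ ff IH (B := C * (C * (2 * A * C) ^+ k))).
- by move=> n; exact: (fb n).1.
- by move=> n; exact: (star_pow_bnd k s0 C0 (fb n)).1.
- move=> n a b; rewrite normrM.
  have w1 c y : 0 <= c -> c * (m y * wt (- s) y) <= c * m y.
    by move=> c0; rewrite ler_wpM2l// ler_piMr ?(maj_ge0 M)// wt_le1.
  rewrite (_ : _ * _ * _ = (C * m a) * (C * (2 * A * C) ^+ k * m b)); last by ring.
  apply: ler_pM => //.
    by apply: le_trans ((fb n).2 a) _; exact: w1.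
  apply: le_trans ((star_pow_bnd k s0 C0 (fb n)).2 b) _; apply: w1.
  by rewrite mulr_ge0// exprn_ge0// !mulr_ge0// (maj_A M).
Qed.

Lemma V_star_pow (s C : R) f k X : 0 <= s -> 0 <= C -> bnd s C f -> V (star_pow f k) X = V f X ^+ k.+1.
Proof.
move=> s0 C0 fb; elim: k => [|k IH] //=.
have C1 : 0 <= C * (2 * A * C) ^+ k by rewrite mulr_ge0// exprn_ge0// !mulr_ge0// (maj_A M).
have pb := star_pow_bnd k s0 C0 fb.
have [v1 v2 _] := star_bnd M s0 C0 C1 fb pb.
have fi := bnd_intg M s0 C0 fb.
have gi := bnd_intg M s0 C1 pb.
rewrite V_star//.
by rewrite exprS IH.
Qed.

Lemma V_sum n (F : nat -> R -> R) X : (forall i, intg (F i)) ->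
  V (fun x => \sum_(0 <= i < n) F i x) X = \sum_(0 <= i < n) V (F i) X.
Proof.
move=> Fi; rewrite /V big_mkord -(itg_sum (fun i : 'I_n => intg_cas X (Fi i))).
by apply: eq_itg => x; rewrite big_mkord mulr_suml.
Qed.

(** Under [V] the partial sums become those of the scalar exponential series without its constant
    term; a multiple of [m] dominates all partial sums of profiles. *)
Lemma V_exp_profile (s C : R) f X : 0 <= s -> 0 <= C -> bnd s C f -> V (exp_profile f) X = expR (2 * V f X) - 1.
Proof.
move=> s0 C0 fb.
have K0 : 0 <= 2 * C * expR (2 * (2 * A * C)) by rewrite !mulr_ge0// ltW// expR_gt0.
have [||||_ h] := @itg_dct R (fun n x => series (fun k => exp_cf k * star_pow f k x) n * cas (x * X)) (fun x =>
  exp_profile f x * cas (x * X)) (fun x => (2 * C * expR (2 * (2 * A * C))) * m x * 2).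
- move=> n; apply: measurable_funM; first exact: measurable_exp_profile_series fb.
  exact: measurable_casM.
- move=> n x; rewrite normrM; apply: ler_pM => //; last exact: cas_le2.
  have [_ /(_ n) b _] := exp_series_bound (y0 C0) (w0 s x C0) (fun k => exp_cf_star_pow_le k x s0 C0 fb).
  apply: (le_trans b).
  rewrite (_ : 2 * C * _ * _ = 2 * C * expR (2 * (2 * A * C)) * (m x * wt (- s) x)); last by ring.
  by rewrite ler_wpM2l// ler_piMr ?(maj_ge0 M)// wt_le1.
- have := intgZ (2 * (2 * C * expR (2 * (2 * A * C)))) (maj_intg M).
  by congr intg; apply/funext => x; ring.
- by move=> x; apply: cvgMr_tmp; exact: exp_profile_cvg fb.
have E n : itg (fun x => series (fun k => exp_cf k * star_pow f k x) n * cas (x * X)) = series (exp_coeff (2 *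
  V f X)) n.+1 - 1.
  transitivity (V (fun x => \sum_(0 <= k < n) exp_cf k * star_pow f k x) X) => //.
  have pi k : intg (star_pow f k).
    apply: (bnd_intg M s0 _ (star_pow_bnd k s0 C0 fb)).
    by rewrite mulr_ge0// exprn_ge0// !mulr_ge0// (maj_A M).
  rewrite (@V_sum n (fun k x => exp_cf k * star_pow f k x))//; last by move=> k; exact: intgZ.
  rewrite /series/= big_nat_recl// /exp_coeff/= expr0 fact0 invr1 mulr1 addrAC subrr add0r.
  apply: eq_bigr => k _; rewrite VZ//; first by rewrite (V_star_pow _ _ s0 C0 fb) /exp_cf exprMn; ring.
rewrite {1}/V; apply: (cvg_unique _ h); first exact: norm_hausdorff.
rewrite /= (eq_cvg _ _ E); apply: cvgB; last exact: cvg_cst.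
have := is_cvg_series_exp_coeff (2 * V f X).
by rewrite -(cvg_shiftS (series _)).
Qed.

End Exponential.

(** * Construction of majorants *)

Section MkMajorant.
Context {R : realType}.

Lemma exp_coeff_le (y : R) n : 0 <= y -> exp_coeff y n <= expR y.
Proof.
move=> y0; apply: le_trans (series_exp_le n.+1 y0).
rewrite /series/= big_nat_recr//= lerDr sumr_ge0// => i _; exact: exp_coeff_ge0.
Qed.

(** [y^n / n! <= exp y] at [y = d * br x]. *)
Lemma br_exp_wt (d : R) n : 0 < d -> exists2 K : R, 0 <= K & forall x, br x ^+ n <= K * wt d x.
Proof.
move=> d0; exists (n`!%:R / d ^+ n); first by rewrite divr_ge0// exprn_ge0// ltW.
move=> x; have := @exp_coeff_le (d * br x) n.
rewrite mulr_ge0 ?(ltW d0) ?(ltW (br_gt0 _))// => /(_ isT).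
rewrite /exp_coeff/= exprMn ler_pdivrMr ?ltr0n ?fact_gt0// => h.
by rewrite mulrAC ler_pdivlMr ?exprn_gt0// mulrC (le_trans h)// mulrC wtE.
Qed.

(* The integrable summand makes the majorant stable under convolution; the
   power [br ^+ 3] pays for three derivatives in [X]. *)
Definition std_majorant (h : R -> R) (x : R) := (1 + x ^+ 2)^-1 + (h x + h (- x)) * br x ^+ 3.

(** [A] is chosen before [h] and depends on [C] and [d] only, which makes estimates uniform in time.
    For stability under convolution, [(1 + x^2) conv m m] is bounded by a constant, so that
    [conv m m <= A / (1 + x^2) <= A m]. *)
Lemma std_majorantP (C d : R) : 0 < d -> exists A : R, forall h : R -> R,
  (forall x, 0 <= h x) -> measurable_fun [set: R] h -> sqi (fun x => h x * wt d x) ->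
  itg (fun x => (h x * wt d x) ^+ 2) <= C -> majorant A (std_majorant h).
Proof.
(* The exponent 5 is the 3 of [std_majorant] plus 2 for the factor [1 + x^2 <= br x ^+ 2]. *)
move=> d0; have [K K0 HK] := br_exp_wt 5 d0.
(* [K2] will bound the integral of [k2 ^+ 2], [I1] that of the majorant and [I2] that of its
   square. *)
pose K2 : R := 4 * K ^+ 2 * `|C|.
pose I1 : R := pi + 2^-1 * (K2 + pi).
pose I2 : R := 2 * pi + 2 * K2.
exists (4 * (I1 + I2 + K2)) => h h0 mh hs hC.
have pi0 : 0 < pi :> R by exact: pi_gt0.
have K20 : 0 <= K2 by rewrite !mulr_ge0// exprn_ge0.
have q0 x : 0 < 1 + x ^+ 2 :> R by rewrite ltr_wpDr ?sqr_ge0.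
pose p x : R := (1 + x ^+ 2)^-1.
have p0 x : 0 < p x by rewrite invr_gt0.
have p1 x : p x <= 1 by rewrite invf_le1// lerDl sqr_ge0.
pose k x := (h x + h (- x)) * br x ^+ 3.
have k0 x : 0 <= k x by rewrite mulr_ge0 ?addr_ge0// exprn_ge0// ltW// br_gt0.
pose k2 x := k x * (1 + x ^+ 2).
have [ip Ep] := @intg_oneDsqr R.
have mk : measurable_fun [set: R] k.
  apply: measurable_funM.
    by apply: measurable_funD => //; exact: (measurableT_comp mh (@oppr_measurable R setT)).
  by apply: measurable_funX; exact: measurable_br.
have mp : measurable_fun [set: R] p by exact: intg_meas ip.
have mq : measurable_fun [set: R] (fun x : R => 1 + x ^+ 2).
  by apply: measurable_funD => //; exact: measurable_funX.
have qbr (x : R) : 1 + x ^+ 2 <= br x ^+ 2.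
  by rewrite /br sqrrD real_normK ?num_real// expr1n mulr1 addrC lerD2r lerDl mulrn_wge0.
have k2le x : k2 x <= K * (h x * wt d x + h (- x) * wt d (- x)).
  rewrite wtN -mulrDl /k2 /k -mulrA [leRHS]mulrCA ler_wpM2l ?addr_ge0//.
  by apply: le_trans (HK x); rewrite (exprD _ 3 2) ler_wpM2l// exprn_ge0// ltW// br_gt0.
have k20 x : 0 <= k2 x by rewrite mulr_ge0// ltW.
pose b x := 2 * K ^+ 2 * ((h x * wt d x) ^+ 2 + (h (- x) * wt d (- x)) ^+ 2).
have ib : intg b.
  apply: intgZ; apply: intgD; first exact: hs.2.
  exact: (intg_opp hs.2).
have Eb : itg b <= K2.
  rewrite itgZ; last by apply: intgD; [exact: hs.2|exact: (intg_opp hs.2)].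
  rewrite itgD; [|exact: hs.2|exact: (intg_opp hs.2)].
  rewrite (itg_opp hs.2) /K2 (_ : 4 * _ * _ = 2 * K ^+ 2 * (`|C| + `|C|)); last by ring.
  have hC' := le_trans hC (ler_norm C).
  by rewrite ler_wpM2l ?lerD// mulr_ge0// exprn_ge0.
have k2b x : k2 x ^+ 2 <= b x.
  apply: (@le_trans _ _ ((K * (h x * wt d x + h (- x) * wt d (- x))) ^+ 2)).
    by rewrite lerXn2r// nnegrE// (le_trans (k20 x)).
  rewrite /b; set u := h x * _; set v := h (- x) * _.
  by have := mulr_ge0 (sqr_ge0 K) (sqr_ge0 (u - v)); lra.
have ik2 : intg (fun x => k2 x ^+ 2).
  apply: (intg_le _ _ ib); first by apply: measurable_funX; exact: measurable_funM.
  by move=> x; rewrite ger0_norm ?sqr_ge0.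
have Ek2 : itg (fun x => k2 x ^+ 2) <= K2 by apply: le_trans Eb; exact: itg_le.
have kk2 x : k x <= k2 x by rewrite ler_peMr// lerDl sqr_ge0.
(* Arithmetic-geometric mean inequality with weight [1 + x^2]: integrability of [k] is deduced from
   that of [k2 ^+ 2]. *)
have kle x : k x <= 2^-1 * (k2 x ^+ 2 + p x).
  have e1 : 2 * k x <= k x ^+ 2 * (1 + x ^+ 2) + p x.
    rewrite -(ler_pM2r (q0 x)) [leRHS]mulrDl /p mulVf ?gt_eqF//.
    by have := sqr_ge0 (k x * (1 + x ^+ 2) - 1); lra.
  have e2 : k x ^+ 2 * (1 + x ^+ 2) <= k2 x ^+ 2.
    rewrite /k2 [leRHS]exprMn ler_wpM2l ?sqr_ge0// ler_peMl ?(ltW (q0 x))//.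
    by rewrite lerDl sqr_ge0.
  lra.
have ig1 : intg (fun x => 2^-1 * (k2 x ^+ 2 + p x)) by apply: intgZ; exact: intgD.
have ik : intg k.
  by apply: (intg_le mk _ ig1) => x; rewrite ger0_norm.
have Ek : itg k <= 2^-1 * (K2 + pi).
  apply: (le_trans (itg_le ik ig1 kle)).
  by rewrite itgZ ?itgD//; [rewrite ler_pM2l ?invr_gt0// Ep lerD2r|exact: intgD].
have im : intg (std_majorant h) by exact: intgD.
have Em : itg (std_majorant h) <= I1.
  by rewrite (itgD ip ik) Ep lerD2l.
have m0 x : 0 <= std_majorant h x by rewrite addr_ge0//; [exact: ltW (p0 x)|exact: k0].
have mm := intg_meas im.
have m2 x : std_majorant h x ^+ 2 <= 2 * p x + 2 * k2 x ^+ 2.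
  have e1 : std_majorant h x ^+ 2 <= 2 * p x ^+ 2 + 2 * k x ^+ 2.
    by have := sqr_ge0 (p x - k x); rewrite /std_majorant -/(p x) -/(k x); lra.
  have e2 : p x ^+ 2 <= p x by rewrite expr2 ler_piMr// ltW.
  have e3 : k x ^+ 2 <= k2 x ^+ 2 by rewrite lerXn2r// nnegrE.
  lra.
have ig2 : intg (fun x => 2 * p x + 2 * k2 x ^+ 2) by apply: intgD; exact: intgZ.
have im2 : intg (fun x => std_majorant h x ^+ 2).
  apply: (intg_le _ _ ig2); first exact: measurable_funX.
  by move=> x; rewrite ger0_norm ?sqr_ge0.
have Em2 : itg (fun x => std_majorant h x ^+ 2) <= I2.
  apply: (le_trans (itg_le im2 ig2 m2)).
  rewrite itgD ?itgZ//; [|exact: intgZ|exact: intgZ].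
  by rewrite Ep lerD2l ler_pM2l.
have I10 : 0 <= I1 by apply: le_trans Em; exact: itg_ge0.
have I20 : 0 <= I2 by apply: le_trans Em2; apply: itg_ge0 => x; exact: sqr_ge0.
(* the tails are handled through [1 + x^2 <= 2 (1 + a^2) + 2 (1 + (x - a)^2)] *)
pose G x a := 2 * (std_majorant h a + std_majorant h a ^+ 2 + k2 a ^+ 2 + (std_majorant h (x - a) +
  std_majorant h (x - a) ^+ 2 + k2 (x - a) ^+ 2)).
have key x a : std_majorant h a * std_majorant h (x - a) * (1 + x ^+ 2) <= G x a.
  have e0 : 1 + x ^+ 2 <= 2 * (1 + a ^+ 2) + 2 * (1 + (x - a) ^+ 2).
    by have := sqr_ge0 (x - 2 * a); lra.
  have mjq y : std_majorant h y * (1 + y ^+ 2) = 1 + k2 y by rewrite /std_majorant mulrDl mulVf ?gt_eqF.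
  have e1 : std_majorant h a * std_majorant h (x - a) * (1 + x ^+ 2) <= 2 * (std_majorant h (x - a) * (1 + k2
    a) + std_majorant h a * (1 + k2 (x - a))).
    rewrite -!mjq.
    have := ler_wpM2l (mulr_ge0 (m0 a) (m0 (x - a))) e0; lra.
  have s1 := sqr_ge0 (std_majorant h (x - a) - k2 a); have s2 := sqr_ge0 (std_majorant h a - k2 (x - a)).
  have t1 := sqr_ge0 (std_majorant h a); have t2 := sqr_ge0 (std_majorant h (x - a)).
  have t3 := sqr_ge0 (k2 a); have t4 := sqr_ge0 (k2 (x - a)).
  rewrite /G; lra.
pose g a := std_majorant h a + std_majorant h a ^+ 2 + k2 a ^+ 2.
have igg : intg g by apply: intgD => //; exact: intgD.
have Eg : itg g <= I1 + I2 + K2.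
  rewrite itgD//; last exact: intgD.
  by rewrite itgD// !lerD.
have iG x : intg (G x) by apply: intgZ; apply: intgD => //; exact: (intg_rsub x igg).
have EG x : itg (G x) <= 4 * (I1 + I2 + K2).
  rewrite itgZ; last by apply: intgD => //; exact: (intg_rsub x igg).
  rewrite (itgD igg (intg_rsub x igg)) (itg_rsub x igg); lra.
have cm : convable (std_majorant h) (std_majorant h).
  move=> x; apply: (intg_le _ _ (iG x)).
    by apply: measurable_funM => //; apply: (measurableT_comp mm); exact: measurable_funB.
  move=> a; rewrite ger0_norm ?mulr_ge0//; apply: le_trans (key x a).
  by rewrite ler_peMr ?mulr_ge0// lerDl sqr_ge0.
split => //.
- by move=> x; rewrite /std_majorant sqrrN opprK (addrC (h _)) brN.
- by lra.
- by lra.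
- move=> x.
  apply: (@le_trans _ _ (4 * (I1 + I2 + K2) * p x)).
    rewrite /p ler_pdivlMr ?q0//; apply: le_trans (EG x).
    rewrite /conv mulrC -itgZ//; apply: itg_le; [exact: intgZ|exact: iG|].
    by move=> a; rewrite mulrC; exact: key.
  by apply: ler_wpM2l; [lra|rewrite /std_majorant lerDl; exact: k0].
- by lra.
Qed.

Lemma std_majorant_ge (h : R -> R) x : (forall x, 0 <= h x) -> h x * br x ^+ 3 <= std_majorant h x.
Proof.
move=> h0; rewrite /std_majorant mulrDl addrCA lerDl addr_ge0//.
  by rewrite invr_ge0 addr_ge0// sqr_ge0.
by rewrite mulr_ge0// exprn_ge0// ltW// br_gt0.
Qed.

End MkMajorant.

(** * Nonlinear terms on profiles *)

Section Nonlinearity.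
Context {R : realType}.

(* profiles of [r_j], [q_j = eps * (r_j)_X], [v_j] for the two components [j] *)
Record state := State { sr : bool -> R -> R; sq : bool -> R -> R; sv : bool -> R -> R }.

Definition sub_state (z w : state) := State (fun j x => sr z j x - sr w j x)
  (fun j x => sq z j x - sq w j x) (fun j x => sv z j x - sv w j x).

Definition add_state (z w : state) := State (fun j x => sr z j x + sr w j x)
  (fun j x => sq z j x + sq w j x) (fun j x => sv z j x + sv w j x).

Variables (gam : bool -> R) (alpha : R).

Definition N1 (z : state) (j : bool) (x : R) : R := - 2 * star (sv z j) (D (sr z j)) x.

Definition Nq (z : state) (j : bool) (x : R) : R := - 2 * D (star (sv z j) (sq z j)) x.

(** All nonlinear terms of the [v] equation are exact derivatives: [2 gamma exp (2 r) r_X], its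
    coupled analogue, [- 2 v v_X] and the term from the square of [q]. Subtracting 1 from the
    exponentials leaves their derivative unchanged. *)
Definition flux (z : state) (j : bool) (x : R) : R :=
  (star (sq z j) (sq z j) x - star (sv z j) (sv z j) x) +
  (gam j * exp_profile (sr z j) x + alpha * exp_profile (sr z (~~ j)) x).

Definition N2 (z : state) (j : bool) : R -> R := D (flux z j).

Variables (A : R) (m : R -> R).
Hypothesis M : majorant A m.
Notation bnd := (bnd m).
Notation bnd1 := (bnd1 m).

Definition stbnd (s C : R) (z : state) := forall j,
  [/\ bnd s C (sr z j), bnd s C (sq z j) & bnd s C (sv z j)].

Lemma bnd_V_D (s C : R) f X : 0 < s -> 0 <= C -> bnd s C f ->
  derivable (V f) X 1 /\ derive1 (V f) X = V (D f) X.
Proof.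
move=> s0 C0 fb; apply: V_derive; first exact: (bnd_intg M (ltW s0) C0 fb).
have := intg_opp (bnd1_intg M s0 C0 (bnd_D M C0 fb)).
by congr intg; apply/funext => x; rewrite /D !opprK.
Qed.

Lemma D_sub (f g : R -> R) x : D (fun y => f y - g y) x = D f x - D g x.
Proof. by rewrite /D mulrBr. Qed.

Lemma star_lip (s C d : R) (f f' g g' : R -> R) : 0 <= s -> 0 <= C -> 0 <= d ->
  bnd s C f -> bnd s C f' -> bnd s C g -> bnd s C g' ->
  bnd s d (fun x => f x - f' x) -> bnd s d (fun x => g x - g' x) ->
  bnd s (4 * A * C * d) (fun x => star f g x - star f' g' x).
Proof.
move=> s0 C0 d0 fb f'b gb g'b fd gd.
have [v1 v2 b1] := star_bnd M s0 d0 C0 fd gb.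
have [v3 v4 b2] := star_bnd M s0 C0 d0 f'b gd.
have [w1 w2 _] := star_bnd M s0 C0 C0 fb gb.
have [w3 w4 _] := star_bnd M s0 C0 C0 f'b gb.
have [w5 w6 _] := star_bnd M s0 C0 C0 f'b g'b.
have := bndD b1 b2; rewrite (_ : _ + _ = 4 * A * C * d); last by ring.
by congr (bnd _ _ _); apply/funext => x; rewrite star_subl// star_subr//; ring.
Qed.

Lemma star_lip1 (s0 s C d : R) (f f' g g' : R -> R) : 0 < s0 -> s0 <= s -> 0 <= C -> 0 <= d ->
  bnd s C f -> bnd s C f' -> bnd1 s C g -> bnd1 s C g' ->
  bnd s d (fun x => f x - f' x) -> bnd1 s d (fun x => g x - g' x) ->
  bnd1 s (4 * A * (1 + s0^-1) * C * d) (fun x => star f g x - star f' g' x).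
Proof.
move=> s0p ss C0 d0 fb f'b gb g'b fd gd.
have [v1 v2 b1] := star_bnd1 M s0p ss d0 C0 fd gb.
have [v3 v4 b2] := star_bnd1 M s0p ss C0 d0 f'b gd.
have [w1 w2 _] := star_bnd1 M s0p ss C0 C0 fb gb.
have [w3 w4 _] := star_bnd1 M s0p ss C0 C0 f'b gb.
have [w5 w6 _] := star_bnd1 M s0p ss C0 C0 f'b g'b.
have := bnd1D b1 b2; rewrite (_ : _ + _ = 4 * A * (1 + s0^-1) * C * d); last by ring.
by congr (bnd1 _ _ _); apply/funext => x; rewrite star_subl// star_subr//; ring.
Qed.

(** One constant for the bounds and the differences of all nonlinear terms. The summands account for
    a product with a derivative inside, for products under [D], and for the exponentials; the width
    enters through [s0] only. *)
Definition lip_cst (s0 C : R) : R :=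
  8 * A * (1 + s0^-1) * C + 8 * A * C +
  (`|gam false| + `|gam true| + `|alpha|) * (2 * expR (2 * (2 * A * C))).

Let K1 s0 C : 0 < s0 -> 0 <= C -> 0 <= 8 * A * (1 + s0^-1) * C.
Proof. by move=> s0p C0; rewrite !mulr_ge0 ?(maj_A M)// addr_ge0// invr_ge0 ltW. Qed.

Let K2 C : 0 <= C -> 0 <= 8 * A * C.
Proof. by move=> C0; rewrite !mulr_ge0 ?(maj_A M). Qed.

Let K3 C : 0 <= (`|gam false| + `|gam true| + `|alpha|) * (2 * expR (2 * (2 * A * C))).
Proof. by rewrite mulr_ge0 ?addr_ge0// mulr_ge0// ltW// expR_gt0. Qed.

Lemma lip_cst_ge0 s0 C : 0 < s0 -> 0 <= C -> 0 <= lip_cst s0 C.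
Proof. by move=> s0p C0; rewrite !addr_ge0 ?K1 ?K2 ?K3. Qed.

Lemma flux_bnd (s0 s C : R) z j : 0 < s0 -> s0 <= s -> 0 <= C -> stbnd s C z ->
  bnd s (lip_cst s0 C * C) (flux z j).
Proof.
move=> s0p ss C0 zb; have sp : 0 <= s by rewrite ltW// (lt_le_trans s0p).
have [rb qb vb] := zb j; have [rb' _ _] := zb (~~ j).
have [_ _ b1] := star_bnd M sp C0 C0 qb qb.
have [_ _ b2] := star_bnd M sp C0 C0 vb vb.
have b3 := bndD (bndZ (gam j) (exp_profile_bnd M sp C0 rb)) (bndZ alpha (exp_profile_bnd M sp C0 rb')).
have := bndD (bndB b1 b2) b3; apply: (bnd_mono M).
rewrite /lip_cst; set e := expR _.
have gj : `|gam j| <= `|gam false| + `|gam true| by case: j {zb rb qb vb rb' b1 b2 b3}; rewrite ?lerDl ?lerDr.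
have h1 := ler_wpM2r (mulr_ge0 (ltW (expR_gt0 (2 * (2 * A * C)))) C0) gj.
have h2 := mulr_ge0 (K1 s0p C0) C0; have h3 := mulr_ge0 (K2 C0) C0.
by rewrite -/e in h1; lra.
Qed.

Lemma N_bnd (s0 s C : R) z j : 0 < s0 -> s0 <= s -> 0 <= C -> stbnd s C z ->
  [/\ bnd1 s (lip_cst s0 C * C) (N1 z j), bnd1 s (lip_cst s0 C * C) (Nq z j) &
      bnd1 s (lip_cst s0 C * C) (N2 z j)].
Proof.
move=> s0p ss C0 zb; have sp : 0 <= s by rewrite ltW// (lt_le_trans s0p).
have [rb qb vb] := zb j.
have h1 := mulr_ge0 (K1 s0p C0) C0; have h2 := mulr_ge0 (K2 C0) C0.
have h3 := mulr_ge0 (K3 C) C0.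
have A0 := maj_A M.
split.
- have [_ _ b] := star_bnd1 M s0p ss C0 C0 vb (bnd_D M C0 rb).
  have := bnd1Z (- 2) b; apply: (bnd1_mono M); rewrite normrN normr_nat /lip_cst; lra.
- have [_ _ b] := star_bnd M sp C0 C0 vb qb.
  have := bnd1Z (- 2) (bnd_D M _ b); rewrite !mulr_ge0// => /(_ isT).
  apply: (bnd1_mono M); rewrite normrN normr_nat /lip_cst; lra.
- by apply: (bnd_D M _ (flux_bnd _ s0p ss C0 zb)); rewrite mulr_ge0// lip_cst_ge0.
Qed.

Lemma flux_lip (s0 s C d : R) z w j : 0 < s0 -> s0 <= s -> 0 <= C -> 0 <= d ->
  stbnd s C z -> stbnd s C w -> stbnd s d (sub_state z w) ->
  bnd s (lip_cst s0 C * d) (fun x => flux z j x - flux w j x).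
Proof.
move=> s0p ss C0 d0 zb wb zwb; have sp : 0 <= s by rewrite ltW// (lt_le_trans s0p).
have [rb qb vb] := zb j; have [rb' _ _] := zb (~~ j).
have [rb2 qb2 vb2] := wb j; have [rb2' _ _] := wb (~~ j).
have [rb3 qb3 vb3] := zwb j; have [rb3' _ _] := zwb (~~ j).
have b1 := star_lip sp C0 d0 qb qb2 qb qb2 qb3 qb3.
have b2 := star_lip sp C0 d0 vb vb2 vb vb2 vb3 vb3.
have b3 := bndD (bndZ (gam j) (exp_profile_lip M sp C0 d0 rb rb2 rb3)) (bndZ alpha (exp_profile_lip M sp C0 d0
  rb' rb2' rb3')).
have b4 : bnd s (lip_cst s0 C * d) _ := bnd_mono M _ (bndD (bndB b1 b2) b3).
suff /b4 : 4 * A * C * d + 4 * A * C * d +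
  (`|gam j| * (2 * expR (2 * (2 * A * C)) * d) + `|alpha| * (2 * expR (2 * (2 * A * C)) * d)) <= lip_cst s0 C * d.
  by congr (bnd _ _ _); apply/funext => x; rewrite /flux; ring.
rewrite /lip_cst; set e := expR _.
have gj : `|gam j| <= `|gam false| + `|gam true|.
  by case: j {zb rb qb vb rb' b1 b2 b3 b4 rb2 qb2 vb2 rb2' rb3 qb3 vb3 rb3'}; rewrite ?lerDl ?lerDr.
have h1 := ler_wpM2r (mulr_ge0 (ltW (expR_gt0 (2 * (2 * A * C)))) d0) gj.
have h2 := mulr_ge0 (K1 s0p C0) d0; have h3 := mulr_ge0 (K2 C0) d0.
by rewrite -/e in h1; lra.
Qed.

Lemma N_lip (s0 s C d : R) z w j : 0 < s0 -> s0 <= s -> 0 <= C -> 0 <= d ->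
  stbnd s C z -> stbnd s C w -> stbnd s d (sub_state z w) ->
  [/\ bnd1 s (lip_cst s0 C * d) (fun x => N1 z j x - N1 w j x),
      bnd1 s (lip_cst s0 C * d) (fun x => Nq z j x - Nq w j x) &
      bnd1 s (lip_cst s0 C * d) (fun x => N2 z j x - N2 w j x)].
Proof.
move=> s0p ss C0 d0 zb wb zwb; have sp : 0 <= s by rewrite ltW// (lt_le_trans s0p).
have [rb qb vb] := zb j.
have [rb2 qb2 vb2] := wb j.
have [rb3 qb3 vb3] := zwb j.
have h1 := mulr_ge0 (K1 s0p C0) d0; have h2 := mulr_ge0 (K2 C0) d0.
have h3 := mulr_ge0 (K3 C) d0.
have A0 := maj_A M.
split.
- have Db : bnd1 s d (fun x => D (sr z j) x - D (sr w j) x).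
    by have := bnd_D M d0 rb3; congr (bnd1 _ _ _); apply/funext => x; rewrite -D_sub.
  have b := star_lip1 s0p ss C0 d0 vb vb2 (bnd_D M C0 rb) (bnd_D M C0 rb2) vb3 Db.
  have : bnd1 s (lip_cst s0 C * d) (fun x => - 2 * (star (sv z j) (D (sr z j)) x - star (sv w j) (D (sr w j)) x)).
    have := bnd1Z (- 2) b; apply: (bnd1_mono M); rewrite normrN normr_nat /lip_cst; lra.
  by congr (bnd1 _ _ _); apply/funext => x; rewrite /N1 mulrBr.
- have b := star_lip sp C0 d0 vb vb2 qb qb2 vb3 qb3.
  have : bnd1 s (lip_cst s0 C * d) (fun x => - 2 * D (fun y => star (sv z j) (sq z j) y - star (sv w j) (sq w j) y) x).
    have := bnd1Z (- 2) (bnd_D M _ b); rewrite !mulr_ge0// => /(_ isT).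
    apply: (bnd1_mono M); rewrite normrN normr_nat /lip_cst; lra.
  by congr (bnd1 _ _ _); apply/funext => x; rewrite /Nq D_sub mulrBr.
- have := bnd_D M _ (flux_lip j s0p ss C0 d0 zb wb zwb).
  rewrite mulr_ge0 ?lip_cst_ge0// => /(_ isT).
  by congr (bnd1 _ _ _); apply/funext => x; rewrite D_sub.
Qed.

Lemma V_N1 (s C : R) z j X : 0 < s -> 0 <= C -> stbnd s C z ->
  V (N1 z j) X = - 2 * (V (sv z j) X * derive1 (V (sr z j)) X).
Proof.
move=> s0 C0 zb; have [rb qb vb] := zb j.
have Db := bnd_D M C0 rb.
have [v1 v2 b] := star_bnd1 M s0 (lexx s) C0 C0 vb Db.
have i1 := bnd_intg M (ltW s0) C0 vb; have i2 := bnd1_intg M s0 C0 Db.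
rewrite VZ; first by rewrite V_star// (bnd_V_D X s0 C0 rb).2.
exact: intg_star.
Qed.

Lemma V_flux (s C : R) z j X : 0 < s -> 0 <= C -> stbnd s C z ->
  V (flux z j) X = (V (sq z j) X ^+ 2 - V (sv z j) X ^+ 2) +
    (gam j * (expR (2 * V (sr z j) X) - 1) + alpha * (expR (2 * V (sr z (~~ j)) X) - 1)).
Proof.
move=> s0 C0 zb; have [rb qb vb] := zb j; have [rb' _ _] := zb (~~ j).
have A0 := maj_A M.
have [v1 v2 b1] := star_bnd M (ltW s0) C0 C0 qb qb.
have [v3 v4 b2] := star_bnd M (ltW s0) C0 C0 vb vb.
have K0 : 0 <= 2 * A * (C * C) by rewrite !mulr_ge0.
have E0 : 0 <= 2 * expR (2 * (2 * A * C)) * C by rewrite !mulr_ge0// ltW// expR_gt0.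
have iq := bnd_intg M (ltW s0) C0 qb; have iv := bnd_intg M (ltW s0) C0 vb.
have i1 := bnd_intg M (ltW s0) K0 b1; have i2 := bnd_intg M (ltW s0) K0 b2.
have i3 := bnd_intg M (ltW s0) E0 (exp_profile_bnd M (ltW s0) C0 rb).
have i4 := bnd_intg M (ltW s0) E0 (exp_profile_bnd M (ltW s0) C0 rb').
have i34 : intg (fun x => gam j * exp_profile (sr z j) x + alpha * exp_profile (sr z (~~ j)) x).
  by apply: intgD; exact: intgZ.
have i12 : intg (fun x => star (sq z j) (sq z j) x - star (sv z j) (sv z j) x).
  exact: intgB.
rewrite /flux VD// VB// VD; [|exact: intgZ|exact: intgZ].
by rewrite !V_star// !VZ// (V_exp_profile M X (ltW s0) C0 rb) (V_exp_profile M X (ltW s0) C0 rb') -!expr2.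
Qed.

Lemma V_N2 (s C : R) z j X : 0 < s -> 0 <= C -> stbnd s C z ->
  V (N2 z j) X = derive1 (fun X => (V (sq z j) X ^+ 2 - V (sv z j) X ^+ 2) +
    (gam j * (expR (2 * V (sr z j) X) - 1) + alpha * (expR (2 * V (sr z (~~ j)) X) - 1))) X.
Proof.
move=> s0 C0 zb.
have fb := flux_bnd j s0 (lexx s) C0 zb.
rewrite /N2 -(bnd_V_D X s0 _ fb).2; last by rewrite mulr_ge0// lip_cst_ge0.
by congr (derive1 _ X); apply/funext => Y; rewrite (V_flux _ _ s0 C0 zb).
Qed.

End Nonlinearity.

(** * Time-continuous profiles of the Whitham solution *)

Section TimeDerivative.
Context {R : realType}.
Implicit Types (Tm T l : R).

(** The sequential form is the one dominated convergence handles; restricting sequences to [A]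
    covers one-sided limits at the endpoints. *)
Lemma cvg_within_dnbhs (A : set R) (f : R -> R) (T l : R) :
  f x @[x --> within A T^'] --> l <->
  (forall u : nat -> R, (forall n, A (u n) /\ u n != T) -> u n @[n --> \oo] --> T ->
    f (u n) @[n --> \oo] --> l).
Proof.
split.
  move=> h u Au uT; apply: cvg_trans h => B.
  rewrite /nbhs/= => hB.
  have := uT _ hB; rewrite /nbhs/=; apply: filterS => n /=.
  by have [? ?] := Au n; exact.
move=> h; pose g x := if `[< A x >] then f x else l.
have gl : g x @[x --> T^'] --> l.
  apply/cvgr_dnbhsP => u [uT ucv]; apply/cvgrPdist_le => e e0.
  have [[n0 An0]|nA] := pselect (exists n0, A (u n0)); last first.
    apply: nearW => n; rewrite /g; case: asboolP => [a|]; last by rewrite subrr normr0 ltW.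
    by exfalso; apply: nA; exists n.
  (* replace the terms outside [A] by a fast sequence inside it *)
  apply: contrapT => nn.
  have ex n : exists k, [/\ (n <= k)%N, A (u k) & e < `|l - f (u k)|].
    apply: contrapT => ne; apply: nn; exists n => // k /= nk.
    rewrite /g; case: asboolP => [a|_]; last by rewrite subrr normr0 ltW.
    by rewrite leNgt; apply/negP => lt; apply: ne; exists k.
  have [phi hphi] := choice ex.
  have : f (u (phi n)) @[n --> \oo] --> l.
    apply: h; first by move=> n; have [_ ? _] := hphi n.
    apply: (cvg_comp phi u _ ucv) => B [N _ NB]; exists N => // n /= Nn; apply: NB => /=.
    by have [h1 _ _] := hphi n; exact: leq_trans h1.
  move/cvgrPdist_le => /(_ _ e0)[N _ /(_ N (leqnn N))/=].
  by rewrite leNgt; have [_ _ ->] := hphi N.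
apply: cvg_trans (@cvg_within_filter _ _ _ _ _ _ _ gl) => //.
apply: near_eq_cvg; rewrite near_withinE; apply: nearW => x Ax.
by rewrite /g; case: asboolP.
Qed.

Lemma htd_interior Tm f T l : 0 < T < Tm -> has_time_derivative Tm f T l -> is_derive T 1 f l.
Proof.
move=> /andP[T0 T1] h.
have h' : (fun S => (S - T)^-1 * (f S - f T)) x @[x --> T^'] --> l.
  apply: cvg_trans h => B; rewrite /nbhs/= => hB.
  have : T^' `[0, Tm]%classic.
    have : \forall x \near T, x \in `]0, Tm[ by apply: near_in_itvoo; rewrite in_itv/= T0.
    move=> [r r0 rI]; exists r => // x xr _; have := rI x xr; rewrite /= !in_itv/=.
    by move=> /andP[/ltW -> /ltW ->].
  by move=> H; move: H hB; apply: filterS2 => x xI; exact.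
have h2 : (fun k => k^-1 *: (f (k *: 1 + T) - f T)) x @[x --> 0^'] --> l.
  apply/cvgr_dnbhsP => u [u0 ucv].
  have : (u n + T - T)^-1 * (f (u n + T) - f T) @[n --> \oo] --> l.
    move/cvgr_dnbhsP : h' => /(_ (fun n => u n + T)); apply; split.
      by move=> n; rewrite -subr_eq0 addrK.
    by rewrite -{2}(add0r T); apply: cvgD => //; exact: cvg_cst.
  by apply: cvg_trans; apply: near_eq_cvg; apply: nearW => n; rewrite addrK /GRing.scale/= mulr1.
by apply: DeriveDef; [apply/cvg_ex; exists l|exact/cvg_lim].
Qed.

Lemma htd_cvg Tm f T l : has_time_derivative Tm f T l -> f S @[S --> within `[0, Tm] (nbhs T)] --> f T.
Proof.
move=> h.
have h2 : (S - T) * ((S - T)^-1 * (f S - f T)) @[S --> within `[0, Tm] T^'] --> 0.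
  rewrite -[X in _ --> X](mul0r l); apply: cvgM => //.
  have : S - T @[S --> T] --> 0.
    by rewrite -(subrr T); apply: cvgB; [exact: cvg_id|exact: cvg_cst].
  apply: cvg_trans => B [e /= e0 eB].
  by exists e => // x xe _ _; exact: eB.
apply/cvgrPdist_le => e e0.
move/cvgrPdist_le : h2 => /(_ _ e0)[r r0 rI]; exists r => // S Sr SA.
have [->|ST] := eqVneq S T; first by rewrite subrr normr0 ltW.
have := rI S Sr ST SA; rewrite /= mulrA mulfV ?subr_eq0// mul1r sub0r opprB.
exact.
Qed.

(** Mean value theorem: at interior times the relative derivative is the ordinary one, and at the
    endpoints continuity is enough. *)
Lemma htd_lip Tm f (f' : R -> R) (B : R) :
  (forall T, T \in `[0, Tm] -> has_time_derivative Tm f T (f' T) /\ `|f' T| <= B) ->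
  forall S T, S \in `[0, Tm] -> T \in `[0, Tm] -> `|f S - f T| <= B * `|S - T|.
Proof.
move=> h; have : forall S T, S \in `[0, Tm] -> T \in `[0, Tm] -> S <= T -> `|f S - f T| <= B * `|S - T|.
  move=> S T; rewrite !in_itv/= => /andP[S0 S1] /andP[T0 T1] ST.
  have [||c] := @MVT_segment R f f' S T ST.
  - move=> x; rewrite in_itv/= => /andP[Sx xT].
    apply: (@htd_interior Tm); first by rewrite (le_lt_trans S0 Sx) (lt_le_trans xT T1).
    by apply: (h x _).1; rewrite in_itv/= (le_trans S0 (ltW Sx)) (le_trans (ltW xT) T1).
  - apply: (@continuous_subspaceW _ _ _ `[0, Tm]).
      by move=> x /=; rewrite !in_itv/= => /andP[Sx xT]; rewrite (le_trans S0 Sx) (le_trans xT T1).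
    by apply/subspace_continuousP => x xI; apply: htd_cvg (h x xI).1.
  rewrite in_itv/= => /andP[Sc cT] E.
  rewrite distrC E normrM (distrC S T) ler_wpM2r//.
  by apply: (h c _).2; rewrite in_itv/= (le_trans S0 Sc) (le_trans cT T1).
move=> H S T SI TI; have [ST|TS] := leP S T; first exact: H.
by rewrite distrC (distrC S T) H// ltW.
Qed.

Lemma htdP Tm f T l : has_time_derivative Tm f T l <->
  (forall u : nat -> R, (forall n, u n \in `[0, Tm] /\ u n != T) -> u n @[n --> \oo] --> T ->
    (u n - T)^-1 * (f (u n) - f T) @[n --> \oo] --> l).
Proof. exact: cvg_within_dnbhs. Qed.

(** The difference quotients are dominated by [G], by the mean value bound [htd_lip]. *)
Lemma htd_under_itg Tm (F F' : R -> R -> R) (G : R -> R) : 0 < Tm -> intg G ->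
  (forall T, T \in `[0, Tm] -> intg (F T)) ->
  (forall T, T \in `[0, Tm] -> forall x, has_time_derivative Tm (F ^~ x) T (F' T x) /\ `|F' T x| <= G x) ->
  forall T, T \in `[0, Tm] -> has_time_derivative Tm (fun S => itg (F S)) T (itg (F' T)).
Proof.
move=> Tm0 Gi Fi h T TI; apply/htdP => u uI uT.
have [||||_ H] := @itg_dct R (fun n x => (u n - T)^-1 * (F (u n) x - F T x)) (F' T) G.
- move=> n; apply: measurable_funM => //; apply: measurable_funB; apply: intg_meas; apply: Fi => //.
  by have [] := uI n.
- move=> n x; have [unI unT] := uI n; rewrite normrM normfV.
  rewrite ler_pdivrMl ?normr_gt0 ?subr_eq0// mulrC.
  by apply: (htd_lip (fun S SI => h S SI x)).
- exact: Gi.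
- by move=> x; have := (h T TI x).1; move/htdP; apply.
move: H; apply: cvg_trans; apply: near_eq_cvg; apply: nearW => n.
have [unI unT] := uI n.
rewrite itgZ; last by apply: intgB; exact: Fi.
by rewrite itgB//; exact: Fi.
Qed.

Lemma htd_eq Tm f g T l : T \in `[0, Tm] -> (forall S, S \in `[0, Tm] -> f S = g S) ->
  has_time_derivative Tm f T l -> has_time_derivative Tm g T l.
Proof.
move=> TI fg /htdP h; apply/htdP => u uI uT; apply: cvg_trans (h u uI uT).
by apply: near_eq_cvg; apply: nearW => n; rewrite !fg//; have [] := uI n.
Qed.

Lemma htdD Tm f g T l k : has_time_derivative Tm f T l -> has_time_derivative Tm g T k ->
  has_time_derivative Tm (fun S => f S + g S) T (l + k).
Proof.
move=> /htdP h1 /htdP h2; apply/htdP => u uI uT.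
apply: cvg_trans (cvgD (h1 u uI uT) (h2 u uI uT)).
by apply: near_eq_cvg; apply: nearW => n; rewrite /= -mulrDr; congr (_ * _); rewrite opprD addrACA.
Qed.

Lemma htdZ Tm f T l (c : R) : has_time_derivative Tm f T l ->
  has_time_derivative Tm (fun S => c * f S) T (c * l).
Proof.
move=> /htdP h1; apply/htdP => u uI uT.
have E n : (u n - T)^-1 * (c * f (u n) - c * f T) = c * ((u n - T)^-1 * (f (u n) - f T)).
  by rewrite -mulrBr mulrCA.
by rewrite (eq_cvg _ _ E); apply: cvgMl_tmp; exact: h1.
Qed.

Lemma htdW Tm T1 f T l : T1 <= Tm -> has_time_derivative Tm f T l -> has_time_derivative T1 f T l.
Proof.
move=> TT /htdP h; apply/htdP => u uI; apply: h => n; have [] := uI n.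
by rewrite !in_itv/= => /andP[-> b] ->; rewrite (le_trans b TT).
Qed.

Lemma is_derive_htd Tm f T l : is_derive T 1 f l -> has_time_derivative Tm f T l.
Proof.
move=> [df <-]; apply/htdP => u uI uT.
have := df; rewrite /derivable => /cvg_ex[l' hl'].
have -> : 'D_1 f T = l' by exact/cvg_lim.
move/cvgr_dnbhsP : hl' => /(_ (fun n => u n - T)); have HP : (forall n, u n - T != 0) /\ (u n - T @[n --> \oo] --> 0).
  split; first by move=> n; have [_] := uI n; rewrite subr_eq0.
  by rewrite -[X in _ --> X](subrr T); apply: cvgB => //; exact: cvg_cst.
move=> /(_ HP); apply: cvg_trans; apply: near_eq_cvg; apply: nearW => n.
by rewrite /GRing.scale/= mulr1 subrK.
Qed.

End TimeDerivative.

(** * Time regularity of the Whitham profiles in weighted L^2 *)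

Section Static.
Context {R : realType}.

Lemma V0 (X : R) : V (fun=> 0) X = 0.
Proof.
have [i _] := @intg_oneDsqr R; have := itgZ 0 i; rewrite mul0r => E; rewrite -[RHS]E.
by apply: eq_itg => x; rewrite !mul0r.
Qed.

Lemma bnd1_wt (A : R) m (s t C : R) f : majorant A m -> 0 < t -> 0 <= C -> bnd1 m (s + t) C f ->
  sqi (fun x => f x * wt s x) /\ itg (fun x => (f x * wt s x) ^+ 2) <= (C * t^-1) ^+ 2 * A.
Proof.
move=> M t0 C0 [mf hf]; apply: (bnd_sqi M (lexx 0)); first by rewrite mulr_ge0// invr_ge0 ltW.
apply: (bnd1_bnd0 M t0 C0); split.
  by apply: measurable_funM => //; exact: measurable_wt.
move=> x; have w0 := wt_gt0 s x.
rewrite normrM (gtr0_norm w0); apply: (le_trans (ler_wpM2r (ltW w0) (hf x))).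
rewrite opprD wtD -!mulrA; do 3 (apply: ler_wpM2l; rewrite ?(ltW (br_gt0 _)) ?(maj_ge0 M)//).
by rewrite mulrC -mulrA -wtD subrr (wtE 0) mul0r expR0 mulr1.
Qed.

Definition whitham_r (r v : bool -> R -> R) (j : bool) (X : R) : R :=
  - 2 * (v j X * derive1 (r j) X) - derive1 (v j) X.

Definition whitham_v (gam : bool -> R) (alpha : R) (r v : bool -> R -> R) (j : bool) : R -> R :=
  derive1 (fun X => - v j X ^+ 2 +
    (gam j * (expR (2 * r j X) - 1) + alpha * (expR (2 * r (~~ j) X) - 1))).

(** The right-hand side of the Whitham system at a fixed time. The majorant is built from the given
    profiles themselves; one gap [sigma / 8] goes into the majorant and another one into the
    derivative. [G] is chosen before the profiles and so will be uniform in time. *)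
Lemma static_whitham (gam : bool -> R) (alpha sigma C : R) : 0 < sigma -> 0 <= C ->
  exists2 G : R, 0 <= G & forall r v : bool -> R -> R,
  (forall j, [/\ sqi (fun x => r j x * wt (2 * sigma) x),
     itg (fun x => (r j x * wt (2 * sigma) x) ^+ 2) <= C,
     sqi (fun x => v j x * wt (2 * sigma) x) &
     itg (fun x => (v j x * wt (2 * sigma) x) ^+ 2) <= C]) ->
  exists gr gv : bool -> R -> R, forall j,
  [/\ V (gr j) = whitham_r (fun j => V (r j)) (fun j => V (v j)) j &
      V (gv j) = whitham_v gam alpha (fun j => V (r j)) (fun j => V (v j)) j] /\
  forall g, g = gr j \/ g = gv j -> [/\ intg g, forall X, `|V g X| <= G,
     sqi (fun x => g x * wt (7 * sigma / 4) x) & itg (fun x => (g x * wt (7 * sigma / 4) x) ^+ 2) <= G ^+ 2].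
Proof.
move=> s0 C0.
have d0 : 0 < sigma / 8 by rewrite divr_gt0.
have [A HA] := std_majorantP (16 * C) d0.
pose s := 15 * sigma / 8.
have sp : 0 < s by rewrite /s; lra.
have es : s + sigma / 8 = 2 * sigma by rewrite /s; lra.
have es' : 7 * sigma / 4 + sigma / 8 = s by rewrite /s; lra.
pose K := lip_cst gam alpha A s 1.
pose K' := (K + 1) * (sigma / 8)^-1.
(* Absolute values because the sign of [A] is known only once a majorant is at hand. The final 1
   gives [1 <= G], so that a bound by [G] is also one by [G ^+ 2]. *)
exists (2 * ((`|K| + 1) * s^-1 * `|A|) + K' ^+ 2 * `|A| + 1).
  have si : 0 <= s^-1 by rewrite invr_ge0 ltW.
  have t1 : 0 <= (`|K| + 1) * s^-1 * `|A| by rewrite !mulr_ge0// addr_ge0.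
  have t2 : 0 <= K' ^+ 2 * `|A| by rewrite mulr_ge0// sqr_ge0.
  lra.
move=> r v rv.
have mwt (f : R -> R) : sqi (fun x => f x * wt (2 * sigma) x) -> measurable_fun [set: R] f.
  move=> [mf _]; have -> : f = (fun x => (f x * wt (2 * sigma) x) * wt (- (2 * sigma)) x).
    by apply/funext => x; rewrite -mulrA -wtD subrr (wtE 0) mul0r expR0 mulr1.
  by apply: measurable_funM => //; exact: measurable_wt.
(* The weight [wt s] is multiplied in, so that [std_majorant h] times [wt (- s)] dominates every
   profile. *)
pose h x := (`|r false x| + `|r true x| + `|v false x| + `|v true x|) * wt s x.
have h0 x : 0 <= h x by rewrite mulr_ge0 ?addr_ge0// ltW// wt_gt0.
have mr j : measurable_fun [set: R] (r j) by apply: mwt; have [] := rv j.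
have mv j : measurable_fun [set: R] (v j) by apply: mwt; have [] := rv j.
have mh : measurable_fun [set: R] h.
  apply: measurable_funM; last exact: measurable_wt.
  by do 3 (apply: measurable_funD; last exact: measurableT_comp); exact: measurableT_comp.
pose b x := 4 * ((r false x * wt (2 * sigma) x) ^+ 2 + (r true x * wt (2 * sigma) x) ^+ 2 +
   (v false x * wt (2 * sigma) x) ^+ 2 + (v true x * wt (2 * sigma) x) ^+ 2).
have [[[_ rf2] rfC [_ vf2] vfC] [[_ rt2] rtC [_ vt2] vtC]] := (rv false, rv true).
have ib : intg b by apply: intgZ; do 3 apply: intgD => //.
have Eb : itg b <= 16 * C.
  rewrite itgZ; last by do 3 apply: intgD => //.
  rewrite itgD//; last by do 2 apply: intgD => //.
  rewrite itgD//; last exact: intgD.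
  rewrite itgD//; lra.
have hb x : (h x * wt (sigma / 8) x) ^+ 2 <= b x.
  have -> : h x * wt (sigma / 8) x = (`|r false x| + `|r true x| + `|v false x| + `|v true x|) * wt (2 * sigma) x.
    by rewrite /h -mulrA -wtD es.
  rewrite /b !exprMn -!mulrDl mulrA ler_wpM2r ?sqr_ge0//.
  rewrite -(real_normK (num_real (r false x))) -(real_normK (num_real (r true x))).
  rewrite -(real_normK (num_real (v false x))) -(real_normK (num_real (v true x))).
  move: `|r false x| `|r true x| `|v false x| `|v true x| => a1 a2 a3 a4.
  have := sqr_ge0 (a1 - a2); have := sqr_ge0 (a1 - a3); have := sqr_ge0 (a1 - a4).
  have := sqr_ge0 (a2 - a3); have := sqr_ge0 (a2 - a4); have := sqr_ge0 (a3 - a4); lra.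
have mhw : measurable_fun [set: R] (fun x => h x * wt (sigma / 8) x).
  by apply: measurable_funM => //; exact: measurable_wt.
have ih : intg (fun x => (h x * wt (sigma / 8) x) ^+ 2).
  apply: (intg_le _ _ ib); first exact: measurable_funX.
  by move=> x; rewrite ger0_norm ?sqr_ge0.
have M : majorant A (std_majorant h).
  by apply: HA => //; apply: le_trans Eb; exact: itg_le.
have hm x : h x <= std_majorant h x.
  apply: le_trans (std_majorant_ge x h0); rewrite ler_peMr// exprn_ege1//; exact: br_ge1.
have fb (f : R -> R) : measurable_fun [set: R] f -> (forall x, `|f x| * wt s x <= h x) -> bnd (std_majorant h) s 1 f.
  move=> mf fh; split => // x; rewrite mul1r wtE mulNr expRN ler_pdivlMr ?expR_gt0//.
  exact: le_trans (fh x) (hm x).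
(* With [q = 0] the terms [N1] and [N2] are the nonlinear terms of the Whitham system. *)
pose z := State r (fun _ _ => 0) v.
have zb : stbnd (std_majorant h) s 1 z.
  move=> j; split.
  - apply: fb => // x; rewrite /h ler_wpM2r ?(ltW (wt_gt0 _ _))//.
    have := normr_ge0 (r false x); have := normr_ge0 (r true x).
    have := normr_ge0 (v false x); have := normr_ge0 (v true x); case: j; lra.
  - apply: fb; first exact: measurable_cst.
    by move=> x /=; rewrite normr0 mul0r.
  - apply: fb => // x; rewrite /h ler_wpM2r ?(ltW (wt_gt0 _ _))//.
    have := normr_ge0 (r false x); have := normr_ge0 (r true x).
    have := normr_ge0 (v false x); have := normr_ge0 (v true x); case: j; lra.
have K0 : 0 <= K by apply: (lip_cst_ge0 gam alpha M).
have A0 := maj_A M.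
exists (fun j x => N1 z j x - D (v j) x), (N2 gam alpha z) => j.
have [b1 _ b2] := N_bnd gam alpha M j sp (lexx s) ler01 zb.
have [rb _ vb] := zb j; have [rb' _ vb'] := zb (~~ j).
rewrite -/K mulr1 in b1 b2.
have Dv := bnd_D M ler01 vb.
have b3 := bnd1B b1 Dv.
have i1 := bnd1_intg M sp K0 b1; have i2 := bnd1_intg M sp ler01 Dv.
split; first split.
- apply/funext => X; rewrite VB// (V_N1 M j X sp ler01 zb).
  by rewrite -(bnd_V_D M X sp ler01 vb).2.
- apply/funext => X; rewrite (V_N2 gam alpha M j X sp ler01 zb) /whitham_v.
  congr (derive1 _ X); apply/funext => Y.
  by rewrite /= V0 expr0n sub0r.
have fin (g : R -> R) : bnd1 (std_majorant h) s (K + 1) g -> [/\ intg g, forall X,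
  `|V g X| <= 2 * ((`|K| + 1) * s^-1 * `|A|) + K' ^+ 2 * `|A| + 1,
     sqi (fun x => g x * wt (7 * sigma / 4) x) & itg (fun x => (g x * wt (7 * sigma / 4) x) ^+ 2) <= (2 *
       ((`|K| + 1) * s^-1 * `|A|) + K' ^+ 2 * `|A| + 1) ^+ 2].
  move=> gb; have K10 : 0 <= K + 1 by rewrite addr_ge0.
  have gi := bnd1_intg M sp K10 gb.
  have si : 0 <= s^-1 by rewrite invr_ge0 ltW.
  have t1 : 0 <= (K + 1) * s^-1 * A by rewrite !mulr_ge0.
  have t2 : 0 <= K' ^+ 2 * A by rewrite mulr_ge0// sqr_ge0.
  rewrite (ger0_norm K0) (ger0_norm A0).
  have [g1 g2] : sqi (fun x => g x * wt (7 * sigma / 4) x) /\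
     itg (fun x => (g x * wt (7 * sigma / 4) x) ^+ 2) <= K' ^+ 2 * A.
    by apply: (bnd1_wt M d0 K10); rewrite es'.
  split; [exact: gi| |exact: g1|].
  - move=> X; apply: le_trans (V_le X gi) _.
    have : itg (fun x => `|g x|) <= (K + 1) * s^-1 * A.
      have [_ gb0] := bnd1_bnd0 M sp K10 gb.
      apply: (@le_trans _ _ (itg (fun x => (K + 1) * s^-1 * std_majorant h x))).
        apply: itg_le; [exact: intg_abs|exact: intgZ (maj_intg M)|move=> x].
        by apply: le_trans (gb0 x) _; rewrite oppr0 (wtE 0) mul0r expR0 mulr1.
      by rewrite itgZ ?ler_wpM2l ?mulr_ge0// ?(maj_itg1 M)//; exact: maj_intg M.
    lra.
  - apply: (le_trans g2); rewrite expr2; apply: (@le_trans _ _ (2 * ((K + 1) * s^-1 * A) + K' ^+ 2 * A + 1)); first lra.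
    by rewrite ler_peMr//; lra.
move=> g [|] ->; apply: fin => //; by apply: (bnd1_mono M _ b2); rewrite lerDl.
Qed.

Lemma itg_sq_cvg (F : nat -> R -> R) f : (forall n, sqi (F n)) -> sqi f ->
  itg (fun x => (F n x - f x) ^+ 2) @[n --> \oo] --> 0 ->
  itg (fun x => F n x ^+ 2) @[n --> \oo] --> itg (fun x => f x ^+ 2).
Proof.
move=> Fs fs Ff; have h := itgM_cvg Fs fs fs Ff.
have E n : itg (fun x => F n x ^+ 2) = itg (fun x => (F n x - f x) ^+ 2) + (2 * itg (fun x =>
  F n x * f x) - itg (fun x => f x ^+ 2)).
  have i1 := (sqiB (Fs n) fs).2; have i2 := sqiM (Fs n) fs; have i3 := fs.2.
  rewrite -itgZ// -itgB//; last exact: intgZ.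
  rewrite -itgD//; last by apply: intgB => //; exact: intgZ.
  by apply: eq_itg => x; ring.
have -> : itg (fun x => f x ^+ 2) = 0 + (2 * itg (fun x => f x * f x) - itg (fun x => f x ^+ 2)).
  by rewrite add0r (eq_itg (f := fun x => f x * f x) (g := fun x => f x ^+ 2))//; ring.
by rewrite (eq_cvg _ _ E); apply: cvgD => //; apply: cvgB; [apply: cvgMl_tmp|exact: cvg_cst].
Qed.

(** The weight is unbounded; on an interval it is a bounded multiplier, which makes the cut function
    an admissible test profile. *)
Lemma wt_cut_sqi (s N : R) (f : R -> R) : intg f -> sqi f ->
  intg (cut (- N) N (fun x => f x * wt s x)) /\ sqi (cut (- N) N (fun x => f x * wt s x)).
Proof.
move=> fi fs.
have cw : continuous (wt s) by exact: continuous_wt.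
have [B B0 hB] := cut_bounded (- N) N cw.
have E x : cut (- N) N (fun x => f x * wt s x) x = f x * cut (- N) N (wt s) x.
  by rewrite /cut; case: ifP; rewrite ?mulr0.
have mc := continuous_measurable_cut (- N) N cw.
rewrite (funext E : cut (- N) N (fun x => f x * wt s x) = _); split; first exact: intg_mulb hB.
split; first by apply: measurable_funM => //; exact: intg_meas.
have := @intg_mulb R (fun x => f x ^+ 2) (fun x => cut (- N) N (wt s) x ^+ 2) (B ^+ 2) fs.2.
rewrite (_ : (fun x => f x ^+ 2 * _) = (fun x => (f x * cut (- N) N (wt s) x) ^+ 2));
  last by apply/funext => x; rewrite exprMn.
apply; first exact: measurable_funX.
by move=> x; rewrite normrX lerXn2r ?nnegrE.
Qed.

(* duality: test the increment of [V (f T)] against [V k], [k] the truncation of [(f S - f T) wt (2 s)] *)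
Lemma profile_lipschitz (Tm s G : R) (f g : R -> R -> R) : 0 < Tm -> 0 <= s -> 0 <= G ->
  (forall T, T \in `[0, Tm] -> intg (f T) /\ sqi (fun x => f T x * wt s x)) ->
  (forall T, T \in `[0, Tm] -> [/\ intg (g T), forall X, `|V (g T) X| <= G,
      sqi (fun x => g T x * wt s x) & itg (fun x => (g T x * wt s x) ^+ 2) <= G ^+ 2]) ->
  (forall T, T \in `[0, Tm] -> forall X, has_time_derivative Tm (fun S => V (f S) X) T (V (g T) X)) ->
  forall S T, S \in `[0, Tm] -> T \in `[0, Tm] ->
  sqi (fun x => (f S x - f T x) * wt s x) /\
  itg (fun x => ((f S x - f T x) * wt s x) ^+ 2) <= (G * `|S - T|) ^+ 2.
Proof.
move=> Tm0 s0 G0 hf hg hd S T SI TI.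
have [iS sS] := hf S SI; have [iT sT] := hf T TI.
pose d x := f S x - f T x.
have ds : sqi (fun x => d x * wt s x).
  by have := sqiB sS sT; congr sqi; apply/funext => x; rewrite /d mulrBl.
split => //.
have di : intg d by exact: intgB.
have md := intg_meas di.
have d2 : sqi d.
  apply: sqi_le md _ ds => x; rewrite normrM ler_peMr//.
  by rewrite ger0_norm ?(ltW (wt_gt0 _ _))// wt_ge1.
(* The estimate with the weighted increment cut to [[-N, N]], uniformly in [N]; Fatou's lemma
   removes the cut at the end. *)
have fin (N : nat) : itg (fun x => cut (- N%:R) N%:R (fun x => d x * wt s x) x ^+ 2) <= (G * `|S - T|) ^+ 2.
  have [ki ks] := wt_cut_sqi (2 * s) N%:R di d2.
  set k := cut _ _ _ in ki ks.
  set h := V k; have ch : continuous h by exact: continuous_V.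
  pose c (n : nat) := cut (- n%:R) n%:R h.
  have ci n : intg (c n) by exact: intg_cut.
  have cs n : sqi (c n) by exact: sqi_cut.
  have Vcs n : sqi (V (c n)) by have [] := sqi_V (ci n) (cs n).
  pose Vw n x := V (c n) x * wt (- s) x.
  have wle x : 0 <= wt (- s) x <= 1 by rewrite (ltW (wt_gt0 _ _)) wt_le1.
  have msw : measurable_fun [set: R] (wt (- s) : R -> R) by exact: measurable_wt.
  have Vws n : sqi (Vw n).
    apply: sqi_le (Vcs n); first by apply: measurable_funM => //; exact: (Vcs n).1.
    by move=> x; have /andP[w0 w1] := wle x; rewrite normrM ler_piMr// ger0_norm.
  pose C n := itg (fun x => Vw n x ^+ 2).
  pose P n Tt := itg (fun X => V (f Tt) X * c n X).
  (* The pairing with [c n] is differentiable in time; its derivative equals the integral of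
     [g * V (c n)], split into [(g wt s) (V (c n) wt (- s))] for Cauchy-Schwarz. The inequality is
     squared so that its limit involves no root. *)
  have L n : (P n S - P n T) ^+ 2 <= G ^+ 2 * C n * (S - T) ^+ 2.
    have [] : `|P n S - P n T| <= (G * Num.sqrt (C n)) * `|S - T|.
      apply: (@htd_lip R Tm (P n) (fun Tt => itg (fun X => V (g Tt) X * c n X))) => // Tt TtI.
      have [gi gb gs gG] := hg Tt TtI; have [fi fs] := hf Tt TtI.
      split.
        apply: (@htd_under_itg R Tm (fun Tt X => V (f Tt) X * c n X) (fun Tt X => V (g Tt) X * c n X) (fun X =>
          G * `|c n X|)) => //.
        - by apply: intgZ; exact: intg_abs.
        - by move=> U UI; apply: intg_VM => //; exact: (hf U UI).1.
        - move=> U UI X; split; last by rewrite normrM ler_wpM2r//; have [_ + _ _] := hg U UI; exact.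
          have := htdZ (c := c n X) (hd U UI X); rewrite mulrC.
          by apply: htd_eq => // W _; rewrite mulrC.
      rewrite V_adjoint// (eq_itg (g := fun x => (g Tt x * wt s x) * Vw n x)); last first.
        by move=> x; rewrite /Vw mulrACA -wtD subrr (wtE 0) mul0r expR0 mulr1.
      apply: (le_trans (itg_CS_sqrt gs (Vws n))); rewrite ler_wpM2r ?sqrtr_ge0//.
      by rewrite -(ger0_norm G0) -sqrtr_sqr ler_wsqrtr.
    have C0 : 0 <= C n by apply: itg_ge0 => x; exact: sqr_ge0.
    move=> h1; rewrite -[leLHS]real_normK ?num_real// -[(S - T) ^+ 2]real_normK ?num_real//.
    rewrite -(sqr_sqrtr C0) -!exprMn lerXn2r// nnegrE !mulr_ge0// sqrtr_ge0.
  have Vc0 : itg (fun x => (V (c n) x - 2 * pi * k x) ^+ 2) @[n --> \oo] --> 0 by exact: V_cut_cvg.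
  have k2s : sqi (fun x => 2 * pi * k x) by exact: sqiZ.
  pose B := itg (fun x => cut (- N%:R) N%:R (fun x => d x * wt s x) x ^+ 2).
  have B0 : 0 <= B by apply: itg_ge0 => x; exact: sqr_ge0.
  have dk x : d x * k x = cut (- N%:R) N%:R (fun x => d x * wt s x) x ^+ 2.
    rewrite /k /cut; case: ifP => _; last by rewrite mulr0 expr0n.
    by rewrite (_ : 2 * s = s + s) ?wtD; ring.
  have lim1 : P n S - P n T @[n --> \oo] --> 2 * pi * B.
    have E n : P n S - P n T = itg (fun x => V (c n) x * d x).
      rewrite /P (V_adjoint iS (ci n)) (V_adjoint iT (ci n)) -itgB.
      - by apply: eq_itg => x; rewrite /d; ring.
      - by under eq_fun do rewrite mulrC; exact: intg_VM.
      - by under eq_fun do rewrite mulrC; exact: intg_VM.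
    rewrite (eq_cvg _ _ E).
    have := itgM_cvg Vcs k2s d2 Vc0.
    congr (_ --> _); rewrite /B -itgZ; last first.
      by have := sqiM d2 ks; congr intg; apply/funext => x; rewrite dk.
    by apply: eq_itg => x; rewrite -dk; ring.
  have lim2 : C n @[n --> \oo] --> (2 * pi) ^+ 2 * B.
    have kws : sqi (fun x => 2 * pi * k x * wt (- s) x).
      apply: (sqi_le _ _ k2s); first by apply: measurable_funM => //; exact: k2s.1.
      by move=> x; have /andP[w0 w1] := wle x; rewrite normrM ler_piMr// ger0_norm.
    have -> : (2 * pi) ^+ 2 * B = itg (fun x => (2 * pi * k x * wt (- s) x) ^+ 2).
      rewrite /B -itgZ; last by have := sqiM d2 ks; congr intg; apply/funext => x; rewrite dk.
      apply: eq_itg => x; rewrite -exprMn; congr (_ ^+ 2).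
      rewrite /k /cut; case: ifP => _; last by rewrite !mulr0 mul0r.
      by rewrite (_ : 2 * s = s + s) ?wtD; [rewrite -!mulrA -wtD subrr (wtE 0) mul0r expR0 mulr1|ring].
    apply: itg_sq_cvg => //.
    apply: cvg_squeeze0 Vc0 => n; rewrite ger0_norm; last by apply: itg_ge0 => x; exact: sqr_ge0.
    apply: itg_le; [exact: (sqiB (Vws n) kws).2|exact: (sqiB (Vcs n) k2s).2|move=> x].
    rewrite /Vw -mulrBl exprMn ler_piMr ?sqr_ge0//.
    by have /andP[w0 w1] := wle x; rewrite exprn_ile1.
  have : (2 * pi * B) ^+ 2 <= G ^+ 2 * ((2 * pi) ^+ 2 * B) * (S - T) ^+ 2.
    have l1 : (P n S - P n T) ^+ 2 @[n --> \oo] --> (2 * pi * B) ^+ 2.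
      by rewrite (eq_cvg _ _ (fun n => expr2 _)) expr2; exact: cvgM.
    have l2 : G ^+ 2 * C n * (S - T) ^+ 2 @[n --> \oo] --> G ^+ 2 * ((2 * pi) ^+ 2 * B) * (S - T) ^+ 2.
      by apply: cvgMr_tmp; apply: cvgMl_tmp.
    by apply: (ler_cvg_to l1 l2); exact: nearW.
  (* Up to the factor [(2 pi)^2] the limit reads [B^2 <= G^2 (S - T)^2 B]; one factor [B]
     cancels. *)
  rewrite -/B; have [->|Bn] := eqVneq B 0; first by rewrite sqr_ge0.
  have Bp : 0 < B by rewrite lt_def Bn.
  have p2 : 0 < (2 * pi) ^+ 2 * B :> R by rewrite mulr_gt0// exprn_gt0// mulr_gt0// pi_gt0.
  rewrite (_ : _ * (S - T) ^+ 2 = ((2 * pi) ^+ 2 * B) * (G * `|S - T|) ^+ 2); last first.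
    by rewrite [(G * _) ^+ 2]exprMn real_normK ?num_real//; ring.
  by rewrite (_ : (2 * pi * B) ^+ 2 = ((2 * pi) ^+ 2 * B) * B) ?ler_pM2l//; ring.
have [||||_ ->//] := @itg_fatou R (fun n x => cut (- n%:R) n%:R (fun x => d x * wt s x) x ^+ 2) (fun x =>
  (d x * wt s x) ^+ 2) ((G * `|S - T|) ^+ 2).
- by move=> n x; exact: sqr_ge0.
- move=> n; rewrite cut_sqr; apply: (intg_le _ _ ds.2).
    by apply: measurable_cut; apply: measurable_funX; exact: ds.1.
  by move=> x; rewrite /cut; case: ifP => _; rewrite ?normr0 ?sqr_ge0// ger0_norm ?sqr_ge0.
- move=> x; apply: cvg_near_cst; near=> n.
  have xn : `|x| <= n%:R by near: n; exact: nbhs_infty_ger.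
  by move: xn; rewrite ler_norml /cut => ->.
- exact: fin.
Unshelve. all: by end_near. Qed.

End Static.

(** * Continuity in time at each frequency, by chaining *)

Section Chaining.
Context {R : realType}.
Notation mu := (@lebesgue_measure R).

Lemma half_pow_cvg (c : R) : c / 2 ^+ n @[n --> \oo] --> 0.
Proof.
have := @cvg_geometric R c 2^-1; rewrite ger0_norm// invf_lt1// ltr1n => /(_ isT).
by apply: cvg_trans; apply: near_eq_cvg; apply: nearW => n; rewrite /geometric/= exprVn.
Qed.

Lemma geo_cauchy (a : nat -> R) (c : R) : (forall n, `|a n.+1 - a n| <= c / 2 ^+ n.+1) ->
  cvgn a /\ forall n, `|limn a - a n| <= c / 2 ^+ n.
Proof.
move=> h.
have c0 : 0 <= c by have := le_trans (normr_ge0 _) (h 0%N); rewrite pmulr_lge0// invr_gt0.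
have d n k : `|a (n + k)%N - a n| <= c / 2 ^+ n - c / 2 ^+ (n + k).
  elim: k => [|k IH]; first by rewrite addn0 !subrr normr0.
  rewrite addnS -(subrK (a (n + k)%N) (a (n + k).+1)) -addrA.
  apply: (le_trans (ler_normD _ _)); have := h (n + k)%N; rewrite exprS invfM.
  set e := (2 ^+ (n + k))^-1; have -> : c * (2^-1 * e) = 2^-1 * (c * e) by ring.
  by rewrite -/e in IH; lra.
have d' n k : (n <= k)%N -> `|a k - a n| <= c / 2 ^+ n.
  move=> nk; rewrite -(subnKC nk); apply: (le_trans (d _ _)).
  by rewrite lerBlDr lerDl divr_ge0// exprn_ge0.
have cv : cvgn a.
  have ct : cvgn (series (telescope a)).
    apply: normed_cvg; apply: (series_le_cvg (v_ := geometric (c / 2) 2^-1)) => //.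
    - by move=> n; exact: normr_ge0.
    - by move=> n; rewrite /geometric/= mulr_ge0 ?divr_ge0// exprn_ge0.
    - move=> n; apply: (le_trans (h n)).
      by rewrite /geometric/= exprS invfM mulrA exprVn.
    - by apply: is_cvg_geometric_series; rewrite ger0_norm// invf_lt1// ltr1n.
  have -> : a = (fun n => series (telescope a) n + a 0%N).
    by rewrite telescopeK; apply/funext => n; rewrite /= subrK.
  by apply: is_cvgD => //; exact: is_cvg_cst.
split => // n.
apply: (@cvg_le_cst _ (fun k => `|a (k + n)%N - a n|)).
  by move=> k; apply: d'; rewrite leq_addl.
apply: cvg_norm; apply: cvgB; last exact: cvg_cst.
by rewrite cvg_shiftn.
Qed.

(** Summable integrals make the sum finite almost everywhere. The measurable predicate [fin] keeps
    the good frequencies explicit, so that functions can be set to 0 on the others. *)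
Lemma series_ae (a : nat -> R -> R) (c : R) : (forall n x, 0 <= a n x) -> (forall n, intg (a n)) ->
  (forall n, itg (a n) <= c / 2 ^+ n) ->
  exists (S : R -> R) (fin : R -> bool),
  [/\ forall x, 0 <= S x, intg S, measurable_fun [set: measurableTypeR R] fin,
     {ae mu, forall x : measurableTypeR R, fin x} & forall x, fin x -> forall n, a n x <= S x].
Proof.
move=> a0 ai ac.
have c0 : 0 <= c by have := le_trans (itg_ge0 (a0 0%N)) (ac 0%N); rewrite expr0 divr1.
pose SE (x : measurableTypeR R) := (\sum_(n <oo) (a n x)%:E)%E.
have mSE : measurable_fun setT SE.
  have := @ge0_emeasurable_sum _ (measurableTypeR R) R setT (fun n x => (a n x)%:E) predT.
  apply; first by move=> k x _ _; rewrite lee_fin.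
  by move=> k _; apply/measurable_EFinP; exact: intg_meas.
have SE0 x : (0 <= SE x)%E by apply: nneseries_ge0 => n _ _; rewrite lee_fin.
have SEi : mu.-integrable setT SE.
  apply/integrableP; split => //.
  under eq_integral do rewrite gee0_abs//.
  have mE n : measurable_fun setT (fun x : measurableTypeR R => (a n x)%:E).
    by apply/measurable_EFinP; exact: intg_meas.
  rewrite /SE integral_nneseries//; last by move=> n x _; rewrite lee_fin.
  apply: (@le_lt_trans _ _ (2 * c)%:E); last by rewrite ltry.
  apply: lime_le; first by apply: is_cvg_nneseries => n _ _; apply: integral_ge0 => x _; rewrite lee_fin.
  apply: nearW => n.
  under eq_bigr do rewrite -EFin_itg//.
  rewrite sumEFin lee_fin.
  suff : \sum_(0 <= i < n) itg (a i) <= 2 * c - 2 * c / 2 ^+ n.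
    by move=> h; apply: (le_trans h); rewrite lerBlDr lerDl divr_ge0 ?exprn_ge0// mulr_ge0.
  elim: n => [|n IH]; first by rewrite big_geq// expr0 divr1 subrr.
  rewrite big_nat_recr//= (le_trans (lerD IH (ac n)))// exprS invfM.
  set e := (2 ^+ n)^-1; have -> : 2 * c * (2^-1 * e) = c * e by field.
  lra.
pose fin x := SE x \is a fin_num.
exists (fun x => fine (SE x)), fin.
have le x : fin x -> forall n, a n x <= fine (SE x).
  move=> fx n; rewrite -lee_fin fineK//.
  apply: (@le_trans _ _ (\sum_(0 <= i < n.+1) (a i x)%:E)%E); last first.
    by apply: nneseries_lim_ge => i _ _; rewrite lee_fin.
  by rewrite big_nat_recr//= leeDr// sume_ge0// => i _; rewrite lee_fin.
split => //.
- by move=> x; exact: fine_ge0.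
- apply: (le_integrable measurableT _ _ SEi).
    by apply/measurable_EFinP; apply: measurableT_comp => //; exact: measurable_fine.
  move=> x _ /=; rewrite (gee0_abs (SE0 x)) ger0_norm ?fine_ge0//.
  by case: (SE x) (SE0 x) => [r||]//=; rewrite ?leey ?lee_fin.
- have -> : fin = (fun x => SE x \is a fin_num) by [].
  apply: (measurable_fun_bool true); rewrite setTI.
  rewrite (_ : _ @^-1` _ = setT `&` [set x | SE x \is a fin_num]); last by apply/seteqP; split => x //= [].
  exact: emeasurable_fin_num.
- have := integrable_ae measurableT SEi; apply: filterS => x; exact.
Qed.

Lemma intg_wtN (s : R) : 0 < s -> intg (wt (- s) : R -> R).
Proof.
move=> s0; have := intgZ (expR (- s)) (@intg_expabs R s s0); congr intg; apply/funext => x.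
by rewrite -expRD; congr expR; ring.
Qed.

Lemma sqi_wt_intg (s : R) (h : R -> R) : 0 < s -> sqi (fun x => h x * wt s x) -> intg h.
Proof.
move=> s0 hs; have ws : sqi (wt (- s) : R -> R).
  split; first exact: measurable_wt.
  have := intg_wtN (addr_gt0 s0 s0); congr intg; apply/funext => x.
  by rewrite opprD wtD expr2.
have := sqiM hs ws; congr intg; apply/funext => x.
by rewrite -mulrA -wtD subrr (wtE 0) mul0r expR0 mulr1.
Qed.

(** When the grid is refined [k] times, the index [i] of the grid point below [y] becomes one of
    [k i, ..., k i + k - 1]. *)
Lemma truncn_scale (y : R) n k : 0 <= y -> (0 < k)%N ->
  (k * Num.truncn (n%:R * y) <= Num.truncn ((k * n)%:R * y) < k * Num.truncn (n%:R * y) + k)%N.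
Proof.
move=> y0 k0; have ny : 0 <= n%:R * y by rewrite mulr_ge0.
have /andP[h1 h2] := truncn_itv ny.
have kp : 0 < k%:R :> R by rewrite ltr0n.
have kny : 0 <= (k * n)%:R * y by rewrite mulr_ge0.
apply/andP; split.
  by rewrite truncn_ge_nat// !natrM -mulrA ler_pM2l.
by rewrite truncn_lt_nat// -mulnSr !natrM -mulrA ltr_pM2l.
Qed.

(** Extends functions on [[0, Tm]] to all times by their endpoint values, so that continuity in time
    can be stated on the whole line. *)
Definition clip (Tm T : R) : R := Num.max 0 (Num.min T Tm).

Lemma clip_itv (Tm T : R) : 0 <= Tm -> clip Tm T \in `[0, Tm].
Proof.
by move=> Tm0; rewrite in_itv/= /clip le_max lexx/= ge_max Tm0 ge_min lexx orbT.
Qed.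

Lemma clip_id (Tm T : R) : T \in `[0, Tm] -> clip Tm T = T.
Proof. by rewrite in_itv/= /clip => /andP[T0 T1]; rewrite min_l// max_r. Qed.

Lemma continuous_clip (Tm : R) : continuous (clip Tm).
Proof.
move=> T; rewrite /clip; apply: (@continuous_max _ _ (fun=> 0) (fun T => Num.min T Tm)); first exact: cvg_cst.
by apply: (@continuous_min _ _ id (fun=> Tm)); [exact: cvg_id|exact: cvg_cst].
Qed.

(* Kolmogorov-type chaining along the points [Tm j / 16^n]: the squared increments of level [n],
   weighted by [4^n], are summable in [L^1] *)
Lemma chaining (Tm s G : R) (f : R -> R -> R) : 0 < Tm -> 0 < s ->
  (forall T, T \in `[0, Tm] -> intg (f T)) -> sqi (fun x => f 0 x * wt s x) ->
  (forall S T, S \in `[0, Tm] -> T \in `[0, Tm] ->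
    sqi (fun x => (f S x - f T x) * wt s x) /\
    itg (fun x => ((f S x - f T x) * wt s x) ^+ 2) <= (G * `|S - T|) ^+ 2) ->
  (forall T, T \in `[0, Tm] -> forall X (u : nat -> R), (forall n, u n \in `[0, Tm]) ->
     u n @[n --> \oo] --> T -> V (f (u n)) X @[n --> \oo] --> V (f T) X) ->
  exists (F : R -> R -> R) (h : R -> R),
  [/\ forall x, 0 <= h x, sqi (fun x => h x * wt s x),
     forall T x, `|F T x| <= h x, forall x, continuous (fun T => F T x) &
     forall T, measurable_fun [set: R] (F T) /\ (T \in `[0, Tm] -> V (F T) = V (f T))].
Proof.
move=> Tm0 s0 fi f0s fL fc.
(* Base 16: level [n] has [16^n] increments of squared size [16^(- 2 n)], so the sum weighted by
   [4^n] is of order [4^(- n)], summable, while the weight still forces pointwise increments of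
   order [2^(- n)]. *)
pose q n := (16 ^ n)%N.
have q0 n : (0 < q n)%N by rewrite expn_gt0.
have qp n : 0 < (q n)%:R :> R by rewrite ltr0n.
have qS n : q n.+1 = (16 * q n)%N by rewrite /q expnS.
pose t n j : R := Tm * (j%:R / (q n)%:R).
have tI n j : (j <= q n)%N -> t n j \in `[0, Tm].
  move=> jq; rewrite in_itv/= /t mulr_ge0 ?(ltW Tm0) ?divr_ge0//=.
  by rewrite ler_piMr ?(ltW Tm0)// ler_pdivrMr// mul1r ler_nat.
have tS n j : t n.+1 (16 * j)%N = t n j.
  rewrite /t qS !natrM; congr (_ * _); field.
  by rewrite gt_eqF//.
pose w n j := f (t n j).
pose M2 n x := \sum_(j < q n) (w n j.+1 x - w n j x) ^+ 2.
have M20 n x : 0 <= M2 n x by apply: sumr_ge0 => j _; exact: sqr_ge0.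
pose a n x := 4 ^+ n * (M2 n x * wt s x ^+ 2).
have a0 n x : 0 <= a n x by rewrite !mulr_ge0// ?exprn_ge0// ltW// wt_gt0.
have aE n x : a n x = 4 ^+ n * \sum_(j < q n) ((w n j.+1 x - w n j x) * wt s x) ^+ 2.
  rewrite /a; congr (_ * _); rewrite mulr_suml; apply: eq_bigr => j _; by rewrite exprMn.
have inc n (j : 'I_(q n)) := fL _ _ (tI n j.+1 (ltn_ord j)) (tI n j (ltnW (ltn_ord j))).
have ai n : intg (a n).
  rewrite (funext (aE n) : a n = _); apply: intgZ; apply: intg_sum => j.
  by have [[]] := inc n j.
have ac n : itg (a n) <= (G * Tm) ^+ 2 / 2 ^+ n.
  rewrite (eq_itg (aE n)) itgZ; last by apply: intg_sum => j; have [[]] := inc n j.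
  rewrite itg_sum; last by move=> j; have [[]] := inc n j.
  apply: (@le_trans _ _ (4 ^+ n * \sum_(j < q n) (G * Tm / (q n)%:R) ^+ 2)).
    rewrite ler_wpM2l ?exprn_ge0//; apply: ler_sum => j _; have [_ le] := inc n j.
    apply: (le_trans le); rewrite /t -mulrBr -mulrBl -natr1 addrAC subrr add0r mul1r.
    by rewrite ger0_norm ?mulrA// mulr_ge0 ?invr_ge0 ?(ltW Tm0).
  rewrite sumr_const card_ord.
  have -> : (G * Tm / (q n)%:R) ^+ 2 *+ q n = (G * Tm) ^+ 2 / (q n)%:R.
    by rewrite -[LHS]mulr_natr; field; rewrite gt_eqF.
  rewrite mulrCA.
  rewrite ler_wpM2l ?sqr_ge0// /q natrX ler_pdivrMr ?exprn_gt0//.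
  have -> : 16 ^+ n = 2 ^+ n * 8 ^+ n :> R by rewrite -exprMn -natrM.
  by rewrite mulrA mulVf ?mul1r ?gt_eqF ?exprn_gt0// lerXn2r ?nnegrE// ler_nat.
have [S [fin [S0 Si mfin aefin finS]]] := series_ae a0 ai ac.
(* [S] dominates the weighted square sums of all levels at once, so its root with the exponential
   weight removed bounds each increment of level [n] by [z / 2^n]. *)
pose z x := Num.sqrt (S x) * wt (- s) x.
have z0 x : 0 <= z x by rewrite mulr_ge0 ?sqrtr_ge0// ltW// wt_gt0.
have step n j x : fin x -> (j < q n)%N -> `|w n j.+1 x - w n j x| <= z x / 2 ^+ n.
  move=> fx jq.
  have h1 : (w n j.+1 x - w n j x) ^+ 2 <= M2 n x.
    rewrite /M2 (bigD1 (Ordinal jq))//= lerDl sumr_ge0// => i _; exact: sqr_ge0.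
  have h2 := finS x fx n.
  have h3 : M2 n x <= (z x / 2 ^+ n) ^+ 2.
    rewrite /z !exprMn sqr_sqrtr// exprVn -!exprM mulnC [(2 ^+ (2 * n))%R]exprM.
    rewrite ler_pdivlMr ?exprn_gt0// (_ : 2 ^+ 2 = 4); last by rewrite -natrX.
    rewrite -(ler_pM2r (exprn_gt0 2 (wt_gt0 s x))) -[leRHS]mulrA -exprMn -wtD addNr (wtE 0) mul0r expR0 expr1n mulr1.
    by move: h2; rewrite /a; lra.
  rewrite -(@ler_pXn2r _ 2) ?nnegrE// ?divr_ge0 ?exprn_ge0// real_normK ?num_real//.
  exact: le_trans h1 h3.
have tele n j k x : fin x -> (j + k <= q n)%N -> `|w n (j + k)%N x - w n j x| <= k%:R * (z x / 2 ^+ n).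
  move=> fx; elim: k => [|k IH]; first by rewrite addn0 subrr normr0 mul0r.
  rewrite addnS => jk; rewrite -(subrKA (w n (j + k)%N x)) (le_trans (ler_normD _ _))//.
  by rewrite -natr1 mulrDl mul1r addrC lerD ?step// IH// ltnW.
pose idx n T := Num.truncn ((q n)%:R * (clip Tm T / Tm)).
have cI T := clip_itv T (ltW Tm0).
have y01 T : 0 <= clip Tm T / Tm <= 1.
  by have := cI T; rewrite in_itv/= => /andP[c0 c1]; rewrite divr_ge0 ?(ltW Tm0)//= ler_pdivrMr// mul1r.
have y0 n T : 0 <= (q n)%:R * (clip Tm T / Tm) by have /andP[h _] := y01 T; rewrite mulr_ge0.
have idq n T : (idx n T <= q n)%N.
  have /andP[_ h] := y01 T.
  rewrite -(ler_nat R) (le_trans (_ : _ <= (q n)%:R * (clip Tm T / Tm)))//; first by rewrite truncn_le.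
  by rewrite ler_piMr.
pose g n T := w n (idx n T).
have gS n T x : fin x -> `|g n.+1 T x - g n T x| <= (16 * z x) / 2 ^+ n.+1.
  move=> fx; have /andP[y0' _] := y01 T.
  have := @truncn_scale _ (q n) 16 y0' isT; rewrite -qS -/(idx n T) -/(idx n.+1 T) => /andP[i1 i2].
  have -> : g n T x = w n.+1 (16 * idx n T)%N x by rewrite /g /w tS.
  rewrite /g -(subnKC i1); apply: (le_trans (tele _ _ _ _ fx _)); first by rewrite subnKC.
  by rewrite -mulrA ler_wpM2r ?divr_ge0 ?exprn_ge0// ler_nat; lia.
(* On exceptional frequencies the approximations are 0 at all times, which preserves continuity in
   time at every frequency. *)
pose g' n T x := if fin x then g n T x else 0.
have g'S n T x : `|g' n.+1 T x - g' n T x| <= (16 * z x) / 2 ^+ n.+1.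
  rewrite /g'; case: ifP => fx; first exact: gS.
  by rewrite subrr normr0 divr_ge0 ?exprn_ge0// mulr_ge0.
pose F T x := limn (fun n => g' n T x).
have gF T x : g' n T x @[n --> \oo] --> F T x by have [] := geo_cauchy (fun n => g'S n T x).
have gFd n T x : `|F T x - g' n T x| <= 16 * z x / 2 ^+ n by have [] := geo_cauchy (fun n => g'S n T x).
(* 17 is one step of level 0 plus 16 for the geometric tail. *)
pose h x := `|f 0 x| + 17 * z x.
have h0 x : 0 <= h x by rewrite addr_ge0// mulr_ge0.
have g0h T x : `|g' 0%N T x| <= `|f 0 x| + z x.
  rewrite /g'; case: ifP => fx; last by rewrite normr0 addr_ge0.
  have -> : f 0 x = w 0%N 0%N x by rewrite /w /t mul0r mulr0.
  rewrite /g -(subrK (w 0%N 0%N x) (w 0%N (idx 0%N T) x)) addrC.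
  apply: (le_trans (ler_normD _ _)); rewrite lerD2l.
  apply: (le_trans (tele 0%N 0%N (idx 0%N T) x fx _)); first by rewrite add0n.
  by rewrite expr0 divr1 ler_piMl// -[1]/(1%:R) ler_nat.
have mfw n j : (j <= q n)%N -> measurable_fun [set: R] (w n j) by move=> jq; apply: intg_meas; apply: fi; exact: tI.
have mg' n T : measurable_fun [set: R] (g' n T).
  apply: measurable_fun_ifT => //; exact: mfw.
have mF T : measurable_fun [set: R] (F T).
  apply: (@measurable_fun_cvg _ _ _ _ (fun n => g' n T)); first by move=> n; exact: mg'.
  by move=> x _; exact: gF.
have Fh T x : `|F T x| <= h x.
  rewrite -(subrK (g' 0%N T x) (F T x)); apply: (le_trans (ler_normD _ _)).
  have := gFd 0%N T x; have := g0h T x; rewrite expr0 divr1 /h; lra.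
have g'h n T x : `|g' n T x| <= `|f 0 x| + 33 * z x.
  rewrite -(subKr (F T x) (g' n T x)); apply: (le_trans (ler_normB _ _)).
  have h1 := gFd n T x; have h2 := Fh T x; rewrite /h in h2.
  have : 16 * z x / 2 ^+ n <= 16 * z x.
    have z16 : 0 <= 16 * z x by rewrite mulr_ge0.
    have e1 : 1 <= 2 ^+ n :> R by apply: exprn_ege1; rewrite ler1n.
    by rewrite ler_pdivrMr ?exprn_gt0// ler_peMr.
  lra.
have sS : sqi (fun x => Num.sqrt (S x)).
  split; first by apply: (measurableT_comp (continuous_measurable_fun (@sqrt_continuous R))); exact: intg_meas.
  by move: Si; congr intg; apply/funext => x; rewrite sqr_sqrtr.
have zE x : z x * wt s x = Num.sqrt (S x).
  by rewrite /z -mulrA -wtD addNr (wtE 0) mul0r expR0 mulr1.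
have f0a : sqi (fun x => `|f 0 x| * wt s x).
  case: f0s => m0 i0; split.
    apply: measurable_funM; last exact: measurable_wt.
    have mf0 : measurable_fun [set: R] (f 0) by apply: intg_meas; apply: fi; rewrite in_itv/= lexx ltW.
    exact: measurableT_comp.
  by move: i0; congr intg; apply/funext => x; rewrite !exprMn real_normK ?num_real.
have hs c : sqi (fun x => (`|f 0 x| + c * z x) * wt s x).
  have := sqiD f0a (sqiZ c sS); congr sqi; apply/funext => x.
  by rewrite mulrDl -mulrA zE.
exists F, h; split => //.
- exact: hs.
- move=> x T; apply/cvgrPdist_le => e e0.
  (* 33 is two tails of 16 plus one step between neighbouring grid points. *)
  have : 33 * z x / 2 ^+ n @[n --> \oo] --> 0 by exact: half_pow_cvg.
  move/cvgrPdist_le => /(_ _ e0)[n _ /(_ n (leqnn n))/=].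
  rewrite sub0r normrN => /(le_trans (ler_norm _)) => hn.
  have close U W : clip Tm U - clip Tm W < Tm / (q n)%:R -> (idx n U <= (idx n W).+1)%N.
    move=> cl; rewrite /idx -ltnS truncn_lt_nat//.
    have /andP[_ lt] := truncn_itv (y0 n W).
    have : (q n)%:R * (clip Tm U / Tm) < (q n)%:R * (clip Tm W / Tm) + 1.
      have : (q n)%:R * ((clip Tm U - clip Tm W) / Tm) < 1.
        by rewrite mulrA ltr_pdivrMr// mul1r mulrC -ltr_pdivlMr.
      by rewrite mulrBl mulrBr; lra.
    by move=> h1; rewrite -[in ltRHS]natr1; lra.
  have gc U W : `|clip Tm U - clip Tm W| < Tm / (q n)%:R -> `|g' n U x - g' n W x| <= z x / 2 ^+ n.
    rewrite ltr_norml => /andP[l1 l2]; rewrite /g'; case: ifP => fx; last by rewrite subrr normr0 divr_ge0 ?exprn_ge0.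
    have c1 := close U W l2; have c2 : (idx n W <= (idx n U).+1)%N by apply: close; lra.
    rewrite /g; have [E|E|->] := ltngtP (idx n U) (idx n W).
    - have -> : idx n W = (idx n U).+1 by apply/eqP; rewrite eqn_leq c2.
      by rewrite distrC; apply: step => //; exact: leq_trans E (idq n W).
    - have -> : idx n U = (idx n W).+1 by apply/eqP; rewrite eqn_leq c1.
      by apply: step => //; exact: leq_trans E (idq n U).
    - by rewrite subrr normr0 divr_ge0 ?exprn_ge0.
  have : clip Tm U @[U --> T] --> clip Tm T by exact: continuous_clip.
  move/cvgrPdist_lt => /(_ (Tm / (q n)%:R)).
  rewrite divr_gt0// => /(_ isT); apply: filterS => U /gc gU.
  have h1 := gFd n T x; have h2 := gFd n U x.
  rewrite (_ : F T x - F U x = (F T x - g' n T x) + (g' n T x - g' n U x) - (F U x - g' n U x)); last by ring.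
  apply: (le_trans (ler_normB _ _)); apply: (le_trans (lerD (ler_normD _ _) (lexx _))).
  have : 33 * z x / 2 ^+ n = 2 * (16 * z x / 2 ^+ n) + z x / 2 ^+ n by ring.
  lra.
- move=> T; split => // TI; apply/funext => X.
  have hi c : intg (fun x => `|f 0 x| + c * z x) by exact: sqi_wt_intg (hs c).
  have [||||_ H] := @itg_dct R (fun n x => g' n T x * cas (x * X)) (fun x => F T x * cas (x * X)) (fun x =>
    (`|f 0 x| + 33 * z x) * 2).
  + by move=> n; apply: measurable_funM => //; exact: measurable_casM.
  + by move=> n x; rewrite normrM ler_pM// cas_le2.
  + by under eq_fun do rewrite mulrC; apply: intgZ; exact: hi.
  + by move=> x; apply: cvgMr_tmp; exact: gF.
  (* At a grid time the profile is changed on a null set only; the grid times tend to [T], and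
     continuity of [V (f T) X] in time identifies the limit. *)
  have E n : itg (fun x => g' n T x * cas (x * X)) = V (f (t n (idx n T))) X.
    have [] := @itg_ae_eq R (fun x => f (t n (idx n T)) x * cas (x * X)) (fun x => g' n T x * cas (x * X)) => //.
    - by apply: measurable_funM => //; exact: measurable_casM.
    - by apply: intg_cas; apply: fi; exact: tI.
    - by move: aefin; apply: filterS => x fx; rewrite /g' fx.
  rewrite [LHS]/V; apply: (cvg_unique _ H); first exact: norm_hausdorff.
  rewrite /= (eq_cvg _ _ E); apply: fc => //; first by move=> n; exact: tI.
  apply/cvgrPdist_le => e e0.
  move/cvgrPdist_le : (half_pow_cvg Tm) => /(_ _ e0); apply: filterS => n.
  rewrite sub0r normrN ger0_norm ?divr_ge0 ?exprn_ge0 ?(ltW Tm0)//; apply: le_trans.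
  have /andP[l1 l2] := truncn_itv (y0 n T); rewrite -/(idx n T) in l1 l2.
  have cT := clip_id TI; rewrite cT in l1 l2.
  have e1 : T = Tm / (q n)%:R * ((q n)%:R * (T / Tm)) by field; rewrite !gt_eqF.
  have e2 : t n (idx n T) = Tm / (q n)%:R * (idx n T)%:R by rewrite /t; ring.
  have d0 : 0 < Tm / (q n)%:R by rewrite divr_gt0.
  rewrite {1}e1 e2 -mulrBr normrM (gtr0_norm d0) ger0_norm ?subr_ge0//.
  apply: (@le_trans _ _ (Tm / (q n)%:R)).
    by rewrite ler_piMr ?(ltW d0)//; rewrite -natr1 in l2; lra.
  rewrite ler_wpM2l ?(ltW Tm0)// lef_pV2 ?posrE ?exprn_gt0// /q natrX lerXn2r ?nnegrE//.
  by rewrite ler_nat.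
Qed.

End Chaining.

(** * Dominated profiles of the Whitham solution *)

Section WhithamProfiles.
Context {R : realType}.

Lemma derive_flux (q v r ro : R -> R) (g a X : R) :
  derivable q X 1 -> derivable v X 1 -> derivable r X 1 -> derivable ro X 1 ->
  derive1 (fun X => (q X ^+ 2 - v X ^+ 2) + (g * (expR (2 * r X) - 1) + a * (expR (2 * ro X) - 1))) X =
  2 * q X * derive1 q X - 2 * v X * derive1 v X +
  (2 * g * expR (2 * r X) * derive1 r X + 2 * a * expR (2 * ro X) * derive1 ro X).
Proof.
move=> /derivableP dq /derivableP dv /derivableP dr /derivableP dro.
rewrite !derive1E.
have e2 (f : R -> R) : is_derive X 1 f ('D_1 f X) -> is_derive X 1 (fun X =>
  expR (2 * f X)) (2 * expR (2 * f X) * 'D_1 f X).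
  move=> df; have h : is_derive X 1 (fun X => 2 * f X) (2 * 'D_1 f X) by apply: is_derive_eq; rewrite /GRing.scale/=; ring.
  have := @is_derive1_comp _ expR _ X _ _ (is_derive_expR _) h.
  by rewrite (_ : expR _ * _ = 2 * expR (2 * f X) * 'D_1 f X)//; ring.
have er := e2 r dr; have ero := e2 ro dro.
have := @derive_val _ _ _ X 1 (fun X => (q X ^+ 2 - v X ^+ 2) + (g * (expR (2 * r X) - 1) + a * (expR (2 * ro X) - 1)))
  (2 * q X * 'D_1 q X - 2 * v X * 'D_1 v X +
  (2 * g * expR (2 * r X) * 'D_1 r X + 2 * a * expR (2 * ro X) * 'D_1 ro X)).
apply; apply: is_derive_eq; rewrite /GRing.scale/=; ring.
Qed.

(** The boolean [j] numbers the two waves and [~~ j] is the other one, so that each equation is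
    treated once for both. *)
Definition ri (j : bool) : 'I_4 := if j then ir2 else ir1.
Definition vi (j : bool) : 'I_4 := if j then iv2 else iv1.
Definition gamj (gamma1 gamma2 : R) (j : bool) : R := if j then gamma2 else gamma1.

Lemma index4 (P : 'I_4 -> Prop) : (forall j, P (ri j) /\ P (vi j)) -> forall i, P i.
Proof.
move=> h; have [[h0 h1] [h2 h3]] := (h false, h true).
case=> [[|[|[|[|//]]]] i4].
- by rewrite (_ : Ordinal i4 = ri false) //; apply: val_inj.
- by rewrite (_ : Ordinal i4 = vi false) //; apply: val_inj.
- by rewrite (_ : Ordinal i4 = ri true) //; apply: val_inj.
- by rewrite (_ : Ordinal i4 = vi true) //; apply: val_inj.
Qed.

Lemma whitham_rowE (gamma1 gamma2 alpha : R) (w : R -> 'cV[R]_4) (X : R) (j : bool) :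
  (whitham_mx gamma1 gamma2 alpha (w X) *m partialX w X) (ri j) 0 =
    - 2 * (w X (vi j) 0 * derive1 (component (ri j) w) X) - derive1 (component (vi j) w) X /\
  (whitham_mx gamma1 gamma2 alpha (w X) *m partialX w X) (vi j) 0 =
    2 * gamj gamma1 gamma2 j * expR (2 * w X (ri j) 0) * derive1 (component (ri j) w) X
    - 2 * w X (vi j) 0 * derive1 (component (vi j) w) X
    + 2 * alpha * expR (2 * w X (ri (~~ j)) 0) * derive1 (component (ri (~~ j)) w) X.
Proof.
rewrite !mxE !big_ord_recl !big_ord0 !mxE.
have -> : lift ord0 (lift ord0 (lift ord0 ord0)) = iv2 :> 'I_4 by apply: val_inj.
have -> : lift ord0 (lift ord0 ord0) = ir2 :> 'I_4 by apply: val_inj.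
have -> : lift ord0 ord0 = iv1 :> 'I_4 by apply: val_inj.
have -> : ord0 = ir1 :> 'I_4 by apply: val_inj.
by case: j => /=; split; ring.
Qed.

(** Profiles are chosen time by time from the Gevrey bound, then replaced by time-continuous
    versions. The Lipschitz bound holds at width [7 sigma / 4]; descending to [3 sigma / 2] leaves a
    gap [sigma / 4] for the majorant, whose built-in power [br ^+ 3] gives the control of three
    derivatives. *)
Lemma whitham_profiles (gamma1 gamma2 alpha T0 sigma : R) (ustar : R -> R -> 'cV[R]_4) (Cwh : R) :
  0 < T0 -> 0 < sigma -> 0 < Cwh ->
  whitham_solution gamma1 gamma2 alpha T0 ustar ->
  (gevrey_sup_norm 0 (2 * sigma) T0 ustar <= Cwh%:E)%E ->
  exists (A : R) (m : R -> R) (F : 'I_4 -> R -> R -> R), majorant A m /\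
  forall i, [/\ forall T, measurable_fun [set: R] (F i T),
    forall T x, `|F i T x| * br x ^+ 3 <= m x * wt (- (3 * sigma / 2)) x,
    forall x, continuous (fun T => F i T x) &
    forall T, T \in `[0, T0] -> component i (ustar T) = V (F i T)].
Proof.
move=> T00 s0 C0 sol bd.
have s20 : 0 < 2 * sigma by rewrite mulr_gt0.
have ex T : exists h : 'I_4 -> R -> R, T \in `[0, T0] -> forall i, [/\ component i (ustar T) = V (h i), intg (h i),
    sqi (fun x => h i x * wt (2 * sigma) x) & itg (fun x => (h i x * wt (2 * sigma) x) ^+ 2) <= Cwh ^+ 2].
  have [TI|_] := boolP (T \in `[0, T0]); last by exists (fun _ _ => 0).
  have [||h hh] := @gevrey_norm_hartley R 4 (2 * sigma) (ustar T) Cwh s20 (ltW C0).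
  - by move=> i X; apply: differentiable_continuous; apply/derivable1_diffP; exact: (sol T X TI i).1.
  - by apply: le_trans bd; apply: ereal_sup_ubound; exists T.
  - by exists h.
have [f hf] := choice ex.
have [G G0 stat] := @static_whitham R (gamj gamma1 gamma2) alpha sigma (Cwh ^+ 2) s0 (sqr_ge0 _).
have exg T : exists g : 'I_4 -> R -> R, T \in `[0, T0] -> forall i,
  [/\ intg (g i), forall X, `|V (g i) X| <= G,
     sqi (fun x => g i x * wt (7 * sigma / 4) x) & itg (fun x => (g i x * wt (7 * sigma / 4) x) ^+ 2) <= G ^+ 2] /\
  forall X, has_time_derivative T0 (fun S => V (f S i) X) T (V (g i) X).
  have [TI|_] := boolP (T \in `[0, T0]); last by exists (fun _ _ => 0).
  have [|gr [gv hg]] := stat (fun j => f T (ri j)) (fun j => f T (vi j)).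
    by move=> j; have [_ _ a1 a2] := hf T TI (ri j); have [_ _ a3 a4] := hf T TI (vi j).
  pose g (i : 'I_4) := if i == ir1 then gr false else if i == ir2 then gr true else
     if i == iv1 then gv false else gv true.
  have gri j : g (ri j) = gr j by case: j.
  have gvi j : g (vi j) = gv j by case: j.
  exists g => _; apply: index4 => j; rewrite gri gvi.
  have [[Er Ev] hgj] := hg j.
  have Ec i : component i (ustar T) = V (f T i) by have [] := hf T TI i.
  have Eci i X : ustar T X i 0 = V (f T i) X by rewrite -Ec.
  have dV i X : derivable (V (f T i)) X 1 by rewrite -Ec; exact: (sol T X TI i).1.
  split; (split; first by apply: hgj; auto) => X.
  - have [_] := sol T X TI (ri j); rewrite (whitham_rowE gamma1 gamma2 alpha (ustar T) X j).1 Er /whitham_r -!Ec.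
    by apply: htd_eq => // S SI; have [<-] := hf S SI (ri j).
  - have [_] := sol T X TI (vi j); rewrite (whitham_rowE gamma1 gamma2 alpha (ustar T) X j).2 Ev /whitham_v !Eci !Ec.
    (* [q = 0] is inserted in order to use [derive_flux]. *)
    have -> : (fun X => - V (f T (vi j)) X ^+ 2 + (gamj gamma1 gamma2 j * (expR (2 * V (f T (ri j)) X) - 1) +
        alpha * (expR (2 * V (f T (ri (~~ j))) X) - 1))) =
      (fun X => ((fun=> 0) X ^+ 2 - V (f T (vi j)) X ^+ 2) + (gamj gamma1 gamma2 j * (expR (2 * V (f T (ri j)) X) - 1) +
        alpha * (expR (2 * V (f T (ri (~~ j))) X) - 1))).
      by apply/funext => Y; rewrite expr0n sub0r.
    rewrite derive_flux//.
    rewrite mulr0 mul0r sub0r addrA [- _ + _]addrC.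
    by apply: htd_eq => // S SI; have [<-] := hf S SI (vi j).
have [g hg] := choice exg.
pose s1 := 7 * sigma / 4.
have s10 : 0 < s1 by rewrite /s1; lra.
have fs T i : T \in `[0, T0] -> sqi (fun x => f T i x * wt s1 x).
  move=> TI; have [_ fi fs _] := hf T TI i; apply: (sqi_le _ _ fs).
    by apply: measurable_funM; [exact: intg_meas|exact: measurable_wt].
  move=> x; rewrite !normrM ler_wpM2l// !gtr0_norm ?wt_gt0//; apply: wt_mono; rewrite /s1; lra.
have ch i : exists (F : R -> R -> R) (h : R -> R),
  [/\ forall x, 0 <= h x, sqi (fun x => h x * wt s1 x),
     forall T x, `|F T x| <= h x, forall x, continuous (fun T => F T x) &
     forall T, measurable_fun [set: R] (F T) /\ (T \in `[0, T0] -> V (F T) = V (f T i))].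
  apply: (@chaining R T0 s1 G (fun T => f T i)) => //.
  - by move=> T TI; have [] := hf T TI i.
  - by apply: fs; rewrite in_itv/= lexx ltW.
  - move=> S T SI TI.
    apply: (@profile_lipschitz R T0 s1 G (fun T => f T i) (fun T => g T i)) => //.
    + exact: ltW.
    + by move=> U UI; split; [have [] := hf U UI i|exact: fs].
    + by move=> U UI; exact: (hg U UI i).1.
    + by move=> U UI; exact: (hg U UI i).2.
  - move=> T TI X u uI uT; have := htd_cvg ((hg T TI i).2 X).
    move=> hc; apply: cvg_trans hc => B; rewrite /nbhs/= => hB.
    by have := uT _ hB; rewrite /nbhs/=; apply: filterS => n /= h; apply: h; exact: uI.
have [F hF] := choice ch.
have [h hh] := choice hF.
(* Summed over the components, so that a single majorant dominates all four. *)
pose H x := (\sum_i h i x) * wt (3 * sigma / 2) x.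
have H0 x : 0 <= H x.
  by rewrite mulr_ge0 ?(ltW (wt_gt0 _ _))// sumr_ge0// => i _; have [] := hh i.
have es : 3 * sigma / 2 + sigma / 4 = s1 by rewrite /s1; lra.
have Hs : sqi (fun x => H x * wt (sigma / 4) x).
  have : sqi (fun x => h ir1 x * wt s1 x + h iv1 x * wt s1 x + (h ir2 x * wt s1 x + h iv2 x * wt s1 x)).
    by apply: sqiD; apply: sqiD; [have [] := hh ir1|have [] := hh iv1|have [] := hh ir2|have [] := hh iv2].
  congr sqi; apply/funext => x; rewrite /H -mulrA -wtD es !big_ord_recl big_ord0 addr0.
  have -> : lift ord0 (lift ord0 (lift ord0 ord0)) = iv2 :> 'I_4 by apply: val_inj.
  have -> : lift ord0 (lift ord0 ord0) = ir2 :> 'I_4 by apply: val_inj.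
  have -> : lift ord0 ord0 = iv1 :> 'I_4 by apply: val_inj.
  have -> : ord0 = ir1 :> 'I_4 by apply: val_inj.
  ring.
have s40 : 0 < sigma / 4 by rewrite divr_gt0.
have [A HA] := @std_majorantP R (itg (fun x => (H x * wt (sigma / 4) x) ^+ 2)) _ s40.
have mH : measurable_fun [set: R] H.
  have -> : H = (fun x => (H x * wt (sigma / 4) x) * wt (- (sigma / 4)) x).
    by apply/funext => x; rewrite -mulrA -wtD subrr (wtE 0) mul0r expR0 mulr1.
  by apply: measurable_funM; [exact: Hs.1|exact: measurable_wt].
exists A, (std_majorant H), F; split; first exact: HA.
move=> i; have [h0 hs Fh Fc Fm] := hh i; split.
- by move=> T; have [] := Fm T.
- move=> T x; have w0 := wt_gt0 (3 * sigma / 2) x.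
  rewrite wtE mulNr expRN ler_pdivlMr ?expR_gt0// -wtE; apply: le_trans (std_majorant_ge x H0).
  rewrite mulrAC ler_wpM2r ?exprn_ge0 ?(ltW (br_gt0 _))// /H ler_wpM2r ?(ltW w0)//.
  apply: (le_trans (Fh T x)); rewrite (bigD1 i)//= lerDl sumr_ge0// => k _.
  by have [] := hh k.
- exact: Fc.
- by move=> T TI; have [Ec _ _ _] := hf T TI i; rewrite Ec (Fm T).2.
Qed.

End WhithamProfiles.

(** * Cauchy-Kovalevskaya iteration on a shrinking strip *)

Section Primitive.
Context {R : realType}.
Notation mu := (@lebesgue_measure R).

(** Starting at -1 makes 0 an interior time, so that the fundamental theorem applies at the left
    endpoint of [[0, Tm]] as well. *)
Definition primitive (f : R -> R) (T : R) : R := itg (cut (- 1) T f).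

Lemma primitive_derive (f : R -> R) (T : R) : continuous f -> -1 < T -> is_derive T 1 (primitive f) (f T).
Proof.
move=> cf T1.
have i : mu.-integrable `[- 1, T + 1] (EFin \o f).
  have := intg_cut (- 1) (T + 1) cf; rewrite cutE /intg -restrict_EFin => h.
  exact/(integrable_mkcond _ _).2.
have T2 : T < T + 1 by rewrite ltrDl.
have [d e] := continuous_FTC1_closed T2 i T1 (cf T).
have E : primitive f = fun y => \int[mu]_(t in `[- 1, y]) f t.
  by apply/funext => y; rewrite /primitive itg_setE.
by rewrite E -e derive1E; apply/derivableP.
Qed.

Lemma continuous_primitive (f : R -> R) (T : R) : continuous f -> -1 < T -> {for T, continuous (primitive f)}.
Proof.
move=> cf T1; apply: differentiable_continuous; apply/derivable1_diffP.
by have [] := primitive_derive cf T1.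
Qed.

(** From measurability in frequency and continuity in time: the integral is a limit of Riemann sums,
    which are finite combinations of measurable functions of [x]. *)
Lemma measurable_primitive (p q : R) (f : R -> R -> R) : (forall s, measurable_fun [set: R] (f s)) ->
  (forall x, continuous (f ^~ x)) -> measurable_fun [set: R] (fun x => itg (cut p q (f ^~ x))).
Proof.
move=> mf cf.
pose N (n : nat) := Num.truncn (n.+1%:R * (q - p)).
pose ind (n j : nat) (s : R) : R := ((j%:R <= n.+1%:R * (s - p)) && (n.+1%:R * (s - p) < j.+1%:R))%:R.
pose pt (n j : nat) : R := p + j%:R / n.+1%:R.
pose g (n : nat) (x s : R) := \sum_(j < (N n).+1) f (pt n j) x * cut p q (ind n j) s.
have mind n j : measurable_fun [set: R] (ind n j).
  apply: measurableT_comp => //; apply: measurable_and.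
    apply: measurable_fun_ler => //; apply: measurable_funM => //; exact: measurable_funB.
  apply: measurable_fun_ltr => //; apply: measurable_funM => //; exact: measurable_funB.
have ci n j : intg (cut p q (ind n j)).
  have := @intg_cut R p q (fun=> 1) (@cst_continuous _ _ _); apply: intg_le; first exact: measurable_cut.
  move=> s; rewrite /cut; case: ifP => _; last by rewrite normr0.
  by rewrite /ind; case: (_ && _); rewrite ?normr1 ?normr0.
have gE n x s : g n x s = if p <= s <= q then f (pt n (Num.truncn (n.+1%:R * (s - p)))) x else 0.
  rewrite /g /cut; case: ifP => [/andP[ps sq]|_]; last by rewrite big1// => j _; rewrite mulr0.
  set k := Num.truncn _.
  have y0 : 0 <= n.+1%:R * (s - p) by rewrite mulr_ge0// subr_ge0.
  have kN : (k < (N n).+1)%N.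
    by rewrite ltnS; apply: le_truncn; rewrite ler_pM2l// lerD2r.
  have kP j : ind n j s = (j == k)%:R.
    by rewrite /ind eq_sym /k truncn_eq.
  rewrite (bigD1 (Ordinal kN))//= kP eqxx mulr1 big1 ?addr0// => j jk.
  by rewrite kP (_ : (j : nat) == k = false) ?mulr0//; apply/negbTE; move: jk; apply: contra => /eqP jk; apply/eqP/val_inj.
have E n x : itg (g n x) = \sum_(j < (N n).+1) f (pt n j) x * itg (cut p q (ind n j)).
  rewrite /g itg_sum; last by move=> j; exact: intgZ.
  by apply: eq_bigr => j _; rewrite itgZ.
apply: (@measurable_fun_cvg _ _ _ _ (fun n x => itg (g n x))).
  move=> n; rewrite (_ : (fun x => itg (g n x)) = (fun x => \sum_(j < (N n).+1) f (pt n j) x * itg (cut p q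
    (ind n j)))); last by apply/funext => x; exact: E.
  by apply: measurable_sum => j; apply: measurable_funM.
move=> x _.
have [B B0 hB] := cut_bounded p q (cf x).
have [||||_ //] := @itg_dct R (fun n => g n x) (cut p q (f ^~ x)) (cut p q (fun=> B)).
- move=> n; rewrite /g; apply: measurable_sum => j; apply: measurable_funM => //; exact: intg_meas.
- move=> n s; rewrite gE /cut; case: ifP => [/andP[ps sq]|_]; last by rewrite normr0.
  set k := Num.truncn _.
  have y0 : 0 <= n.+1%:R * (s - p) by rewrite mulr_ge0// subr_ge0.
  have /andP[k1 _] := truncn_itv y0.
  have := hB (pt n k); rewrite /cut /pt lerDl divr_ge0//=.
  have -> : p + k%:R / n.+1%:R <= q.
    apply: le_trans sq; rewrite -lerBrDl ler_pdivrMr//; by rewrite mulrC.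
  by [].
- exact: (@intg_cut R p q (fun=> B) (@cst_continuous _ _ _)).
- move=> s; under eq_fun do rewrite gE.
  rewrite /cut; case: ifP => [/andP[ps sq]|_]; last exact: cvg_cst.
  apply: (@cvg_comp _ _ _ (fun n => pt n (Num.truncn (n.+1%:R * (s - p)))) (f ^~ x) _ (nbhs s)); last exact: cf.
  apply/cvgrPdist_le => e e0.
  have : n.+1%:R^-1 @[n --> \oo] --> (0 : R) by exact: cvg_harmonic.
  move/cvgrPdist_le => /(_ _ e0); apply: filterS => n.
  rewrite sub0r normrN ger0_norm ?invr_ge0//; apply: le_trans.
  have y0 : 0 <= n.+1%:R * (s - p) by rewrite mulr_ge0// subr_ge0.
  have /andP[k1 k2] := truncn_itv y0; set k := Num.truncn _ in k1 k2 *.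
  have -> : s - pt n k = (n.+1%:R * (s - p) - k%:R) / n.+1%:R.
    by rewrite /pt; field; rewrite addrC natr1 pnatr_eq0.
  rewrite normrM [`|_^-1|]ger0_norm ?invr_ge0// ler_piMl ?invr_ge0// ger0_norm ?subr_ge0//.
  by rewrite -natr1 in k2; lra.
Qed.

Definition primclip (Tm : R) (f : R -> R) (T : R) : R := primitive f (clip Tm T) - primitive f 0.

Lemma clip_gt (Tm T : R) : 0 <= Tm -> -1 < clip Tm T.
Proof. by move=> T0; have := clip_itv T T0; rewrite in_itv/= => /andP[h _]; lra. Qed.

Lemma continuous_primclip (Tm : R) (f : R -> R) : 0 <= Tm -> continuous f -> continuous (primclip Tm f).
Proof.
move=> Tm0 cf T; apply: cvgB; last exact: cvg_cst.
apply: (@continuous_comp _ _ _ (clip Tm) (primitive f)); first exact: continuous_clip.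
by apply: continuous_primitive => //; exact: clip_gt.
Qed.

Lemma primclip_htd (Tm : R) (f : R -> R) (T : R) : continuous f -> T \in `[0, Tm] ->
  has_time_derivative Tm (primclip Tm f) T (f T).
Proof.
move=> cf TI; have T1 : -1 < T by move: TI; rewrite in_itv/= => /andP[h _]; lra.
have h : has_time_derivative Tm (fun S => primitive f S + (- primitive f 0)) T (f T + 0).
  by apply: htdD; apply: is_derive_htd; exact: primitive_derive.
rewrite addr0 in h; apply: htd_eq h => // S SI.
by rewrite /primclip clip_id.
Qed.

Lemma primclip0 (Tm : R) (f : R -> R) : 0 <= Tm -> primclip Tm f 0 = 0.
Proof. by move=> Tm0; rewrite /primclip clip_id ?subrr// in_itv/= lexx. Qed.

Lemma primclip_sub (Tm : R) (f g : R -> R) (T : R) : continuous f -> continuous g ->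
  primclip Tm (fun s => f s - g s) T = primclip Tm f T - primclip Tm g T.
Proof.
move=> cf cg.
have E S : primitive (fun s => f s - g s) S = primitive f S - primitive g S.
  rewrite /primitive -itgB; [|exact: intg_cut|exact: intg_cut].
  by apply: eq_itg => x; rewrite /cut; case: ifP; rewrite ?subrr.
by rewrite /primclip !E; ring.
Qed.

Lemma measurable_primclip (Tm T : R) (f : R -> R -> R) : (forall s, measurable_fun [set: R] (f s)) ->
  (forall x, continuous (f ^~ x)) -> measurable_fun [set: R] (fun x => primclip Tm (f ^~ x) T).
Proof. by move=> mf cf; apply: measurable_funB; exact: measurable_primitive. Qed.

Lemma htd_ge (Tm : R) (f f' : R -> R) :
  (forall T, T \in `[0, Tm] -> has_time_derivative Tm f T (f' T) /\ 0 <= f' T) ->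
  forall S T, S \in `[0, Tm] -> T \in `[0, Tm] -> S <= T -> f S <= f T.
Proof.
move=> h S T; rewrite !in_itv/= => /andP[S0 S1] /andP[T0 T1] ST.
have [||c] := @MVT_segment R f f' S T ST.
- move=> x; rewrite in_itv/= => /andP[Sx xT].
  apply: (@htd_interior _ Tm); first by rewrite (le_lt_trans S0 Sx) (lt_le_trans xT T1).
  by apply: (h x _).1; rewrite in_itv/= (le_trans S0 (ltW Sx)) (le_trans (ltW xT) T1).
- apply: (@continuous_subspaceW _ _ _ `[0, Tm]).
    by move=> x /=; rewrite !in_itv/= => /andP[Sx xT]; rewrite (le_trans S0 Sx) (le_trans xT T1).
  by apply/subspace_continuousP => x xI; apply: htd_cvg (h x xI).1.
rewrite in_itv/= => /andP[Sc cT] E.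
rewrite -subr_ge0 E mulr_ge0 ?subr_ge0//.
by apply: (h c _).2; rewrite in_itv/= (le_trans S0 Sc) (le_trans cT T1).
Qed.

Lemma primclip_clip (Tm : R) (f : R -> R) (T : R) : 0 <= Tm -> primclip Tm f T = primclip Tm f (clip Tm T).
Proof. by move=> Tm0; rewrite /primclip (clip_id (clip_itv T Tm0)). Qed.

(** Both [g + primclip Tm f] and [g - primclip Tm f] are nondecreasing on [[0, Tm]]. *)
Lemma primclip_le (Tm : R) (f g g' : R -> R) (T : R) : 0 <= Tm -> continuous f ->
  (forall T, T \in `[0, Tm] -> has_time_derivative Tm g T (g' T) /\ `|f T| <= g' T) ->
  `|primclip Tm f T| <= g (clip Tm T) - g 0.
Proof.
move=> Tm0 cf h; have cI := clip_itv T Tm0; rewrite (primclip_clip f T Tm0).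
have c0 : 0 <= clip Tm T by move: cI; rewrite in_itv/= => /andP[].
have I0 : 0 \in `[0, Tm] by rewrite in_itv/= lexx.
have h1 : g 0 + primclip Tm f 0 <= g (clip Tm T) + primclip Tm f (clip Tm T).
  apply: (@htd_ge Tm (fun S => g S + primclip Tm f S) (fun S => g' S + f S)) => // S SI.
  have [hg] := h S SI; rewrite ler_norml => /andP[l1 l2].
  by split; [apply: htdD => //; exact: primclip_htd|lra].
have h2 : g 0 + (- 1) * primclip Tm f 0 <= g (clip Tm T) + (- 1) * primclip Tm f (clip Tm T).
  apply: (@htd_ge Tm (fun S => g S + (- 1) * primclip Tm f S) (fun S => g' S + (- 1) * f S)) => // S SI.
  have [hg] := h S SI; rewrite ler_norml => /andP[l1 l2].
  by split; [apply: htdD => //; apply: htdZ; exact: primclip_htd|lra].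
rewrite primclip0// in h1 h2; rewrite ler_norml; apply/andP; split; lra.
Qed.

End Primitive.

Section Sequential.
Context {R : realType}.

Lemma cvg_seq_at (f : R -> R) (T : R) :
  (forall u : nat -> R, u n @[n --> \oo] --> T -> f (u n) @[n --> \oo] --> f T) ->
  f x @[x --> T] --> f T.
Proof.
move=> h.
have : f x @[x --> T^'] --> f T by apply/cvgr_dnbhsP => u [_ uT]; exact: h.
move=> /cvgrPdist_le hd; apply/cvgrPdist_le => e e0.
have [r r0 rI] := hd e e0; exists r => // x xr.
by have [->|xT] := eqVneq x T; [rewrite subrr normr0 ltW|exact: rI].
Qed.

Lemma cvg_at_seq (f : R -> R) (T : R) (u : nat -> R) : {for T, continuous f} ->
  u n @[n --> \oo] --> T -> f (u n) @[n --> \oo] --> f T.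
Proof. by move=> cf uT; apply: (cvg_comp u f uT); exact: cf. Qed.

End Sequential.

(** * Profiles bounded in a shrinking strip *)

Section Families.
Context {R : realType}.
Variables (A : R) (m : R -> R).
Hypothesis M : majorant A m.
Notation bnd := (bnd m).
Notation bnd1 := (bnd1 m).

(* the analyticity strip shrinks at speed [kappa] on [[0, Tm]] *)
Variables (rho kappa Tm s0 : R).
Hypotheses (Tm0 : 0 <= Tm) (kappa0 : 0 < kappa) (s00 : 0 < s0) (s0_le : s0 + kappa * Tm <= rho).

Definition strip (T : R) := rho - kappa * clip Tm T.

Lemma strip_ge (T : R) : s0 <= strip T.
Proof.
have := clip_itv T Tm0; rewrite in_itv/= => /andP[c0 c1]; rewrite /strip.
by rewrite lerBrDr (le_trans _ s0_le)// lerD2l ler_pM2l.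
Qed.

Lemma strip_le (T : R) : strip T <= rho.
Proof.
have := clip_itv T Tm0; rewrite in_itv/= => /andP[c0 c1]; rewrite /strip.
by rewrite lerBlDr lerDl mulr_ge0// ltW.
Qed.

Lemma strip_gt0 (T : R) : 0 < strip T. Proof. exact: lt_le_trans (strip_ge T). Qed.

(** Each time has its own width, with a constant uniform in time. Continuity is required frequency
    by frequency, which is all that scalar time integrals and dominated convergence use. *)
Definition fam (C : R) (f : R -> R -> R) :=
  (forall T, bnd (strip T) C (f T)) /\ forall x, continuous (fun T => f T x).

Definition fam1 (C : R) (f : R -> R -> R) :=
  (forall T, bnd1 (strip T) C (f T)) /\ forall x, continuous (fun T => f T x).

Lemma fam_mono (C C' : R) (f : R -> R -> R) : C <= C' -> fam C f -> fam C' f.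
Proof. by move=> CC [fb fc]; split => // T; apply: (bnd_mono M CC). Qed.

Lemma famB (C C' : R) (f g : R -> R -> R) : fam C f -> fam C' g -> fam (C + C') (fun T x => f T x - g T x).
Proof.
by move=> [fb fc] [gb gc]; split => [T|x T]; [exact: bndB|apply: cvgB; [exact: fc|exact: gc]].
Qed.

Lemma famD (C C' : R) (f g : R -> R -> R) : fam C f -> fam C' g -> fam (C + C') (fun T x => f T x + g T x).
Proof.
by move=> [fb fc] [gb gc]; split => [T|x T]; [exact: bndD|apply: cvgD; [exact: fc|exact: gc]].
Qed.

Lemma fam1B (C C' : R) (f g : R -> R -> R) : fam1 C f -> fam1 C' g -> fam1 (C + C') (fun T x => f T x - g T x).
Proof.
by move=> [fb fc] [gb gc]; split => [T|x T]; [exact: bnd1B|apply: cvgB; [exact: fc|exact: gc]].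
Qed.

Lemma fam1D (C C' : R) (f g : R -> R -> R) : fam1 C f -> fam1 C' g -> fam1 (C + C') (fun T x => f T x + g T x).
Proof.
by move=> [fb fc] [gb gc]; split => [T|x T]; [exact: bnd1D|apply: cvgD; [exact: fc|exact: gc]].
Qed.

Lemma fam_D (C : R) (f : R -> R -> R) : 0 <= C -> fam C f -> fam1 C (fun T => D (f T)).
Proof.
move=> C0 [fb fc]; split => [T|x T]; first exact: (bnd_D M _ (fb T)).
by apply: cvgMl_tmp; exact: fc.
Qed.

Lemma fam_mul (C : R) (f : R -> R -> R) (c : R -> R -> R) : fam C f -> (forall T, measurable_fun [set: R] (c T)) ->
  (forall x, continuous (fun T => c T x)) -> (forall T x, `|c T x| <= 1) -> fam C (fun T x => c T x * f T x).
Proof.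
move=> [fb fc] mc cc c1; split => [T|x T]; last by apply: cvgM; [exact: cc|exact: fc].
have [mf hf] := fb T; split; first exact: measurable_funM.
by move=> x; rewrite normrM (le_trans (ler_piMl _ (c1 T x))).
Qed.

Lemma fam1_mul (C : R) (f : R -> R -> R) (c : R -> R -> R) : fam1 C f -> (forall T, measurable_fun [set: R] (c T)) ->
  (forall x, continuous (fun T => c T x)) -> (forall T x, `|c T x| <= 1) -> fam1 C (fun T x => c T x * f T x).
Proof.
move=> [fb fc] mc cc c1; split => [T|x T]; last by apply: cvgM; [exact: cc|exact: fc].
have [mf hf] := fb T; split; first exact: measurable_funM.
by move=> x; rewrite normrM (le_trans (ler_piMl _ (c1 T x))).
Qed.

(** The time derivative of [exp (- (rho - kappa T) br)] is [kappa br] times itself. Integrating a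
    bound that carries the extra [br] thus returns the weight of the final time divided by
    [kappa]. *)
Lemma fam_primclip (C : R) (f : R -> R -> R) : 0 <= C -> fam1 C f -> fam (C / kappa) (fun T x => primclip Tm (f ^~ x) T).
Proof.
move=> C0 [fb fc]; split; last by move=> x; apply: continuous_primclip.
move=> T; split; first by apply: measurable_primclip => // s; exact: (fb s).1.
move=> x; have cI := clip_itv T Tm0.
pose g S := C / kappa * (m x * expR (kappa * br x * S - rho * br x)).
have dg (S : R) : is_derive S 1 g (C * (br x * (m x * expR (kappa * br x * S - rho * br x)))).
  have h : is_derive S 1 (fun S => kappa * br x * S - rho * br x) (kappa * br x).
    by apply: is_derive_eq; rewrite /GRing.scale/=; ring.
  have h2 := @is_derive1_comp _ expR _ S _ _ (is_derive_expR _) h.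
  have -> : g = (fun S => C / kappa * m x * (expR \o (fun S => kappa * br x * S - rho * br x)) S).
    by apply/funext => S'; rewrite /g mulrA.
  apply: is_derive_eq; rewrite /GRing.scale/=; field; exact: lt0r_neq0.
have wE S : S \in `[0, Tm] -> wt (- strip S) x = expR (kappa * br x * S - rho * br x).
  by move=> SI; rewrite wtE /strip (clip_id SI); congr expR; ring.
pose g' S := C * (br x * (m x * expR (kappa * br x * S - rho * br x))).
have hg S : S \in `[0, Tm] -> has_time_derivative Tm g S (g' S) /\ `|f S x| <= g' S.
  move=> SI; split; first exact: is_derive_htd (dg S).
  by have [_ h] := fb S; apply: (le_trans (h x)); rewrite wE.
have h := @primclip_le R Tm (f ^~ x) g g' T Tm0 (fc x) hg.
apply: (le_trans h); rewrite /g wtE /strip.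
rewrite (_ : - (rho - kappa * clip Tm T) * br x = kappa * br x * clip Tm T - rho * br x); last by ring.
by rewrite lerBlDr lerDl mulr_ge0 ?divr_ge0 ?(ltW kappa0)// mulr_ge0 ?(maj_ge0 M)// ltW// expR_gt0.
Qed.

Lemma fam_cst_bnd (C : R) (f : R -> R -> R) : 0 <= C -> fam C f -> forall T, bnd 0 C (f T).
Proof. by move=> C0 [fb _] T; apply: (bnd_wmono M _ C0 (fb T)); exact: ltW (strip_gt0 T). Qed.

Lemma fam1_cst_bnd (C : R) (f : R -> R -> R) : 0 <= C -> fam1 C f -> forall T, bnd 0 (C * s0^-1) (f T).
Proof.
move=> C0 [fb _] T; have [mf hf] := bnd1_bnd0 M (strip_gt0 T) C0 (fb T).
apply: (bnd_mono M) (conj mf hf); rewrite ler_wpM2l// lef_pV2 ?posrE ?strip_gt0//.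
exact: strip_ge.
Qed.

(** Dominated convergence along sequences of times needs bounds that do not move with time, hence
    the width 0. *)
Lemma star_continuous (C C' : R) (f g : R -> R -> R) : 0 <= C -> 0 <= C' -> (forall T,
  bnd 0 C (f T)) -> (forall T, bnd 0 C' (g T)) ->
  (forall x, continuous (fun T => f T x)) -> (forall x, continuous (fun T => g T x)) ->
  forall x, continuous (fun T => star (f T) (g T) x).
Proof.
move=> C0 C'0 fb gb fc gc x T; apply: cvg_seq_at => u uT.
apply: (star_cvg (maj_convable M) (maj_even M) (B := C * C')).
- by move=> n; exact: (fb _).1.
- by move=> n; exact: (gb _).1.
- move=> n a b; rewrite normrM.
  have h1 := (fb (u n)).2 a; have h2 := (gb (u n)).2 b.
  rewrite oppr0 !wtE !mul0r expR0 !mulr1 in h1 h2.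
  by rewrite -mulrACA; exact: ler_pM.
- by move=> y; exact: cvg_at_seq (fc y T) uT.
- by move=> y; exact: cvg_at_seq (gc y T) uT.
Qed.

Lemma exp_profile_continuous (C : R) (f : R -> R -> R) : 0 <= C -> fam C f -> forall x,
  continuous (fun T => exp_profile (f T) x).
Proof.
move=> C0 fb x T; apply: cvg_seq_at => u uT.
apply: (exp_profile_seq_cvg M (lexx 0) C0) => [n|y]; first exact: fam_cst_bnd fb (u n).
exact: cvg_at_seq (fb.2 y T) uT.
Qed.

Variables (gam : bool -> R) (alpha : R).

Definition stfam (C : R) (z : R -> state) := forall j,
  [/\ fam C (fun T => sr (z T) j), fam C (fun T => sq (z T) j) & fam C (fun T => sv (z T) j)].

Lemma stfam_stbnd (C : R) (z : R -> state) (T : R) : stfam C z -> stbnd m (strip T) C (z T).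
Proof. by move=> h j; have [[a _] [b _] [c _]] := h j. Qed.

Lemma stfam_mono (C C' : R) (z : R -> state) : C <= C' -> stfam C z -> stfam C' z.
Proof. by move=> CC h j; have [a b c] := h j; split; exact: fam_mono CC _. Qed.

Lemma stfamD (C C' : R) (z w : R -> state) : stfam C z -> stfam C' w -> stfam (C + C') (fun T => add_state (z T) (w T)).
Proof. by move=> zf wf j; have [a b c] := zf j; have [a' b' c'] := wf j; split; exact: famD. Qed.

Lemma stfamB (C C' : R) (z w : R -> state) : stfam C z -> stfam C' w -> stfam (C + C') (fun T => sub_state (z T) (w T)).
Proof. by move=> zf wf j; have [a b c] := zf j; have [a' b' c'] := wf j; split; exact: famB. Qed.

Lemma N_continuous (C : R) (z : R -> state) j (x : R) : 0 <= C -> stfam C z ->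
  [/\ continuous (fun T => N1 (z T) j x), continuous (fun T => Nq (z T) j x) &
      continuous (fun T => N2 gam alpha (z T) j x)].
Proof.
move=> C0 zf; have [rf qf vf] := zf j; have [rf' _ _] := zf (~~ j).
have si : 0 <= s0^-1 by rewrite invr_ge0 ltW.
have Cs : 0 <= C * s0^-1 by rewrite mulr_ge0.
have Df := fam_D C0 rf.
have c1 y : continuous (fun T => star (sv (z T) j) (D (sr (z T) j)) y).
  exact: star_continuous (fam_cst_bnd C0 vf) (fam1_cst_bnd C0 Df) vf.2 Df.2 y.
have c2 y : continuous (fun T => star (sv (z T) j) (sq (z T) j) y).
  exact: star_continuous (fam_cst_bnd C0 vf) (fam_cst_bnd C0 qf) vf.2 qf.2 y.
have c3 y : continuous (fun T => star (sv (z T) j) (sv (z T) j) y).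
  exact: star_continuous (fam_cst_bnd C0 vf) (fam_cst_bnd C0 vf) vf.2 vf.2 y.
have c4 y : continuous (fun T => star (sq (z T) j) (sq (z T) j) y).
  exact: star_continuous (fam_cst_bnd C0 qf) (fam_cst_bnd C0 qf) qf.2 qf.2 y.
have c5 y := exp_profile_continuous C0 rf y; have c6 y := exp_profile_continuous C0 rf' y.
split => T.
- by apply: cvgMl_tmp; exact: c1.
- by apply: cvgMl_tmp; apply: cvgMl_tmp; exact: c2.
- apply: cvgMl_tmp; apply: cvgD; first by apply: cvgB; [exact: c4|exact: c3].
  by apply: cvgD; apply: cvgMl_tmp; [exact: c5|exact: c6].
Qed.

Lemma stfam_N_lip (C d : R) (z w : R -> state) : 0 <= C -> 0 <= d -> stfam C z -> stfam C w ->
  stfam d (fun T => sub_state (z T) (w T)) -> forall j,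
  [/\ fam1 (lip_cst gam alpha A s0 C * d) (fun T x => N1 (z T) j x - N1 (w T) j x),
      fam1 (lip_cst gam alpha A s0 C * d) (fun T x => Nq (z T) j x - Nq (w T) j x) &
      fam1 (lip_cst gam alpha A s0 C * d) (fun T x => N2 gam alpha (z T) j x - N2 gam alpha (w T) j x)].
Proof.
move=> C0 d0 zf wf df j.
have lip T := N_lip gam alpha M j s00 (strip_ge T) C0 d0 (stfam_stbnd T zf) (stfam_stbnd T wf) (stfam_stbnd T df).
have cz x := N_continuous j x C0 zf; have cw x := N_continuous j x C0 wf.
split; split => [T|x T].
- by have [] := lip T.
- by have [c1 _ _] := cz x; have [c2 _ _] := cw x; apply: cvgB; [exact: c1|exact: c2].
- by have [] := lip T.
- by have [_ c1 _] := cz x; have [_ c2 _] := cw x; apply: cvgB; [exact: c1|exact: c2].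
- by have [] := lip T.
- by have [_ _ c1] := cz x; have [_ _ c2] := cw x; apply: cvgB; [exact: c1|exact: c2].
Qed.

End Families.

(** * Exact solution of the dispersive rotation *)

Section Rotation.
Context {R : realType}.

Lemma htdM (Tm : R) (f g : R -> R) (T l k : R) : has_time_derivative Tm f T l -> has_time_derivative Tm g T k ->
  has_time_derivative Tm (fun S => f S * g S) T (l * g T + f T * k).
Proof.
move=> hf hg; have gc := htd_cvg hg.
move/htdP : hf => hf; move/htdP : hg => hg; apply/htdP => u uI uT.
have gu : g (u n) @[n --> \oo] --> g T.
  apply: cvg_trans gc => B; rewrite /nbhs/= => hB.
  by have := uT _ hB; rewrite /nbhs/=; apply: filterS => n /= h; apply: h; have [] := uI n.
have E n : (u n - T)^-1 * (f (u n) * g (u n) - f T * g T) =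
  ((u n - T)^-1 * (f (u n) - f T)) * g (u n) + f T * ((u n - T)^-1 * (g (u n) - g T)).
  by ring.
rewrite (eq_cvg _ _ E); apply: cvgD; first by apply: cvgM => //; exact: hf.
by apply: cvgMl_tmp; exact: hg.
Qed.

Lemma htd_cst0 (Tm : R) (f : R -> R) : 0 <= Tm -> f 0 = 0 ->
  (forall T, T \in `[0, Tm] -> has_time_derivative Tm f T 0) ->
  forall T, T \in `[0, Tm] -> f T = 0.
Proof.
move=> Tm0 f0 h T TI.
have := @htd_lip R Tm f (fun=> 0) 0 _ T 0 TI; rewrite f0 subr0 mul0r in_itv/= lexx Tm0.
by move=> /(_ _ isT)hh; apply/eqP; rewrite -normr_le0 hh// => S SI; rewrite normr0; split => //; exact: h.
Qed.

Variables (A : R) (m : R -> R).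
Hypothesis M : majorant A m.
Variables (rho kappa Tm s0 : R).
Hypotheses (Tm0 : 0 <= Tm) (kappa0 : 0 < kappa) (s00 : 0 < s0) (s0_le : s0 + kappa * Tm <= rho).
Notation fam := (fam m rho kappa Tm).
Notation fam1 := (fam1 m rho kappa Tm).
Notation stfam := (stfam m rho kappa Tm).

Variable eps : R.

Definition rotc (T x : R) : R := cos (eps * x ^+ 2 * clip Tm T).
Definition rots (T x : R) : R := sin (eps * x ^+ 2 * clip Tm T).

Let mphase (T : R) : measurable_fun [set: R] (fun x : R => eps * x ^+ 2 * clip Tm T).
Proof. by apply: measurable_funM => //; apply: measurable_funM => //; exact: measurable_funX. Qed.

Let cphase (x : R) : continuous (fun T => eps * x ^+ 2 * clip Tm T).
Proof. by move=> T; apply: cvgMl_tmp; exact: continuous_clip. Qed.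

Lemma measurable_rotc T : measurable_fun [set: R] (rotc T).
Proof. exact: (measurableT_comp (continuous_measurable_fun (@continuous_cos R)) (mphase T)). Qed.

Lemma measurable_rots T : measurable_fun [set: R] (rots T).
Proof. exact: (measurableT_comp (continuous_measurable_fun (@continuous_sin R)) (mphase T)). Qed.

Lemma continuous_rotc (x : R) : continuous (fun T => rotc T x).
Proof.
move=> T; apply: (@continuous_comp _ _ _ (fun T => eps * x ^+ 2 * clip Tm T) cos); first exact: cphase.
exact: continuous_cos.
Qed.

Lemma continuous_rots (x : R) : continuous (fun T => rots T x).
Proof.
move=> T; apply: (@continuous_comp _ _ _ (fun T => eps * x ^+ 2 * clip Tm T) sin); first exact: cphase.
exact: continuous_sin.
Qed.

Lemma rotc_le1 T x : `|rotc T x| <= 1. Proof. by rewrite ler_norml cos_le1 cos_geN1. Qed.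
Lemma rots_le1 T x : `|rots T x| <= 1. Proof. by rewrite ler_norml sin_le1 sin_geN1. Qed.

Lemma rotc_htd (T x : R) : T \in `[0, Tm] ->
  has_time_derivative Tm (fun S => rotc S x) T (- (eps * x ^+ 2) * rots T x).
Proof.
move=> TI; apply: (@htd_eq _ _ (fun S => cos (eps * x ^+ 2 * S))) => //.
  by move=> S SI; rewrite /rotc clip_id.
apply: is_derive_htd; rewrite /rots clip_id//.
by apply: is_derive_eq; rewrite /GRing.scale/=; ring.
Qed.

Lemma rots_htd (T x : R) : T \in `[0, Tm] ->
  has_time_derivative Tm (fun S => rots S x) T (eps * x ^+ 2 * rotc T x).
Proof.
move=> TI; apply: (@htd_eq _ _ (fun S => sin (eps * x ^+ 2 * S))) => //.
  by move=> S SI; rewrite /rots clip_id.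
apply: is_derive_htd; rewrite /rotc clip_id//.
by apply: is_derive_eq; rewrite /GRing.scale/=; ring.
Qed.

(** The sources are rotated back to time 0 before integration; [solq] and [solv] then rotate the
    result to time [T]. *)
Definition duhamel_c (a b : R -> R -> R) (T x : R) : R := primclip Tm (fun s => rotc s x * a s x - rots s x * b s x) T.
Definition duhamel_s (a b : R -> R -> R) (T x : R) : R := primclip Tm (fun s => rots s x * a s x + rotc s x * b s x) T.

(* Duhamel's formula for [q_T = eps x^2 v + a], [v_T = - eps x^2 q + b] with zero initial data *)
Definition solq (a b : R -> R -> R) (T x : R) : R := rotc T x * duhamel_c a b T x + rots T x * duhamel_s a b T x.
Definition solv (a b : R -> R -> R) (T x : R) : R := rotc T x * duhamel_s a b T x - rots T x * duhamel_c a b T x.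

(** The entries of the rotation are bounded by 1 whatever [eps] and the frequency, so the
    second-order terms cost no derivative. The 2 counts the two entries of a row. *)
Lemma sol_fam (C C' : R) a b : 0 <= C -> 0 <= C' -> fam1 C a -> fam1 C' b ->
  fam (2 * (C + C') / kappa) (solq a b) /\ fam (2 * (C + C') / kappa) (solv a b).
Proof.
move=> C0 C'0 fa fb; have CC : 0 <= C + C' by rewrite addr_ge0.
have mulc B f : fam1 B f -> fam1 B (fun T x => rotc T x * f T x).
  by move=> ff; apply: fam1_mul ff _ _ _; [exact: measurable_rotc|exact: continuous_rotc|exact: rotc_le1].
have muls B f : fam1 B f -> fam1 B (fun T x => rots T x * f T x).
  by move=> ff; apply: fam1_mul ff _ _ _; [exact: measurable_rots|exact: continuous_rots|exact: rots_le1].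
have mulc' B f : fam B f -> fam B (fun T x => rotc T x * f T x).
  by move=> ff; apply: fam_mul ff _ _ _; [exact: measurable_rotc|exact: continuous_rotc|exact: rotc_le1].
have muls' B f : fam B f -> fam B (fun T x => rots T x * f T x).
  by move=> ff; apply: fam_mul ff _ _ _; [exact: measurable_rots|exact: continuous_rots|exact: rots_le1].
have f1 : fam ((C + C') / kappa) (duhamel_c a b).
  by apply: (fam_primclip M Tm0 kappa0 CC); apply: fam1B; [exact: mulc|exact: muls].
have f2 : fam ((C + C') / kappa) (duhamel_s a b).
  by apply: (fam_primclip M Tm0 kappa0 CC); apply: fam1D; [exact: muls|exact: mulc].
have -> : 2 * (C + C') / kappa = (C + C') / kappa + (C + C') / kappa by ring.
by split; [apply: famD|apply: famB]; [exact: mulc'|exact: muls'|exact: mulc'|exact: muls'].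
Qed.

Section OneFrequency.
Variables (a b : R -> R -> R).
Hypotheses (ca : forall x, continuous (fun T => a T x)) (cb : forall x, continuous (fun T => b T x)).

Let c1 (x : R) : continuous (fun s => rotc s x * a s x - rots s x * b s x).
Proof.
by move=> T; apply: cvgB; apply: cvgM; [exact: continuous_rotc|exact: ca|exact: continuous_rots|exact: cb].
Qed.

Let c2 (x : R) : continuous (fun s => rots s x * a s x + rotc s x * b s x).
Proof.
by move=> T; apply: cvgD; apply: cvgM; [exact: continuous_rots|exact: ca|exact: continuous_rotc|exact: cb].
Qed.

Lemma sol_htd (T x : R) : T \in `[0, Tm] ->
  has_time_derivative Tm (fun S => solq a b S x) T (eps * x ^+ 2 * solv a b T x + a T x) /\
  has_time_derivative Tm (fun S => solv a b S x) T (- (eps * x ^+ 2) * solq a b T x + b T x).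
Proof.
move=> TI.
have hc := rotc_htd (x := x) TI; have hs := rots_htd (x := x) TI.
have h1 := primclip_htd (@c1 x) TI; have h2 := primclip_htd (@c2 x) TI.
have cs : rotc T x ^+ 2 + rots T x ^+ 2 = 1 by exact: cos2Dsin2.
split.
- have -> : eps * x ^+ 2 * solv a b T x + a T x = eps * x ^+ 2 * solv a b T x + (rotc T x ^+ 2 + rots T x ^+ 2) * a T x.
    by rewrite cs mul1r.
  have := htdD (htdM hc h1) (htdM hs h2); congr has_time_derivative.
  by rewrite /solv /duhamel_c /duhamel_s; ring.
- have -> : - (eps * x ^+ 2) * solq a b T x + b T x = - (eps * x ^+ 2) * solq a b T x + (rotc T x ^+ 2 + rots T
    x ^+ 2) * b T x.
    by rewrite cs mul1r.
  have := htdD (htdM hc h2) (htdZ (c := - 1) (htdM hs h1)); rewrite /solv.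
  under [X in has_time_derivative _ X]eq_fun do rewrite mulN1r.
  congr has_time_derivative; by rewrite /solq /duhamel_c /duhamel_s; ring.
Qed.

Lemma sol0 (x : R) : solq a b 0 x = 0 /\ solv a b 0 x = 0.
Proof. by rewrite /solq /solv /duhamel_c /duhamel_s !primclip0// !mulr0 addr0 subr0. Qed.

Lemma sol_clip (T x : R) : solq a b T x = solq a b (clip Tm T) x.
Proof.
by rewrite /solq /duhamel_c /duhamel_s /rotc /rots -!(primclip_clip _ _ Tm0) (clip_id (clip_itv T Tm0)).
Qed.

Variables (a' b' : R -> R -> R).
Hypotheses (ca' : forall x, continuous (fun T => a' T x)) (cb' : forall x, continuous (fun T => b' T x)).

Let c1' (x : R) : continuous (fun s => rotc s x * a' s x - rots s x * b' s x).
Proof.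
by move=> T; apply: cvgB; apply: cvgM; [exact: continuous_rotc|exact: ca'|exact: continuous_rots|exact: cb'].
Qed.

Let c2' (x : R) : continuous (fun s => rots s x * a' s x + rotc s x * b' s x).
Proof.
by move=> T; apply: cvgD; apply: cvgM; [exact: continuous_rots|exact: ca'|exact: continuous_rotc|exact: cb'].
Qed.

Lemma sol_sub (T x : R) :
  solq (fun T x => a T x - a' T x) (fun T x => b T x - b' T x) T x = solq a b T x - solq a' b' T x /\
  solv (fun T x => a T x - a' T x) (fun T x => b T x - b' T x) T x = solv a b T x - solv a' b' T x.
Proof.
have E1 : duhamel_c (fun T x => a T x - a' T x) (fun T x => b T x - b' T x) T x = duhamel_c a b T x - duhamel_c a' b' T x.
  by rewrite /duhamel_c -primclip_sub//; congr (primclip _ _ _); apply/funext => s; ring.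
have E2 : duhamel_s (fun T x => a T x - a' T x) (fun T x => b T x - b' T x) T x = duhamel_s a b T x - duhamel_s a' b' T x.
  by rewrite /duhamel_s -primclip_sub//; congr (primclip _ _ _); apply/funext => s; ring.
by rewrite /solq /solv E1 E2; split; ring.
Qed.

End OneFrequency.

End Rotation.

Section StarScale.
Context {R : realType}.

Lemma star_scaler (c : R) (f g : R -> R) : convable f g -> convable f (flip g) ->
  forall x, star f (fun y => c * g y) x = c * star f g x.
Proof.
move=> h1 h2 x.
have E (g' : R -> R) y : convable f g' -> conv f (fun y => c * g' y) y = c * conv f g' y.
  by move=> h; rewrite /conv -itgZ//; apply: eq_itg => z; rewrite mulrCA.
rewrite /star; have -> : flip (fun y => c * g y) = (fun y => c * flip g y) by [].
by rewrite !E//; ring.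
Qed.

(** The [q] equation is [eps] times the derivative of the [r] equation; this is the nonlinear part
    of that compatibility, used to propagate [q = eps r_X]. *)
Lemma Nq_N1 (A : R) m (s C eps : R) (z : @state R) j : majorant A m -> 0 < s -> 0 <= C -> stbnd m s C z ->
  sq z j = (fun x => eps * D (sr z j) x) ->
  forall x, Nq z j x = eps * D (N1 z j) x.
Proof.
move=> M s0 C0 zb qE x; have [rb _ vb] := zb j.
have [v1 v2 _] := star_bnd1 M s0 (lexx s) C0 C0 vb (bnd_D M C0 rb).
by rewrite /Nq qE /D -/(D (sr z j)) star_scaler// /N1; ring.
Qed.

(** One index type for the three kinds of unknowns, so that limits of states are taken in a single
    argument. *)
Definition state_comp (k : option bool) (z : @state R) : bool -> R -> R :=
  match k with None => sr z | Some false => sq z | Some true => sv z end.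

Definition mk_state (f : option bool -> bool -> R -> R) : state :=
  State (f None) (f (Some false)) (f (Some true)).

Lemma state_comp_mk f k : state_comp k (mk_state f) = f k.
Proof. by case: k => [[]|]. Qed.

End StarScale.

(** * The fixed point of the Duhamel map *)

Section Picard.
Context {R : realType}.
Variables (A : R) (m : R -> R).
Hypothesis M : majorant A m.
Variables (rho kappa Tm s0 : R).
Hypotheses (Tm0 : 0 <= Tm) (kappa0 : 0 < kappa) (s00 : 0 < s0) (s0_le : s0 + kappa * Tm <= rho).
Notation fam := (fam m rho kappa Tm).
Notation fam1 := (fam1 m rho kappa Tm).
Notation stfam := (stfam m rho kappa Tm).
Notation strip := (strip rho kappa Tm).

Variables (gam : bool -> R) (alpha : R).
(** The 2 bounds the whole state: 1 for the Whitham part and 1 for the perturbation. The speed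
    [kappa] is then taken so large that the Duhamel map preserves a ball and halves distances. *)
Let K := lip_cst gam alpha A s0 2.
Hypothesis kappaK : 8 * (K + 1) <= kappa.

Variable eps : R.
Hypotheses (eps0 : 0 < eps) (eps1 : eps <= 1).
Notation solq := (solq Tm eps).
Notation solv := (solv Tm eps).

Variables (Fr Fv : bool -> R -> R -> R).
Hypothesis hF : forall j F, F = Fr j \/ F = Fv j ->
  [/\ forall T, measurable_fun [set: R] (F T),
      forall T x, `|F T x| * br x ^+ 3 <= m x * wt (- rho) x &
      forall x, continuous (fun T => F T x)].

(** Size of the source, and radius of the ball for the perturbation: [eps ^+ 2] from the dispersive
    term of [q*] and [2 A eps ^+ 2] from its square, since [q*] has size [eps]. *)
Let d0 := (1 + 2 * A) * eps ^+ 2.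
Hypothesis d0_le1 : d0 <= 1.

Let A0 : 0 <= A := maj_A M.
Let d00 : 0 <= d0. Proof. by rewrite mulr_ge0 ?sqr_ge0// addr_ge0// mulr_ge0. Qed.
Let K0 : 0 <= K. Proof. by apply: (lip_cst_ge0 gam alpha M). Qed.

Definition zbase (T : R) : state :=
  State (fun j => Fr j T) (fun j x => eps * D (Fr j T) x) (fun j => Fv j T).

Let wt_strip T x : wt (- rho) x <= wt (- strip T) x.
Proof. by apply: wt_mono; rewrite lerN2; exact: strip_le. Qed.

Let F_le j F k T x : F = Fr j \/ F = Fv j -> (k <= 3)%N ->
  `|F T x| * br x ^+ k <= m x * wt (- strip T) x.
Proof.
move=> /hF[_ h _] k3; apply: (@le_trans _ _ (m x * wt (- rho) x)).
  by apply: le_trans (h T x); rewrite ler_wpM2l// ler_weXn2l// br_ge1.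
by rewrite ler_wpM2l ?(maj_ge0 M).
Qed.

Let qbase_bnd j T : bnd m (strip T) eps (fun x => eps * D (Fr j T) x).
Proof.
have [mF _ _] := hF (or_introl (erefl (Fr j))).
split.
  apply: measurable_funM => //; apply: measurable_funM; first exact: oppr_measurable.
  exact: (measurableT_comp (mF T) (@oppr_measurable R setT)).
move=> x; rewrite normrM (gtr0_norm eps0) ler_pM2l// /D normrM normrN.
have := @F_le j (Fr j) 1 T (- x) (or_introl erefl) isT.
rewrite (maj_even M) wtN brN expr1; apply: le_trans.
by rewrite mulrC ler_wpM2l// /br lerDl.
Qed.

Lemma zbase_fam : stfam 1 zbase.
Proof.
have fF j F : F = Fr j \/ F = Fv j -> fam 1 F.
  move=> h; have [mF _ cF] := hF h; split => // T; split => // x.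
  by have := F_le T x h (leq0n 3); rewrite expr0 mulr1 mul1r.
move=> j; split; [by apply: (fF j); left| |by apply: (fF j); right].
split => [T|x]; first exact: (bnd_mono M eps1 (qbase_bnd j T)).
have [_ _ cF] := hF (or_introl (erefl (Fr j))).
by move=> T; apply: cvgMl_tmp; apply: cvgMl_tmp; exact: cF.
Qed.

(* what the Whitham flow fails to satisfy: [eps q*_XX + (q*^2)_X] with [q* = eps r*_X] *)
Definition source (j : bool) (T x : R) : R :=
  - (eps * x ^+ 2) * sq (zbase T) j x + D (star (sq (zbase T) j) (sq (zbase T) j)) x.

(** Here the three derivatives of the Whitham profile are spent, one in [q*] and two in the
    dispersive term; the power [br ^+ 3] pays for them. *)
Lemma source_fam j : fam1 d0 (source j).
Proof.
have [_ qf _] := zbase_fam j.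
split => [T|x T]; last first.
  apply: cvgD; first by apply: cvgMl_tmp; exact: qf.2.
  apply: cvgMl_tmp.
  exact: (star_continuous M ler01 ler01 (fam_cst_bnd M Tm0 kappa0 s00 s0_le ler01 qf) (fam_cst_bnd M Tm0 kappa0
    s00 s0_le ler01 qf) qf.2 qf.2 (x := - x)).
have sp := strip_gt0 Tm0 kappa0 s00 s0_le T.
have e0 := ltW eps0.
have [_ _ b] := star_bnd M (ltW sp) e0 e0 (qbase_bnd j T) (qbase_bnd j T).
have b2 : bnd1 m (strip T) (eps ^+ 2) (fun x => - (eps * x ^+ 2) * sq (zbase T) j x).
  split; first by apply: measurable_funM; [apply: measurableT_comp => //; apply: measurable_funM => //;
    exact: measurable_funX|exact: (qf.1 T).1].
  move=> x; rewrite /= normrM normrN !normrM (gtr0_norm eps0) normrN.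
  have := @F_le j (Fr j) 3 T (- x) (or_introl erefl) isT.
  rewrite (maj_even M) wtN brN => h.
  have bx : `|x| <= br x by rewrite /br lerDl.
  have x2 : `|x| * `|x| * `|x| <= br x ^+ 3.
    by rewrite -expr2 -exprSr lerXn2r// nnegrE// ltW// br_gt0.
  have h2 : `|x| * `|x| * `|x| * `|Fr j T (- x)| <= m x * wt (- strip T) x.
    by apply: le_trans h; rewrite mulrC ler_wpM2l.
  apply: (@le_trans _ _ (eps ^+ 2 * (m x * wt (- strip T) x))).
    rewrite (_ : _ * _ * _ = eps ^+ 2 * (`|x| * `|x| * `|x| * `|Fr j T (- x)|)); last by ring.
    by rewrite ler_wpM2l// sqr_ge0.
  by rewrite ler_wpM2l ?sqr_ge0// ler_peMl ?mwt_ge0 ?br_ge1//; exact: (mwt_ge0 M).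
have := bnd1D b2 (bnd_D M _ b); rewrite !mulr_ge0// => /(_ isT).
by rewrite (_ : eps ^+ 2 + _ = d0)//; rewrite /d0; ring.
Qed.

Definition src1 (z : R -> state) j T x := N1 (add_state (zbase T) (z T)) j x - N1 (zbase T) j x.
Definition srcq (z : R -> state) j T x := Nq (add_state (zbase T) (z T)) j x - Nq (zbase T) j x.
(** [N2] at the base contains the derivative of the square of [q*], absent from the Whitham
    equation; [source] restores it together with the dispersive term of [q*]. *)
Definition src2 (z : R -> state) j T x :=
  (N2 gam alpha (add_state (zbase T) (z T)) j x - N2 gam alpha (zbase T) j x) + source j T x.

(** The [r] component uses the velocity just computed, not the previous one. The same velocity then
    drives [q] and [r], which keeps [q = eps r_X] exact at every iteration. *)
Definition duhamel_map (z : R -> state) (T : R) : state :=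
  State (fun j x => primclip Tm (fun s => src1 z j s x - D (solv (srcq z j) (src2 z j) s) x) T)
    (fun j => solq (srcq z j) (src2 z j) T) (fun j => solv (srcq z j) (src2 z j) T).

Let N_lip2 d z w : 0 <= d -> stfam 2 z -> stfam 2 w -> stfam d (fun T => sub_state (z T) (w T)) -> forall j,
  [/\ fam1 (K * d) (fun T x => N1 (z T) j x - N1 (w T) j x),
      fam1 (K * d) (fun T x => Nq (z T) j x - Nq (w T) j x) &
      fam1 (K * d) (fun T x => N2 gam alpha (z T) j x - N2 gam alpha (w T) j x)].
Proof.
move=> dd zf wf zw j.
exact: (stfam_N_lip M Tm0 kappa0 s00 s0_le gam alpha _ dd zf wf zw).
Qed.

Let add_fam z : stfam 1 z -> stfam 2 (fun T => add_state (zbase T) (z T)).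
Proof. by move=> zf; have := stfamD zbase_fam zf; rewrite -natr1. Qed.

Lemma src_fam (d : R) z j : 0 <= d -> d <= 1 -> stfam d z ->
  [/\ fam1 (K * d) (src1 z j), fam1 (K * d) (srcq z j) & fam1 (K * d + d0) (src2 z j)].
Proof.
move=> dd d1 zf; have zf1 := stfam_mono M d1 zf.
have b2 : stfam 2 zbase by apply: (stfam_mono M _ zbase_fam); rewrite ler1n.
have E : (fun T => sub_state (add_state (zbase T) (z T)) (zbase T)) = z.
  apply/funext => T; rewrite /sub_state /add_state /=; case: (z T) => r q v /=.
  by congr State; apply/funext => i; apply/funext => x; rewrite addrAC subrr add0r.
have [|l1 l2 l3] := N_lip2 dd (add_fam zf1) b2 _ j; first by rewrite E.
by split => //; exact: fam1D l3 (source_fam j).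
Qed.

Lemma src_sub_fam (d : R) z w j : 0 <= d -> stfam 1 z -> stfam 1 w ->
  stfam d (fun T => sub_state (z T) (w T)) ->
  [/\ fam1 (K * d) (fun T x => src1 z j T x - src1 w j T x),
      fam1 (K * d) (fun T x => srcq z j T x - srcq w j T x) &
      fam1 (K * d) (fun T x => src2 z j T x - src2 w j T x)].
Proof.
move=> dd zf wf zw.
have E : (fun T => sub_state (add_state (zbase T) (z T)) (add_state (zbase T) (w T))) = (fun T => sub_state (z T) (w T)).
  apply/funext => T; rewrite /sub_state /add_state /=.
  by congr State; apply/funext => i; apply/funext => x; rewrite opprD addrACA subrr add0r.
have [|l1 l2 l3] := N_lip2 dd (add_fam zf) (add_fam wf) _ j; first by rewrite E.
split.
- by move: l1; congr fam1; apply/funext => T; apply/funext => x; rewrite /src1; ring.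
- by move: l2; congr fam1; apply/funext => T; apply/funext => x; rewrite /srcq; ring.
- by move: l3; congr fam1; apply/funext => T; apply/funext => x; rewrite /src2; ring.
Qed.

Let kinv : 8 * (K + 1) * kappa^-1 <= 1.
Proof. by rewrite ler_pdivrMr// mul1r. Qed.

(* gain of the contraction: two velocities bounded by sources, then the density *)
Let gain (c : R) : 0 <= c -> 2 * (K * c + (K * c)) / kappa <= c / 2 /\ (K * c + c / 2) / kappa <= c / 2.
Proof.
move=> c0; have ki : 0 < kappa^-1 by rewrite invr_gt0.
have h := ler_wpM2r c0 kinv; rewrite mul1r in h.
have h1 : 0 <= c * kappa^-1 by rewrite mulr_ge0// ltW.
have h2 : 0 <= K * (c * kappa^-1) by rewrite mulr_ge0.
by split; lra.
Qed.

(** [r] comes last: its source contains the derivative of the new velocity, whose difference has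
    already been halved. *)
Lemma duhamel_map_sub_fam (d : R) z w : 0 <= d -> stfam 1 z -> stfam 1 w ->
  stfam d (fun T => sub_state (z T) (w T)) ->
  stfam (d / 2) (fun T => sub_state (duhamel_map z T) (duhamel_map w T)).
Proof.
move=> dd zf wf zw j.
have [l1 lq l2] := src_sub_fam j dd zf wf zw.
have [z1 zq z2] := src_fam j ler01 (lexx 1) zf.
have [w1 wq w2] := src_fam j ler01 (lexx 1) wf.
have [g1 g2] := gain dd.
have Kd : 0 <= K * d by rewrite mulr_ge0.
have [fq fv] := sol_fam M Tm0 kappa0 eps Kd Kd lq l2.
have Eq T x := (sol_sub Tm eps zq.2 z2.2 wq.2 w2.2 T x).1.
have Ev T x := (sol_sub Tm eps zq.2 z2.2 wq.2 w2.2 T x).2.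
have fq' : fam (d / 2) (fun T x => solq (srcq z j) (src2 z j) T x - solq (srcq w j) (src2 w j) T x).
  apply: (fam_mono M g1); move: fq; congr fam; apply/funext => T; apply/funext => x; exact: Eq.
have fv' : fam (d / 2) (fun T x => solv (srcq z j) (src2 z j) T x - solv (srcq w j) (src2 w j) T x).
  apply: (fam_mono M g1); move: fv; congr fam; apply/funext => T; apply/funext => x; exact: Ev.
split => //=.
have d2 : 0 <= d / 2 by rewrite divr_ge0.
have := fam_primclip M Tm0 kappa0 _ (fam1B l1 (fam_D M d2 fv')).
rewrite addr_ge0// => /(_ isT)/(fam_mono M g2); congr fam; apply/funext => T; apply/funext => x.
have KK : 0 <= K * 1 + d0 by rewrite addr_ge0// mulr_ge0.
have K1 : 0 <= K * 1 by rewrite mulr_ge0.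
have [_ sz] := sol_fam M Tm0 kappa0 eps K1 KK zq z2.
have [_ sw] := sol_fam M Tm0 kappa0 eps K1 KK wq w2.
rewrite -primclip_sub.
- by congr (primclip _ _ _); apply/funext => s; rewrite D_sub; ring.
- by move=> s; apply: cvgB; [exact: z1.2|apply: cvgMl_tmp; exact: sz.2].
- by move=> s; apply: cvgB; [exact: w1.2|apply: cvgMl_tmp; exact: sw.2].
Qed.

(** The source contributes one more [d0]; the ball is preserved since [2 (2 K + 1) <= kappa]. *)
Lemma duhamel_map_fam z : stfam d0 z -> stfam d0 (duhamel_map z).
Proof.
move=> zf j.
have [l1 lq l2] := src_fam j d00 d0_le1 zf.
have Kd : 0 <= K * d0 by rewrite mulr_ge0.
have Kd' : 0 <= K * d0 + d0 by rewrite addr_ge0.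
have [fq fv] := sol_fam M Tm0 kappa0 eps Kd Kd' lq l2.
have ki : 0 < kappa^-1 by rewrite invr_gt0.
have h := ler_wpM2r d00 kinv; rewrite mul1r in h.
have h1 : 0 <= d0 * kappa^-1 by rewrite mulr_ge0// ltW.
have h2 : 0 <= K * (d0 * kappa^-1) by rewrite mulr_ge0.
have g1 : 2 * (K * d0 + (K * d0 + d0)) / kappa <= d0 by lra.
have fq' := fam_mono M g1 fq; have fv' := fam_mono M g1 fv.
split => //.
have := fam_primclip M Tm0 kappa0 _ (fam1B l1 (fam_D M d00 fv')).
by rewrite addr_ge0// => /(_ isT); apply: (fam_mono M); lra.
Qed.

Definition zzero (T : R) : @state R := mk_state (fun _ _ _ => 0).
Definition iterate (n : nat) : R -> state := iter n duhamel_map zzero.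

Lemma zzero_fam : stfam d0 zzero.
Proof.
have f0 : fam d0 (fun _ _ => 0).
  split => [T|x T]; last exact: cvg_cst.
  by split; [exact: measurable_cst|move=> x; rewrite normr0 mulr_ge0//; exact: (mwt_ge0 M)].
by move=> j; split.
Qed.

Lemma iterate_fam n : stfam d0 (iterate n).
Proof. by elim: n => [|n IH]; [exact: zzero_fam|exact: duhamel_map_fam]. Qed.

Let d40 : 0 <= 4 * d0. Proof. exact: mulr_ge0 (ler0n _ 4) d00. Qed.

Let c40 n : 0 <= 4 * d0 / 2 ^+ n. Proof. by apply: divr_ge0 => //; exact: exprn_ge0. Qed.

Let f1 n : stfam 1 (iterate n). Proof. exact: (stfam_mono M d0_le1 (iterate_fam n)). Qed.

(** The initial difference is at most [2 d0], and each later one is halved. *)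
Lemma iterate_step n : stfam (4 * d0 / 2 ^+ n.+1) (fun T => sub_state (iterate n.+1 T) (iterate n T)).
Proof.
elim: n => [|n IH].
  have := stfamB (iterate_fam 1) (iterate_fam 0); rewrite expr1.
  by rewrite (_ : d0 + d0 = 4 * d0 / 2)//; field.
have c0 := c40 n.+1.
have := duhamel_map_sub_fam c0 (f1 n.+1) (f1 n) IH.
by rewrite (_ : _ / 2 = 4 * d0 / 2 ^+ n.+2)// [in RHS]exprS invfM; ring.
Qed.

Lemma stfamP (C : R) z : stfam C z <-> forall k j, fam C (fun T => state_comp k (z T) j).
Proof.
split; first by move=> h [[]|] j; have [] := h j.
by move=> h j; split; [exact: (h None j)|exact: (h (Some false) j)|exact: (h (Some true) j)].
Qed.

Lemma state_comp_sub k (z w : @state R) j x : state_comp k (sub_state z w) j x = state_comp k z j x - state_comp k w j x.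
Proof. by case: k => [[]|]. Qed.

Definition zlim (T : R) : state := mk_state (fun k j x => limn (fun n => state_comp k (iterate n T) j x)).

Let zlim_cvg k j T x :
  state_comp k (iterate n T) j x @[n --> \oo] --> state_comp k (zlim T) j x /\
  forall n, `|state_comp k (zlim T) j x - state_comp k (iterate n T) j x| <= 4 * d0 * (m x * wt (- strip T) x) / 2 ^+ n.
Proof.
rewrite state_comp_mk; apply: geo_cauchy => n; rewrite -state_comp_sub.
have := (stfamP _ _).1 (iterate_step n) k j => -[/(_ T)[_ /(_ x)] + _].
by rewrite mulrAC.
Qed.

(** Continuity in time survives because, at each frequency, the convergence is uniform in time. *)
Lemma zlim_fam : stfam d0 zlim.
Proof.
apply/stfamP => k j; have fi n := (stfamP _ _).1 (iterate_fam n) k j.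
split => [T|x T].
  split.
    apply: (@measurable_fun_cvg _ _ _ _ (fun n => state_comp k (iterate n T) j)) => [n|x _].
      exact: ((fi n).1 T).1.
    exact: (zlim_cvg k j T x).1.
  move=> x; apply: (@cvg_le_cst _ (fun n => `|state_comp k (iterate n T) j x|)).
    by move=> n; exact: ((fi n).1 T).2.
  by apply: cvg_norm; exact: (zlim_cvg k j T x).1.
apply/cvgrPdist_le => e e0.
have e3 : 0 < e / 3 by rewrite divr_gt0.
move/cvgrPdist_le : (half_pow_cvg (4 * d0 * m x)) => /(_ _ e3)[n _ /(_ n (leqnn n))/=].
rewrite sub0r normrN => /(le_trans (ler_norm _)) hn.
have near U : `|state_comp k (zlim U) j x - state_comp k (iterate n U) j x| <= e / 3.
  apply: (le_trans ((zlim_cvg k j U x).2 n)); apply: le_trans hn.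
  have w1 : m x * wt (- strip U) x <= m x.
    rewrite ler_piMr ?(maj_ge0 M)//.
    by apply: wt_le1; apply: ltW; exact: (strip_gt0 Tm0 kappa0 s00 s0_le).
  by rewrite ler_wpM2r ?invr_ge0 ?exprn_ge0// ler_wpM2l.
have := (fi n).2 x T; move/cvgrPdist_le => /(_ _ e3); apply: filterS => U hU.
have n1 := near T; have n2 := near U.
rewrite (_ : _ - _ = (state_comp k (zlim T) j x - state_comp k (iterate n T) j x) + (state_comp k (iterate n T)
  j x - state_comp k (iterate n U) j x) - (state_comp k (zlim U) j x - state_comp k (iterate n U) j x));
  last by ring.
apply: (le_trans (ler_normB _ _)); apply: (le_trans (lerD (ler_normD _ _) (lexx _))); lra.
Qed.

Let zlim1 : stfam 1 zlim. Proof. exact: (stfam_mono M d0_le1 zlim_fam). Qed.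

Lemma zlim_near n : stfam (4 * d0 / 2 ^+ n) (fun T => sub_state (zlim T) (iterate n T)).
Proof.
apply/stfamP => k j.
have [fb fc] := (stfamP _ _).1 (stfamB zlim_fam (iterate_fam n)) k j.
split => // T; split; first exact: (fb T).1.
move=> x; rewrite state_comp_sub; apply: (le_trans ((zlim_cvg k j T x).2 n)).
by rewrite mulrAC.
Qed.

(** The images of the iterates converge to the limit and, by the contraction estimate, to its
    image. *)
Lemma zlim_fix T j : sr (zlim T) j = sr (duhamel_map zlim T) j /\ sv (zlim T) j = sv (duhamel_map zlim T) j.
Proof.
suff E k : state_comp k (zlim T) j = state_comp k (duhamel_map zlim T) j by split;
  [exact: (E None)|exact: (E (Some true))].
apply/funext => x.
have l1 : state_comp k (iterate n.+1 T) j x @[n --> \oo] --> state_comp k (zlim T) j x.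
  by rewrite (cvg_shiftS (fun n => state_comp k (iterate n T) j x)); exact: (zlim_cvg k j T x).1.
suff l2 : state_comp k (iterate n.+1 T) j x @[n --> \oo] --> state_comp k (duhamel_map zlim T) j x.
  by apply: (cvg_unique _ l1 l2); exact: norm_hausdorff.
have dist n : `|state_comp k (duhamel_map zlim T) j x - state_comp k (iterate n.+1 T) j x| <= (2 * d0 * (m x *
  wt (- strip T) x)) / 2 ^+ n.
  have c0 := c40 n.
  have := (stfamP _ _).1 (duhamel_map_sub_fam c0 zlim1 (f1 n) (zlim_near n)) k j => -[/(_ T)[_ /(_ x)] + _].
  rewrite state_comp_sub => h; apply: (le_trans h); rewrite le_eqVlt; apply/orP; left; apply/eqP; field.
  by rewrite expf_neq0.
apply/cvgrPdist_le => e e0.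
move/cvgrPdist_le : (half_pow_cvg (2 * d0 * (m x * wt (- strip T) x))) => /(_ _ e0); apply: filterS => n.
by rewrite sub0r normrN => /(le_trans (ler_norm _)); apply: le_trans.
Qed.

Lemma src_qD z : stfam 1 z -> (forall T j x, sq (z T) j x = eps * D (sr (z T) j) x) ->
  forall T j x, srcq z j T x = eps * D (src1 z j T) x.
Proof.
move=> zf zq T j x; have sp := strip_gt0 Tm0 kappa0 s00 s0_le T.
rewrite /srcq (Nq_N1 (eps := eps) M sp (ler0n _ 2) (stfam_stbnd T (add_fam zf))); last first.
  by apply/funext => y /=; rewrite zq /D; ring.
rewrite (Nq_N1 (eps := eps) M sp ler01 (stfam_stbnd T zbase_fam))//.
by rewrite /src1 /D; ring.
Qed.

(** At each frequency the difference of the two sides starts from 0 and has zero time derivative. *)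
Lemma duhamel_map_qD z : stfam d0 z -> (forall T j x, sq (z T) j x = eps * D (sr (z T) j) x) ->
  forall T j x, sq (duhamel_map z T) j x = eps * D (sr (duhamel_map z T) j) x.
Proof.
move=> zf zq T j x.
have zf1 := stfam_mono M d0_le1 zf.
have [l1 lq l2] := src_fam j d00 d0_le1 zf.
have Kd : 0 <= K * d0 by rewrite mulr_ge0.
have Kd' : 0 <= K * d0 + d0 by rewrite addr_ge0.
have [_ fv] := sol_fam M Tm0 kappa0 eps Kd Kd' lq l2.
have cr y : continuous (fun s => src1 z j s y - D (solv (srcq z j) (src2 z j) s) y).
  by move=> s; apply: cvgB; [exact: l1.2|apply: cvgMl_tmp; exact: fv.2].
pose f S := solq (srcq z j) (src2 z j) S x + (- (eps * - x)) * primclip Tm (fun s =>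
  src1 z j s (- x) - D (solv (srcq z j) (src2 z j) s) (- x)) S.
suff h S : S \in `[0, Tm] -> f S = 0.
  have cI := clip_itv T Tm0; have := h _ cI.
  rewrite /f -primclip_clip// -sol_clip// => /eqP; rewrite mulNr subr_eq0 => /eqP E.
  by rewrite [LHS]E /D mulrA.
apply: htd_cst0 => //.
  by rewrite /f primclip0// mulr0 addr0 (sol0 Tm0 eps _ _ x).1.
move=> U UI.
have [h1 _] := sol_htd eps lq.2 l2.2 x UI.
have h2 := htdZ (c := - (eps * - x)) (primclip_htd (@cr (- x)) UI).
have := htdD h1 h2; congr has_time_derivative.
by rewrite (src_qD zf1 zq) /D opprK; ring.
Qed.

Lemma iterate_qD n T j x : sq (iterate n T) j x = eps * D (sr (iterate n T) j) x.
Proof.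
elim: n T j x => [|n IH] T j x; first by rewrite /= /D !mulr0.
by apply: duhamel_map_qD => //; exact: iterate_fam.
Qed.

Lemma zlim_qD T j x : sq (zlim T) j x = eps * D (sr (zlim T) j) x.
Proof.
have l1 := (zlim_cvg (Some false) j T x).1; have l2 := (zlim_cvg None j T (- x)).1.
apply: (cvg_unique _ l1); first exact: norm_hausdorff.
rewrite /= (eq_cvg _ _ (fun n => iterate_qD n T j x)).
by apply: cvgMl_tmp; apply: cvgMl_tmp.
Qed.

Lemma zlim_htd T j x : T \in `[0, Tm] ->
  has_time_derivative Tm (fun S => sr (zlim S) j x) T (src1 zlim j T x - D (sv (zlim T) j) x) /\
  has_time_derivative Tm (fun S => sv (zlim S) j x) T (src2 zlim j T x - eps * x ^+ 2 * sq (zlim T) j x).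
Proof.
move=> TI.
have [l1 lq l2] := src_fam j d00 d0_le1 zlim_fam.
have Kd : 0 <= K * d0 by rewrite mulr_ge0.
have Kd' : 0 <= K * d0 + d0 by rewrite addr_ge0.
have [_ fv] := sol_fam M Tm0 kappa0 eps Kd Kd' lq l2.
have cr y : continuous (fun s => src1 zlim j s y - D (solv (srcq zlim j) (src2 zlim j) s) y).
  by move=> s; apply: cvgB; [exact: l1.2|apply: cvgMl_tmp; exact: fv.2].
have Er S := (zlim_fix S j).1; have Ev S := (zlim_fix S j).2.
have Eq : sq (zlim T) j x = solq (srcq zlim j) (src2 zlim j) T x.
  have := duhamel_map_qD zlim_fam zlim_qD T j x; rewrite -Er -zlim_qD => <-.
  by [].
split.
  rewrite (_ : (fun S => sr (zlim S) j x) = (fun S => sr (duhamel_map zlim S) j x)); last by apply/funext => S; rewrite Er.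
  rewrite Ev; exact: (primclip_htd (@cr x) TI).
rewrite Eq; have [_ h] := sol_htd eps lq.2 l2.2 x TI.
rewrite (_ : (fun S => sv (zlim S) j x) = (fun S => sv (duhamel_map zlim S) j x)); last by apply/funext => S; rewrite Ev.
by rewrite addrC -mulNr.
Qed.

End Picard.

(** * The dispersive solution *)

Section RightHandSides.
Context {R : realType}.

Lemma htd_V (Tm C : R) (f g : R -> R -> R) (m : R -> R) (X : R) : 0 < Tm -> intg m ->
  (forall T, T \in `[0, Tm] -> intg (f T)) ->
  (forall T, T \in `[0, Tm] -> forall x, has_time_derivative Tm (fun S => f S x) T (g T x) /\ `|g T x| <= C * m x) ->
  forall T, T \in `[0, Tm] -> has_time_derivative Tm (fun S => V (f S) X) T (V (g T) X).
Proof.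
move=> Tm0 mi fi fg T TI.
apply: (@htd_under_itg R Tm (fun T x => f T x * cas (x * X)) (fun T x => g T x * cas (x * X)) (fun x =>
  2 * (C * m x))) => //.
- by do 2 apply: intgZ.
- by move=> S SI; apply: intg_cas; exact: fi.
- move=> S SI x; have [h gC] := fg S SI x; split.
    have := htdZ (c := cas (x * X)) h; rewrite [g S x * _]mulrC; apply: htd_eq => // U _.
    by rewrite mulrC.
  by rewrite normrM mulrC; apply: ler_pM => //; exact: cas_le2.
Qed.

Variables (A : R) (m : R -> R).
Hypothesis M : majorant A m.

(** Half of the remaining width pays for a derivative; repeated finitely often, this gives the
    classical X-derivatives of a fixed function. *)
Lemma bnd_D_half (s C : R) f : 0 < s -> 0 <= C -> bnd m s C f -> bnd m (s / 2) (C * (s / 2)^-1) (D f).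
Proof.
move=> s0 C0 fb; have s20 : 0 < s / 2 by rewrite divr_gt0.
have [mD hD] := bnd_D M C0 fb; split => // x.
apply: (le_trans (hD x)); rewrite -mulrA ler_wpM2l//.
have -> : wt (- s) x = wt (- (s / 2)) x * wt (- (s / 2)) x by rewrite -wtD; congr (wt _ x); field.
rewrite (_ : br x * _ = (m x * wt (- (s / 2)) x) * (br x * wt (- (s / 2)) x)); last by ring.
by rewrite mulrC ler_wpM2r ?(mwt_ge0 M)//; exact: br_wt_le.
Qed.

Lemma V_derive1n (k : nat) (s C : R) f : 0 < s -> 0 <= C -> bnd m s C f ->
  derive1n k (V f) = V (iter k D f) /\ exists s' C', [/\ 0 < s', 0 <= C' & bnd m s' C' (iter k D f)].
Proof.
move=> s0 C0 fb; elim: k => [|k [IH [s' [C' [s'0 C'0 b]]]]]; first by split => //; exists s, C.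
split.
  by rewrite derive1nS; apply/funext => X; rewrite IH /= (bnd_V_D M X s'0 C'0 b).2.
exists (s' / 2), (C' * (s' / 2)^-1); split; first by rewrite divr_gt0.
  by rewrite mulr_ge0// invr_ge0 divr_ge0// ltW.
exact: bnd_D_half.
Qed.

Lemma V_derivable_n (k : nat) (s C : R) f X : 0 < s -> 0 <= C -> bnd m s C f ->
  derivable (derive1n k (V f)) X 1.
Proof.
move=> s0 C0 fb; have [-> [s' [C' [s'0 C'0 b]]]] := V_derive1n k s0 C0 fb.
exact: (bnd_V_D M X s'0 C'0 b).1.
Qed.

Section States.
Variables (s C : R).
Hypotheses (s0 : 0 < s) (C0 : 0 <= C).
Variables (gam : bool -> R) (alpha eps : R).

Let intg1 D' f : 0 <= D' -> bnd1 m s D' f -> intg f. Proof. exact: (bnd1_intg M s0). Qed.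

Lemma V_rhs_r (zb zt : state) j X : stbnd m s C zb -> stbnd m s C zt ->
  V (fun x => (N1 zt j x - N1 zb j x) - (D (sv zt j) x - D (sv zb j) x)) X =
  (- 2 * (V (sv zt j) X * derive1 (V (sr zt j)) X) - derive1 (V (sv zt j)) X) -
  (- 2 * (V (sv zb j) X * derive1 (V (sr zb j)) X) - derive1 (V (sv zb j)) X).
Proof.
move=> bb bt.
have K0 : 0 <= lip_cst gam alpha A s C * C by rewrite mulr_ge0 ?(lip_cst_ge0 gam alpha M).
have [b1 _ _] := N_bnd gam alpha M j s0 (lexx s) C0 bb.
have [t1 _ _] := N_bnd gam alpha M j s0 (lexx s) C0 bt.
have [_ _ bv] := bb j; have [_ _ tv] := bt j.
have i1 := intg1 K0 b1; have i2 := intg1 K0 t1.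
have i3 := intg1 C0 (bnd_D M C0 bv); have i4 := intg1 C0 (bnd_D M C0 tv).
rewrite VB; [|exact: intgB|exact: intgB]; rewrite !VB//.
rewrite (V_N1 M j X s0 C0 bb) (V_N1 M j X s0 C0 bt) (bnd_V_D M X s0 C0 bv).2 (bnd_V_D M X s0 C0 tv).2.
ring.
Qed.

Lemma V_N2_expand (z : state) j X : stbnd m s C z ->
  V (N2 gam alpha z j) X = 2 * V (sq z j) X * derive1 (V (sq z j)) X - 2 * V (sv z j) X * derive1 (V (sv z j)) X +
   (2 * gam j * expR (2 * V (sr z j) X) * derive1 (V (sr z j)) X +
    2 * alpha * expR (2 * V (sr z (~~ j)) X) * derive1 (V (sr z (~~ j))) X).
Proof.
move=> zb; rewrite (V_N2 gam alpha M j X s0 C0 zb).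
have [rb qb vb] := zb j; have [rb' _ _] := zb (~~ j).
by rewrite derive_flux//;
  [exact: (bnd_V_D M X s0 C0 qb).1|exact: (bnd_V_D M X s0 C0 vb).1|exact: (bnd_V_D M X s0 C0 rb).1|exact:
    (bnd_V_D M X s0 C0 rb').1].
Qed.

(** [D] applied twice is multiplication by [- x^2], which turns the rotation term into [eps] times
    the second derivative of [q]. *)
Lemma V_rhs_v (zb zt : state) j X : stbnd m s C zb -> stbnd m s C zt ->
  V (fun x => (N2 gam alpha zt j x - N2 gam alpha zb j x) + D (star (sq zb j) (sq zb j)) x
     + (- (eps * x ^+ 2) * sq zt j x)) X =
  V (N2 gam alpha zt j) X - V (N2 gam alpha zb j) X + 2 * V (sq zb j) X * derive1 (V (sq zb j)) X
  + eps * derive1n 2 (V (sq zt j)) X.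
Proof.
move=> bb bt.
have K0 : 0 <= lip_cst gam alpha A s C * C by rewrite mulr_ge0 ?(lip_cst_ge0 gam alpha M).
have [_ _ b1] := N_bnd gam alpha M j s0 (lexx s) C0 bb.
have [_ _ t1] := N_bnd gam alpha M j s0 (lexx s) C0 bt.
have [_ qb _] := bb j; have [_ qt _] := bt j.
have i1 := intg1 K0 b1; have i2 := intg1 K0 t1.
have [v1 v2 bs] := star_bnd M (ltW s0) C0 C0 qb qb.
have A0 := maj_A M.
have A20 : 0 <= 2 * A * (C * C) by rewrite !mulr_ge0.
have i3 := intg1 A20 (bnd_D M A20 bs).
have [E [s' [C' [s'0 C'0 b2]]]] := V_derive1n 2 s0 C0 qt.
have i4 := bnd_intg M (ltW s'0) C'0 b2.
have ED : (fun x => - (eps * x ^+ 2) * sq zt j x) = (fun x => eps * iter 2 D (sq zt j) x).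
  by apply/funext => x; rewrite /= /D opprK; ring.
rewrite VD; [|by apply: intgD => //; exact: intgB|by rewrite ED; exact: intgZ].
rewrite VD//; last exact: intgB.
rewrite VB// ED VZ// -E; congr (_ + _ + _).
rewrite -(bnd_V_D M X s0 A20 bs).2.
have iq := bnd_intg M (ltW s0) C0 qb.
rewrite V_star// derive1E.
have [/derivableP dq _] := bnd_V_D M X s0 C0 qb.
rewrite derive1E.
have := @derive_val _ _ _ X 1 (fun X => V (sq zb j) X * V (sq zb j) X) (2 * V (sq zb j) X * 'D_1 (V (sq zb j)) X).
by apply; apply: is_derive_eq; rewrite /GRing.scale/=; ring.
Qed.

End States.

End RightHandSides.

(** * Return to Gevrey spaces and to the equation in physical space *)

Section ProfileRegularity.
Context {R : realType}.
Variables (A : R) (m : R -> R).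
Hypothesis M : majorant A m.

Lemma bnd_gevrey (s sigma C : R) (f : R -> R) : 0 <= sigma -> sigma <= s -> 0 <= C -> bnd m s C f ->
  [/\ intg f, sqi (fun x => f x * wt sigma x) &
      itg (fun x => (f x * wt sigma x) ^+ 2) <= (C * Num.sqrt A) ^+ 2].
Proof.
move=> s0 ss C0 fb; have sp := le_trans s0 ss.
have wb : bnd m 0 C (fun x => f x * wt sigma x).
  split; first by apply: measurable_funM; [exact: fb.1|exact: measurable_wt].
  move=> x; have w0 := wt_gt0 sigma x; rewrite normrM (gtr0_norm w0).
  apply: (le_trans (ler_wpM2r (ltW w0) (fb.2 x))).
  rewrite -!mulrA ler_wpM2l// ler_wpM2l ?(maj_ge0 M)// -wtD; apply: wt_mono; lra.
have [h1 h2] := bnd_sqi M (lexx 0) C0 wb.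
split => //; first exact: (bnd_intg M sp C0 fb).
by rewrite exprMn sqr_sqrtr// (maj_A M).
Qed.

Lemma gevrey_norm_ge0 n (s sigma : R) (w : R -> 'cV[R]_n) : (0 <= gevrey_norm s sigma w)%E.
Proof. by rewrite /gevrey_norm; case: ifP => _; [exact: Lnorm_ge0|exact: leey]. Qed.

(** Continuity at each frequency becomes continuity in norm by dominated convergence, a multiple of
    the integrable [m ^+ 2] dominating the squared differences. *)
Lemma profile_gevrey_continuous (sigma s Tm C : R) (w : R -> R -> 'cV[R]_4) (H : 'I_4 -> R -> R -> R) :
  0 <= sigma -> sigma <= s -> 0 <= C -> (forall i T, bnd m s C (H i T)) ->
  (forall i x, continuous (fun T => H i T x)) ->
  (forall T, T \in `[0, Tm] -> forall i, component i (w T) = V (H i T)) ->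
  gevrey_continuous 0 sigma Tm w.
Proof.
move=> s0 ss C0 Hb Hc wE T TI.
have K0 : 0 <= C * Num.sqrt A by rewrite mulr_ge0// sqrtr_ge0.
have g i S := bnd_gevrey s0 ss C0 (Hb i S).
split.
  rewrite /in_gevrey; apply: (@le_lt_trans _ _ (Num.sqrt (4 * pi * 4%:R) * (C * Num.sqrt A))%:E); last exact: ltry.
  apply: (@gevrey_norm_le R 4 sigma (w T) (fun i => H i T)) => //.
  - exact: wE.
  - by move=> i; have [] := g i T.
  - by move=> i; have [] := g i T.
  - by move=> i; have [] := g i T.
pose e i S := itg (fun x => ((H i S x - H i T x) * wt sigma x) ^+ 2).
pose c S := Num.sqrt (\sum_i e i S).
have e0 i S : 0 <= e i S by apply: itg_ge0 => x; exact: sqr_ge0.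
have C20 : 0 <= C + C by rewrite addr_ge0.
have gd i S := bnd_gevrey s0 ss C20 (bndB (Hb i S) (Hb i T)).
have eT i : e i T = 0.
  have := itgZ 0 (maj_intg M); rewrite mul0r => E; rewrite -[RHS]E; apply: eq_itg => x.
  by rewrite subrr !mul0r expr0n.
have ecv i : e i S @[S --> T] --> e i T.
  apply: cvg_seq_at => u uT.
  have [||||_ //] := @itg_dct R (fun n x => ((H i (u n) x - H i T x) * wt sigma x) ^+ 2)
    (fun x => ((H i T x - H i T x) * wt sigma x) ^+ 2) (fun x => (C + C) ^+ 2 * m x ^+ 2).
  - by move=> n; apply: measurable_funX; have [_ [h _] _] := gd i (u n).
  - move=> n x; rewrite ger0_norm ?sqr_ge0// -exprMn -[leLHS]real_normK ?num_real// lerXn2r ?nnegrE//.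
      by rewrite mulr_ge0 ?(maj_ge0 M).
    have w0 := wt_gt0 sigma x; rewrite normrM (gtr0_norm w0).
    apply: (le_trans (ler_wpM2r (ltW w0) ((bndB (Hb i (u n)) (Hb i T)).2 x))).
    rewrite -mulrA ler_wpM2l// -mulrA ler_piMr ?(maj_ge0 M)// -wtD.
    rewrite wtE -[leRHS]expR0 ler_expR mulr_le0_ge0 ?(ltW (br_gt0 _))//; lra.
  - by apply: intgZ; exact: (maj_sqi M).2.
  - move=> x; rewrite (eq_cvg _ _ (fun n => expr2 _)) expr2.
    have h : (H i (u n) x - H i T x) * wt sigma x @[n --> \oo] --> (H i T x - H i T x) * wt sigma x.
      apply: cvgMr_tmp; apply: cvgB; last exact: cvg_cst.
      exact: cvg_at_seq (Hc i x T) uT.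
    exact: cvgM.
have ccv : c S @[S --> T] --> 0.
  have -> : 0 = c T :> R by rewrite /c big1 ?sqrtr0// => i _; exact: eT.
  apply: (@continuous_comp _ _ _ (fun S => \sum_i e i S) Num.sqrt); last exact: sqrt_continuous.
  have : forall r : seq 'I_4, (\sum_(i <- r) e i S) @[S --> T] --> \sum_(i <- r) e i T.
    elim=> [|i r IH]; first by rewrite big_nil; under eq_fun do rewrite big_nil; exact: cvg_cst.
    by rewrite big_cons; under eq_fun do rewrite big_cons; apply: cvgD.
  exact.
have bnd_norm S : S \in `[0, Tm] -> (gevrey_norm 0 sigma (w S \- w T)%R <= (Num.sqrt (4 * pi * 4%:R) * c S)%:E)%E.
  move=> SI.
  have se0 : 0 <= \sum_i e i S by apply: sumr_ge0 => i _; exact: e0.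
  apply: (@gevrey_norm_le R 4 sigma _ (fun i x => H i S x - H i T x)) => //.
  - move=> i; apply/funext => X; rewrite VB; [|by have [] := g i S|by have [] := g i T].
    by rewrite -!wE// /component !mxE.
  - by move=> i; have [] := gd i S.
  - by move=> i; have [] := gd i S.
  - by move=> i; rewrite /c sqr_sqrtr// (bigD1 i)//= lerDl sumr_ge0.
  - exact: sqrtr_ge0.
have cv : (Num.sqrt (4 * pi * 4%:R) * c S)%:E @[S --> within `[0, Tm] (nbhs T)] --> 0%E.
  have ccv' : c S @[S --> within `[0, Tm] (nbhs T)] --> 0 by exact: cvg_within_filter ccv.
  have ccv2 : Num.sqrt (4 * pi * 4%:R) * c S @[S --> within `[0, Tm] (nbhs T)] --> 0.
    by rewrite -[X in _ --> X](mulr0 (Num.sqrt (4 * pi * 4%:R))); apply: cvgMl_tmp.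
  by apply: cvg_EFin; [exact: nearW|exact: ccv2].
apply: (squeeze_cvge _ (cvg_cst 0%E) cv).
rewrite near_withinE; apply: nearW => S SI; rewrite gevrey_norm_ge0/=; exact: bnd_norm.
Qed.

Lemma dispersive_rowE (w : R -> 'cV[R]_4) (X : R) (j : bool) :
  dispersive_term w X (ri j) 0 = 0 /\
  dispersive_term w X (vi j) 0 = dispersive_scalar (component (ri j) w) X.
Proof. by rewrite !mxE; case: j. Qed.

Lemma V_scaled_derivative (eps : R) (k : nat) (s C : R) f : 0 < s -> 0 <= C -> bnd m s C f ->
  forall X, derive1n k (V (fun x => eps * D f x)) X = eps * derive1n k.+1 (V f) X.
Proof.
move=> s0 C0 fb X.
have s20 : 0 < s / 2 by rewrite divr_gt0.
have C20 : 0 <= C * (s / 2)^-1 by rewrite mulr_ge0// invr_ge0 ltW.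
have fD := bndZ eps (bnd_D_half M s0 C0 fb).
have [-> _] := V_derive1n M k s20 (mulr_ge0 (normr_ge0 eps) C20) fD.
have [-> [s' [C' [s'0 C'0 b]]]] := V_derive1n M k.+1 s0 C0 fb.
have bi := bnd_intg M (ltW s'0) C'0 b.
transitivity (V (fun x => eps * iter k.+1 D f x) X); last by rewrite VZ.
congr (V _ X); elim: k {b fD bi} => [|k IH] //.
by rewrite [iter k.+1 D _]iterS IH; apply/funext => x; rewrite /= /D; ring.
Qed.

End ProfileRegularity.

Theorem theorem5p2 (R : realType) (gamma1 gamma2 alpha : R)
    (hgamma1 : gamma1 = -1 \/ gamma1 = 1)
    (hgamma2 : gamma2 = -1 \/ gamma2 = 1)
    (halpha : alpha <> 0)
    (hdet : gamma1 * gamma2 - alpha ^+ 2 <> 0)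
    (T0 sigma : R) (hT0 : 0 < T0) (hsigma : 0 < sigma)
    (ustar : R -> R -> 'cV[R]_4)
    (ustar_cont : gevrey_continuous 0 (2 * sigma) T0 ustar)
    (ustar_sol : whitham_solution gamma1 gamma2 alpha T0 ustar)
    (Cwh : R) (hCwh : 0 < Cwh)
    (ustar_bound : (gevrey_sup_norm 0 (2 * sigma) T0 ustar <= Cwh%:E)%E) :
  exists C2 T1 eps0 : R,
    [/\ 0 < C2, 0 < T1, T1 <= T0, 0 < eps0 &
      forall eps : R, 0 < eps -> eps < eps0 ->
        exists u : R -> R -> 'cV[R]_4,
          [/\ gevrey_continuous 0 sigma T1 u,
              dispersive_whitham_solution gamma1 gamma2 alpha eps T1 u &
              (gevrey_sup_norm 0 sigma T1 (fun T => u T \- ustar T)%R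
                 <= (C2 * eps ^+ 2)%:E)%E]].
Proof.
have [A [m [F [M hF]]]] := whitham_profiles hT0 hsigma hCwh ustar_sol ustar_bound.
pose gam := gamj gamma1 gamma2.
(* [rho] is the width of the Whitham profiles; the strip may shrink down to [s0], still above
   [sigma]. *)
pose rho := 3 * sigma / 2; pose s0 := 5 * sigma / 4.
have s00 : 0 < s0 by rewrite /s0; lra.
have ss0 : sigma <= s0 by rewrite /s0; lra.
pose K := lip_cst gam alpha A s0 2.
have K0 : 0 <= K by apply: (lip_cst_ge0 gam alpha M).
pose kappa := 8 * (K + 1).
have kappa0 : 0 < kappa by rewrite /kappa; lra.
(* The strip has shrunk by [kappa * T1 <= sigma / 4 = rho - s0] at the final time. *)
pose T1 := Num.min T0 (sigma / 4 / kappa).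
have T10 : 0 < T1 by rewrite lt_min hT0 !divr_gt0.
have T1T0 : T1 <= T0 by rewrite ge_min lexx.
have s0_le : s0 + kappa * T1 <= rho.
  have : kappa * T1 <= sigma / 4.
    by rewrite mulrC -ler_pdivlMr// ge_min lexx orbT.
  rewrite /s0 /rho; lra.
have A0 := maj_A M.
pose B := 1 + 2 * A.
have B1 : 1 <= B by rewrite /B; lra.
have Bp : 0 < B by lra.
(* The added 1 makes [C2] positive whatever the value of [A]. For [B >= 1], [eps < B^-1] gives both
   [eps <= 1] and [B * eps ^+ 2 <= 1]. *)
exists (Num.sqrt (4 * pi * 4%:R) * (B * Num.sqrt A) + 1), T1, B^-1; split => //.
- by rewrite ltr_wpDl// !mulr_ge0 ?sqrtr_ge0// ltW.
- by rewrite invr_gt0.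
move=> eps eps0 epsB.
have eps1 : eps <= 1 by rewrite (le_trans (ltW epsB))// invf_le1.
have d0_le1 : (1 + 2 * A) * eps ^+ 2 <= 1.
  rewrite -/B expr2 mulrA mulr_ile1 ?mulr_ge0 ?(ltW eps0) ?(ltW Bp)//.
  by rewrite mulrC -ler_pdivlMr// mul1r ltW.
pose d0 := (1 + 2 * A) * eps ^+ 2.
have d00 : 0 <= d0 by rewrite mulr_ge0 ?sqr_ge0// ltW.
pose Fr (j : bool) := F (ri j); pose Fv (j : bool) := F (vi j).
have hFj (j : bool) G : G = Fr j \/ G = Fv j ->
  [/\ forall T, measurable_fun [set: R] (G T),
      forall T x, `|G T x| * br x ^+ 3 <= m x * wt (- rho) x &
      forall x, continuous (fun T => G T x)].
  by case=> ->; [have [] := hF (ri j)|have [] := hF (vi j)].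
pose z := zlim T1 gam alpha eps Fr Fv.
have T10' := ltW T10.
have kK : 8 * (K + 1) <= kappa by [].
have zfam : stfam m rho kappa T1 d0 z := zlim_fam M T10' kappa0 s00 s0_le kK eps0 eps1 hFj d0_le1.
have zqD : forall T j x, sq (z T) j x = eps * D (sr (z T) j) x :=
  zlim_qD M T10' kappa0 s00 s0_le kK eps0 eps1 hFj d0_le1.
have zhtd := zlim_htd M T10' kappa0 s00 s0_le kK eps0 eps1 hFj d0_le1.
have bfam : stfam m rho kappa T1 1 (zbase eps Fr Fv) := zbase_fam M T10' kappa0 eps0 eps1 hFj.
pose zt T := add_state (zbase eps Fr Fv T) (z T).
have tfam : stfam m rho kappa T1 2 zt.
  have := stfamD bfam (stfam_mono M d0_le1 zfam); rewrite (_ : 1 + 1 = 2)//.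
have low C w : 0 <= C -> stfam m rho kappa T1 C w -> forall T, stbnd m s0 C (w T).
  move=> C0 wf T j; have [[a _] [b _] [c _]] := wf j.
  have sl := strip_ge T10' kappa0 s0_le T.
  by split; [exact: (bnd_wmono M sl C0 (a T))|exact: (bnd_wmono M sl C0 (b T))|exact: (bnd_wmono M sl C0 (c T))].
have zb := low _ _ d00 zfam; have bb := low _ _ ler01 bfam; have tb := low _ _ (ler0n R 2) tfam.
pose G (i : 'I_4) (T : R) : R -> R := if i == ir1 then sr (z T) false else if i == ir2 then sr (z T) true else
  if i == iv1 then sv (z T) false else sv (z T) true.
have Gr j T : G (ri j) T = sr (z T) j by case: j.
have Gv j T : G (vi j) T = sv (z T) j by case: j.
have Gr' j : G (ri j) = (fun T => sr (z T) j) by apply/funext => T; exact: Gr.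
have Gv' j : G (vi j) = (fun T => sv (z T) j) by apply/funext => T; exact: Gv.
have Gb : forall i T, bnd m s0 d0 (G i T).
  by apply: index4 => j; split => T; rewrite ?Gr ?Gv; have [] := zb T j.
have Gc : forall i x, continuous (fun T => G i T x).
  apply: index4 => j; have [[_ a] _ [_ c]] := zfam j; split => x T.
    rewrite (_ : (fun T => G (ri j) T x) = (fun T => sr (z T) j x)); first exact: a.
    by apply/funext => U; rewrite Gr.
  rewrite (_ : (fun T => G (vi j) T x) = (fun T => sv (z T) j x)); first exact: c.
  by apply/funext => U; rewrite Gv.
have Fb i T : bnd m s0 1 (F i T).
  move: i T; apply: index4 => j; split => T; have [a b c] := bb T j; [exact: a|exact: c].
have Gi i T : intg (G i T) := bnd_intg M (ltW s00) d00 (Gb i T).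
have Fi i T : intg (F i T) := bnd_intg M (ltW s00) ler01 (Fb i T).
(* The perturbation is added to [ustar] itself, so that the time derivative given by the Whitham
   equation can be used as it stands. *)
pose u (T X : R) : 'cV[R]_4 := ustar T X + \col_i V (G i T) X.
have uE T X i : u T X i 0 = ustar T X i 0 + V (G i T) X by rewrite !mxE.
pose H i T x := F i T x + G i T x.
have Hb i T : bnd m s0 2 (H i T).
  have := bndD (Fb i T) (bnd_mono M d0_le1 (Gb i T)); rewrite (_ : 1 + 1 = 2)//.
have T1I T : T \in `[0, T1] -> T \in `[0, T0].
  by rewrite !in_itv/= => /andP[-> h]; exact: le_trans h T1T0.
have ucomp T : T \in `[0, T1] -> forall i, component i (u T) = V (H i T).
  move=> /T1I TI i; have [_ _ _ /(_ T TI) E] := hF i.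
  by apply/funext => X; rewrite /H VD// -E /component uE.
exists u; split.
- apply: (profile_gevrey_continuous M (ltW hsigma) ss0 (ler0n R 2) Hb _ ucomp).
  by move=> i x T; apply: cvgD; [have [_ _ h _] := hF i; exact: h|exact: Gc].
- move=> T X TI.
  have TI0 := T1I T TI.
  have Hr j : H (ri j) T = sr (zt T) j by apply/funext => x; rewrite /H Gr.
  have Hv j : H (vi j) T = sv (zt T) j by apply/funext => x; rewrite /H Gv.
  have ur j : component (ri j) (u T) = V (sr (zt T) j) by rewrite ucomp// Hr.
  have uv j : component (vi j) (u T) = V (sv (zt T) j) by rewrite ucomp// Hv.
  have br_ j : component (ri j) (ustar T) = V (sr (zbase eps Fr Fv T) j) by have [_ _ _ /(_ T TI0)] := hF (ri j).
  have bv_ j : component (vi j) (ustar T) = V (sv (zbase eps Fr Fv T) j) by have [_ _ _ /(_ T TI0)] := hF (vi j).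
  have der i k : (k < 3)%N -> derivable (derive1n k (component i (u T))) X 1.
    by move=> _; rewrite ucomp//; apply: V_derivable_n; [exact: M|exact: s00|exact: (ler0n R 2)|exact: Hb].
  have ux j : ustar T X (vi j) 0 = V (sv (zbase eps Fr Fv T) j) X by rewrite -bv_.
  have rx j : ustar T X (ri j) 0 = V (sr (zbase eps Fr Fv T) j) X by rewrite -br_.
  have utx j : u T X (vi j) 0 = V (sv (zt T) j) X by rewrite -uv.
  have rtx j : u T X (ri j) 0 = V (sr (zt T) j) X by rewrite -ur.
  have Kd : 0 <= K * d0 by rewrite mulr_ge0.
  have Kd' : 0 <= K * d0 + d0 by rewrite addr_ge0.
  have bb2 : stbnd m s0 2 (zbase eps Fr Fv T).
    by move=> j; have [a b c] := bb T j; split; apply: (bnd_mono M (ler1n R 2)).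
  (* Two powers of [br] absorb the multiplier [eps x^2], at the cost of the width [s0]; this
     dominates the rotation term uniformly in time. *)
  have [K2 K20 hK2] := br_exp_wt 2 s00.
  have uS i : (fun S => u S X i 0) = (fun S => ustar S X i 0 + V (G i S) X) by apply/funext => S; rewrite uE.
  have rhs i : (whitham_mx gamma1 gamma2 alpha (u T X) *m partialX (u T) X + eps ^+ 2 *: dispersive_term (u T) X) i 0
    = (whitham_mx gamma1 gamma2 alpha (u T X) *m partialX (u T) X) i 0 + eps ^+ 2 * dispersive_term (u T) X i 0.
    by rewrite [LHS]mxE [X in _ + X]mxE.
  apply: index4 => j; split; (split; first by move=> k; exact: der); rewrite uS rhs.
  (* The derivative of [ustar] comes from its equation in physical space, that of the perturbation
     from its profiles; in the sum the terms in [zbase] cancel. *)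
  - have h1 := htdW T1T0 (ustar_sol T X TI0 (ri j)).2.
    have [wr _] := whitham_rowE gamma1 gamma2 alpha (ustar T) X j.
    have [wru _] := whitham_rowE gamma1 gamma2 alpha (u T) X j.
    pose g S x := src1 eps Fr Fv z j S x - D (sv (z S) j) x.
    have h2 : has_time_derivative T1 (fun S => V (G (ri j) S) X) T (V (g T) X).
      apply: (@htd_V R T1 ((K * d0 + d0) * s0^-1) (G (ri j)) g m X T10 (maj_intg M)) => //.
      move=> S SI x; split; first by rewrite Gr'; have [h _] := zhtd S j x SI.
      have [s1 _ _] := src_fam M T10' kappa0 s00 s0_le gam alpha eps0 eps1 hFj j d00 d0_le1 zfam.
      have [_ _ zv] := zfam j.
      have [_ /(_ x)] := fam1_cst_bnd M T10' kappa0 s00 s0_le Kd' (fam1B s1 (fam_D M d00 zv)) S.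
      by rewrite oppr0 (wtE 0) mul0r expR0 mulr1.
    have := htdD h1 h2; congr (has_time_derivative _ _ _ _).
    have -> : g T = (fun x => (N1 (zt T) j x - N1 (zbase eps Fr Fv T) j x) - (D (sv (zt T) j) x - D (sv (zbase
      eps Fr Fv T) j) x)).
      by apply/funext => x; rewrite /g /src1 /zt /D /=; ring.
    rewrite (V_rhs_r M s00 (ler0n R 2) gam alpha j X bb2 (tb T)).
    rewrite wr wru (dispersive_rowE (u T) X j).1 ux utx !br_ !bv_ !ur !uv; ring.
  - have h1 := htdW T1T0 (ustar_sol T X TI0 (vi j)).2.
    have [_ wr] := whitham_rowE gamma1 gamma2 alpha (ustar T) X j.
    have [_ wru] := whitham_rowE gamma1 gamma2 alpha (u T) X j.
    pose g S x := src2 gam alpha eps Fr Fv z j S x - eps * x ^+ 2 * sq (z S) j x.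
    have h2 : has_time_derivative T1 (fun S => V (G (vi j) S) X) T (V (g T) X).
      apply: (@htd_V R T1 ((K * d0 + d0) * s0^-1 + K2 * d0) (G (vi j)) g m X T10 (maj_intg M)) => //.
      move=> S SI x; split; first by rewrite Gv'; have [_ h] := zhtd S j x SI.
      have [_ _ s2] := src_fam M T10' kappa0 s00 s0_le gam alpha eps0 eps1 hFj j d00 d0_le1 zfam.
      have [_ /(_ x)] := fam1_cst_bnd M T10' kappa0 s00 s0_le Kd' s2 S.
      rewrite oppr0 (wtE 0) mul0r expR0 mulr1 => hs2.
      rewrite mulrDl (le_trans (ler_normB _ _))// lerD//.
      have [_ [_ /(_ x) hq] _] := zb S j.
      have e1 : `|eps * x ^+ 2| <= K2 * wt s0 x.
        apply: le_trans (hK2 x); rewrite normrM (gtr0_norm eps0) normrX.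
        apply: (@le_trans _ _ (`|x| ^+ 2)); first by rewrite ler_piMl// exprn_ge0.
        by rewrite lerXn2r ?nnegrE ?(ltW (br_gt0 _))// /br lerDl.
      rewrite normrM; apply: (le_trans (ler_pM _ _ e1 hq)) => //.
      rewrite [leLHS](_ : _ = K2 * d0 * m x * (wt s0 x * wt (- s0) x)); last by ring.
      by rewrite -wtD subrr (wtE 0) mul0r expR0 mulr1.
    have := htdD h1 h2; congr (has_time_derivative _ _ _ _).
    have -> : g T = (fun x => (N2 gam alpha (zt T) j x - N2 gam alpha (zbase eps Fr Fv T) j x)
       + D (star (sq (zbase eps Fr Fv T) j) (sq (zbase eps Fr Fv T) j)) x + (- (eps * x ^+ 2) * sq (zt T) j x)).
      by apply/funext => x; rewrite /g /src2 /source /zt /=; ring.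
    rewrite (V_rhs_v M s00 (ler0n R 2) gam alpha eps j X bb2 (tb T)).
    rewrite (V_N2_expand M s00 (ler0n R 2) gam alpha j X (tb T)) (V_N2_expand M s00 (ler0n R 2) gam alpha j X bb2).
    (* With [q = eps r_X] for the full state, the terms in [q] become [eps ^+ 2] times
       [dispersive_scalar]. *)
    have Eq : sq (zt T) j = (fun x => eps * D (sr (zt T) j) x).
      apply/funext => x; transitivity (eps * D (Fr j T) x + sq (z T) j x) => //.
      by rewrite zqD -mulrDr /D -mulrDr.
    have [rt _ _] := tb T j.
    have VQ k := V_scaled_derivative M eps k s00 (ler0n R 2) rt X.
    rewrite Eq (VQ 2%N) -[derive1 (V (fun x => eps * D _ x)) X]/(derive1n 1 _ X) (VQ 1%N).
    rewrite -[V (fun x => eps * D _ x) X]/(derive1n 0 _ X) (VQ 0%N).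
    rewrite wr wru (dispersive_rowE (u T) X j).2 ux utx !rx !rtx !br_ !bv_ !ur !uv /dispersive_scalar.
    have dr2 : derivable (derive1n 1 (V (sr (zt T) j))) X 1.
      by apply: V_derivable_n; [exact: M|exact: s00|exact: (ler0n R 2)|exact: rt].
    have -> : derive1 (fun Y => derive1 (V (sr (zt T) j)) Y ^+ 2) X = 2 * derive1n 1 (V (sr (zt T) j)) X *
      derive1n 2 (V (sr (zt T) j)) X.
      move: dr2; rewrite -[derive1n 1 (V (sr (zt T) j))]/(derive1 (V (sr (zt T) j))).
      rewrite -[derive1n 2 (V (sr (zt T) j)) X]/(derive1 (derive1 (V (sr (zt T) j))) X).
      set w := derive1 (V _); rewrite !derive1E => /derivableP dr2.
      by apply: derive_val; apply: is_derive_eq; rewrite /GRing.scale/=; ring.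
    rewrite -[derive1n 1 (V (sr (zt T) j)) X]/(derive1 (V (sr (zt T) j)) X) /gam.
    clear.
    move: (derive1n 2 (V (sr (zt T) j)) X) (derive1n 3 (V (sr (zt T) j)) X) => a2 a3.
    move: (derive1 (V (sr (zt T) j)) X) (derive1 (V (sv (zt T) j)) X) => a1 b1.
    move: (derive1 (V (sr (zt T) (~~ j))) X) (derive1 (V (sr (zbase eps Fr Fv T) (~~ j))) X) => c1 c2.
    move: (derive1 (V (sr (zbase eps Fr Fv T) j)) X) (derive1 (V (sv (zbase eps Fr Fv T) j)) X) => e1 e2.
    move: (derive1 (V (sq (zbase eps Fr Fv T) j)) X) => e3.
    ring.
(* The difference [u - ustar] has the profiles [G], of size [d0 = B * eps ^+ 2] at a width above
   [sigma]. *)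
- apply: ge_ereal_sup => _ [T TI <-].
  apply: (@le_trans _ _ (Num.sqrt (4 * pi * 4%:R) * (d0 * Num.sqrt A))%:E); last first.
    rewrite lee_fin -subr_ge0 [leRHS](_ : _ = eps ^+ 2) ?sqr_ge0//.
    by rewrite /d0 /B; set a := Num.sqrt _; set b := Num.sqrt A; ring.
  have g i := bnd_gevrey M (ltW hsigma) ss0 d00 (Gb i T).
  apply: (@gevrey_norm_le R 4 sigma _ (fun i => G i T)) => //.
  + exact: ltW.
  + by move=> i; apply/funext => X; rewrite /component !mxE addrAC subrr add0r.
  + by move=> i; have [] := g i.
  + by move=> i; have [] := g i.
  + by rewrite mulr_ge0// sqrtr_ge0.
Qed.
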